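(* Let $d \geq 0$ and $l \geq 2$ be integers. Then $\mathcal{S}(d,l) = \emptyset$ if $d < l-1$, and \[\dim \mathcal{S}(d,l) = \begin{cases} \binom{d+2}{2}-1 & \text{if } d \geq l-1 \text{ and } l \in \{2,3,4\},\\ \binom{d+2}{2}-2 & \text{if } d = 4 \text{ and } l = 5,\\ \binom{d+2}{2}-1 & \text{if } d \geq 5 \text{ and } l = 5,\\ \binom{d+2}{2}-\binom{l}{2}+2l-1 & \text{if } d \geq l-1 \text{ and } l \geq 6. \end{cases}\]
   Context: Let $k$ be an algebraically closed field and $S = k[x_0,x_1,x_2]$, with $S_d$ its space of degree-$d$ forms and $\mathbb{P}S_d \cong \mathbb{P}^{\binom{d+2}{2}-1}$ the space of plane curves of degree $d$. For $l \geq 2$, let $\mathcal{D}_l \subseteq (\check{\mathbb{P}}^2)^l$ be the quasi-projective variety of $l$-tuples of distinct lines $(\ell_1,\dots,\ell_l)$ in $\mathbb{P}^2$ such that no three of them pass through a common point. For such a tuple, the star configuration $\mathbb{X}(l)$ is the set of the $\binom{l}{2}$ points $\ell_i \cap \ell_j$, $1 \le i<j \le l$. Define the incidence correspondence $\Sigma_{d,l} = \{(\mathcal{C}, (\ell_1,\dots,\ell_l)) \in \mathbb{P}S_d \times \mathcal{D}_l : \mathcal{C} \supseteq \mathbb{X}(l)\}$, let $\phi_{d,l}:\Sigma_{d,l}\to \mathbb{P}S_d$ be the projection, and let $\mathcal{S}(d,l) = \phi_{d,l}(\Sigma_{d,l})$, the locus of degree-$d$ plane curves containing some star configuration $\mathbb{X}(l)$.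 Its dimension means the dimension of its Zariski closure in $\mathbb{P}S_d$. *)

(* Defs.v *)
From HB Require Import structures.
From mathcomp Require Import all_boot all_order all_algebra.
From mathcomp Require Import mpoly.
Set Implicit Arguments. Unset Strict Implicit. Unset Printing Implicit Defensive.
Import GRing.Theory.
Local Open Scope ring_scope.

(* A subset of P(K^n) is represented by its affine cone: a predicate on     *)
(* vectors of K^n (only nonzero vectors are considered points).             *)
Section Proj.
Variables (K : fieldType) (n : nat).

Definition vnz (v : 'I_n -> K) : Prop := exists i, v i != 0.

Definition hom_poly (p : {mpoly K[n]}) : Prop :=
  exists e : nat, forall m, m \in msupp p -> mdeg m = e.

Definition pzero (P : {mpoly K[n]} -> Prop) : ('I_n -> K) -> Prop :=
  fun v => vnz v /\ forall p, P p -> p.@[v] = 0.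

Definition pclosed (Z : ('I_n -> K) -> Prop) : Prop :=
  exists P : {mpoly K[n]} -> Prop, (forall p, P p -> hom_poly p) /\
    forall v, Z v <-> pzero P v.

Definition psubset (Z1 Z2 : ('I_n -> K) -> Prop) : Prop :=
  forall v, Z1 v -> Z2 v.

Definition pstrict (Z1 Z2 : ('I_n -> K) -> Prop) : Prop :=
  psubset Z1 Z2 /\ exists v, Z2 v /\ ~ Z1 v.

Definition pirred (Z : ('I_n -> K) -> Prop) : Prop :=
  pclosed Z /\ (exists v, Z v) /\
  forall Z1 Z2, pclosed Z1 -> pclosed Z2 ->
    psubset Z (fun v => Z1 v \/ Z2 v) -> psubset Z Z1 \/ psubset Z Z2.

Definition pclosure (S : ('I_n -> K) -> Prop) : ('I_n -> K) -> Prop :=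
  fun v => vnz v /\ forall p, hom_poly p ->
    (forall w, vnz w -> S w -> p.@[w] = 0) -> p.@[v] = 0.

Definition pchain (Z : ('I_n -> K) -> Prop) (r : nat) : Prop :=
  exists C : nat -> ('I_n -> K) -> Prop,
    (forall i, (i <= r)%N -> pirred (C i)) /\
    (forall i, (i < r)%N -> pstrict (C i) (C i.+1)) /\
    psubset (C r) Z.

Definition pdim_eq (S : ('I_n -> K) -> Prop) (r : nat) : Prop :=
  pchain (pclosure S) r /\ ~ pchain (pclosure S) r.+1.

End Proj.

(* Monomial x0^(d-a-b) x1^a x2^b is coded by (a,b), a + b <= d.            *)
(* A form of degree d is its coefficient vector in K^(nforms d).           *)
Definition mons (d : nat) : seq (nat * nat) :=
  [seq (a, b) | a <- iota 0 d.+1, b <- iota 0 (d.+1 - a)].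

Definition nforms (d : nat) : nat := size (mons d).

Section Curves.
Variable K : fieldType.

Definition eval_form (d : nat) (c : 'I_(nforms d) -> K) (x : 'I_3 -> K) : K :=
  \sum_(i < nforms d)
     let ab := nth (0%N, 0%N) (mons d) i in
     c i * x ord0 ^+ (d - ab.1 - ab.2) * x (inord 1) ^+ ab.1
         * x (inord 2) ^+ ab.2.

Definition on_line (a x : 'I_3 -> K) : Prop :=
  \sum_(i < 3) a i * x i = 0.

Definition same_pt (a b : 'I_3 -> K) : Prop :=
  exists t : K, t != 0 /\ forall i, a i = t * b i.

Definition concurrent (a b c : 'I_3 -> K) : Prop :=
  exists x, vnz x /\ on_line a x /\ on_line b x /\ on_line c x.

Definition in_D (l : nat) (L : 'I_l -> 'I_3 -> K) : Prop :=
  (forall i, vnz (L i)) /\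
  (forall i j, i != j -> ~ same_pt (L i) (L j)) /\
  (forall i j k : 'I_l, (i < j)%N -> (j < k)%N ->
      ~ concurrent (L i) (L j) (L k)).

Definition contains_star (d l : nat) (c : 'I_(nforms d) -> K)
  (L : 'I_l -> 'I_3 -> K) : Prop :=
  forall i j : 'I_l, (i < j)%N -> forall x, vnz x ->
    on_line (L i) x -> on_line (L j) x -> eval_form c x = 0.

Definition Sdl (d l : nat) : ('I_(nforms d) -> K) -> Prop :=
  fun c => vnz c /\ exists L : 'I_l -> 'I_3 -> K,
    in_D L /\ contains_star c L.

End Curves.

Definition expected_dim (d l : nat) : nat :=
  if (l <= 4)%N then ('C(d.+2, 2) - 1)%N
  else if l == 5 then (if d == 4 then ('C(d.+2, 2) - 2)%N else ('C(d.+2, 2) - 1)%N)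
  else ('C(d.+2, 2) - 'C(l, 2) + 2 * l - 1)%N.

(* Main.v *)
(* Through the star configuration of fixed lines, passing through its binom(l,2) points imposes
   independent conditions in degree d >= l - 1 (products of the other lines separate the points),
   while a form of smaller degree through all of them is zero.  Together with the 2l parameters of
   the lines this parametrizes the cone over S(d,l) by binom(d+2,2) - binom(l,2) + 2l variables, and
   the question is whether the parametrization is generically finite.

   Dimensions are bounded by algebraic independence.  The equations separating the members of a
   chain of irreducible closed sets are independent on the parametrization, which bounds chains
   from above; conversely, freezing the parameters one after the other at generic values gives
   a chain as long as the number of independent coordinates of the generic curve.

   Independence is obtained by degeneration.  For d = l - 1 the curves are sum_i g_i prod_(j != i) l_j;
   for the few small l the lowest terms of chosen coefficients, for suitable weights of the parameters,
   are monomials with coefficient 1 or -1 and independent exponents, in every characteristic.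
   A further line close to x0 = 0 leads from l to l + 1, and adding a small form with prescribed
   restriction to x0 = 0 to x0 times the curve leads from d to d + 1.

   For d = 4 and l = 5 the fibres are infinite (Lueroth quartics): five general lines are tangent to
   a conic and so correspond to the roots of a binary quintic B, the quartic is the Bezoutian of B
   and of a binary quartic A, and every member of the pencil B + mu A gives five more lines. *)
Require Import Defs.
From HB Require Import structures.
From mathcomp Require Import all_boot all_order all_algebra.
From mathcomp Require Import mpoly.
From mathcomp Require Import zify ring.
From Stdlib Require Import Classical FunctionalExtensionality.
Set Implicit Arguments. Unset Strict Implicit. Unset Printing Implicit Defensive.
Import GRing.Theory.
Local Open Scope ring_scope.

(** * Polynomial functions *)

(** Dimension is defined by chains of closed sets, so every estimate goes through affine cones. A
    chain of r+1 members yields r+1 independent functions on the parameters, and n+1 independent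
    coordinates depending on n parameters and a scalar yield a chain of n+1 members; hence the shift
    by one between parameter counts and dimensions.

    The forms through a moving star form a vector space that varies with the lines. It is
    parametrized polynomially by projecting a basis at one tuple to the other tuples, with the
    denominator of the projection cleared.

    Degenerations leave the set of admissible tuples. They are carried out in families over
    arbitrary tuples of vectors, where coincident lines can serve as witnesses, and the identity
    principle brings independence back to generic normalized lines.

    A Jacobian computed on lowest terms would not cover all characteristics: for l = 6 the exponent
    matrix of the chosen monomials has determinant divisible by 2 and 5. Solving the monomial
    equations by extracting roots in K avoids this. *)

Section PolyFun.
Variable K : closedFieldType.

Lemma poly_nonroot (p : {poly K}) : p != 0 -> exists x, p.[x] != 0.
Proof. by move/closed_nonrootP => [x]; exists x. Qed.

Lemma poly_vanish (p g : {poly K}) :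
  g != 0 -> (forall x, g.[x] != 0 -> p.[x] = 0) -> p = 0.
Proof.
move=> g0 h; apply/eqP/negPn/negP => p0.
have /poly_nonroot[x] : p * g != 0 by rewrite mulf_neq0.
by rewrite hornerM mulf_eq0 negb_or => /andP[/eqP px /h].
Qed.

Lemma poly_vanishT (p : {poly K}) : (forall x, p.[x] = 0) -> p = 0.
Proof. by move=> h; apply: (@poly_vanish p 1); rewrite ?oner_neq0. Qed.

Lemma inj_points n : exists s : seq K, [/\ uniq s, 0 \notin s & size s = n].
Proof.
elim: n => [|n [s [us s0 ss]]]; first by exists [::].
have /poly_nonroot[x] : \prod_(a <- 0 :: s) ('X - a%:P) != 0.
  by rewrite monic_neq0 // monic_prod_XsubC.
rewrite -[_ != 0]/(~~ root _ x) root_prod_XsubC inE negb_or => /andP[x0 xs].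
by exists (x :: s); rewrite /= ?xs ?ss inE negb_or eq_sym x0.
Qed.

Section Fun.
Variable I : Type.
Implicit Types f g : (I -> K) -> K.

(* Over an infinite field, a function that is polynomial of bounded degree on every line is polynomial. *)
Definition linepoly e f := forall u v, exists2 q : {poly K},
  (size q <= e.+1)%N & forall t, f (fun i => u i + t * v i) = q.[t].

Definition polyfun f := exists e, linepoly e f.

Lemma linepolyW e e' f : (e <= e')%N -> linepoly e f -> linepoly e' f.
Proof. by move=> le h u v; have [q sq hq] := h u v; exists q => //; lia. Qed.

Lemma linepoly_const e c : linepoly e (fun=> c).
Proof.
move=> u v; exists c%:P => [|t]; last by rewrite hornerC.
by rewrite (leq_trans (size_polyC_leq1 c)).
Qed.

Lemma linepoly_coord i : linepoly 1 (fun y => y i).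
Proof.
move=> u v; exists ((u i)%:P + 'X * (v i)%:P) => [|t]; last by rewrite !hornerE.
rewrite (leq_trans (size_polyD _ _)) // geq_max (leq_trans (size_polyC_leq1 _)) //.
rewrite (leq_trans (size_polyMleq _ _)) // size_polyX.
by have := size_polyC_leq1 (v i); lia.
Qed.

Lemma linepolyD e f g : linepoly e f -> linepoly e g -> linepoly e (fun y => f y + g y).
Proof.
move=> hf hg u v; have [p sp hp] := hf u v; have [q sq hq] := hg u v.
exists (p + q) => [|t]; last by rewrite hp hq hornerD.
by rewrite (leq_trans (size_polyD _ _)) // geq_max sp.
Qed.

Lemma linepolyM e e' f g : linepoly e f -> linepoly e' g ->
  linepoly (e + e') (fun y => f y * g y).
Proof.
move=> hf hg u v; have [p sp hp] := hf u v; have [q sq hq] := hg u v.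
exists (p * q) => [|t]; last by rewrite hp hq hornerM.
by rewrite (leq_trans (size_polyMleq _ _)) //; lia.
Qed.

Lemma linepolyX e f k : linepoly e f -> linepoly (e * k) (fun y => f y ^+ k).
Proof.
move=> hf; elim: k => [|k IH]; first exact: linepoly_const.
have -> : (fun y => f y ^+ k.+1) = (fun y => f y * f y ^+ k).
  by apply: functional_extensionality => y; rewrite exprS.
by rewrite mulnS; apply: linepolyM.
Qed.

Lemma linepoly_sum e (T : Type) (r : seq T) (P : pred T) (F : T -> (I -> K) -> K) :
  (forall x, P x -> linepoly e (F x)) -> linepoly e (fun y => \sum_(x <- r | P x) F x y).
Proof.
move=> hF; elim: r => [|x r IH].
  have -> : (fun y => \sum_(x <- [::] | P x) F x y) = (fun=> 0).
    by apply: functional_extensionality => y; rewrite big_nil.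
  exact: linepoly_const.
have -> : (fun y => \sum_(x <- x :: r | P x) F x y) =
  (fun y => (if P x then F x y else 0) + \sum_(x <- r | P x) F x y).
  by apply: functional_extensionality => y; rewrite big_cons; case: ifP; rewrite ?add0r.
by apply: linepolyD => //; case Px: (P x); [apply: hF | apply: linepoly_const].
Qed.

Lemma linepoly_prod e (T : Type) (r : seq T) (F : T -> (I -> K) -> K) :
  (forall x, linepoly e (F x)) -> linepoly (size r * e) (fun y => \prod_(x <- r) F x y).
Proof.
move=> hF; elim: r => [|x r IH].
  have -> : (fun y => \prod_(x <- [::]) F x y) = (fun=> 1).
    by apply: functional_extensionality => y; rewrite big_nil.
  exact: linepoly_const.
have -> : (fun y => \prod_(x <- x :: r) F x y) =
  (fun y => F x y * \prod_(x <- r) F x y).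
  by apply: functional_extensionality => y; rewrite big_cons.
by rewrite mulSn; apply: linepolyM.
Qed.

Lemma polyfun_ext f g : f =1 g -> polyfun f -> polyfun g.
Proof. by move=> /functional_extensionality ->. Qed.

Lemma polyfunC c : polyfun (fun=> c).
Proof. by exists 0%N; apply: linepoly_const. Qed.

Lemma polyfun_coord i : polyfun (fun y => y i).
Proof. by exists 1%N; apply: linepoly_coord. Qed.

Lemma polyfunD f g : polyfun f -> polyfun g -> polyfun (fun y => f y + g y).
Proof.
move=> [e hf] [e' hg]; exists (e + e')%N; apply: linepolyD.
  by apply: linepolyW hf; lia.
by apply: linepolyW hg; lia.
Qed.

Lemma polyfunM f g : polyfun f -> polyfun g -> polyfun (fun y => f y * g y).
Proof. by move=> [e hf] [e' hg]; exists (e + e')%N; apply: linepolyM. Qed.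

Lemma polyfunN f : polyfun f -> polyfun (fun y => - f y).
Proof.
move=> hf; apply: (@polyfun_ext (fun y => -1 * f y)); first by move=> y; rewrite mulN1r.
by apply: polyfunM => //; apply: polyfunC.
Qed.

Lemma polyfunB f g : polyfun f -> polyfun g -> polyfun (fun y => f y - g y).
Proof. by move=> hf hg; apply: polyfunD => //; apply: polyfunN. Qed.

Lemma polyfunX f k : polyfun f -> polyfun (fun y => f y ^+ k).
Proof. by move=> [e hf]; exists (e * k)%N; apply: linepolyX. Qed.

Lemma polyfun_sum (T : Type) (r : seq T) (P : pred T) (F : T -> (I -> K) -> K) :
  (forall x, polyfun (F x)) -> polyfun (fun y => \sum_(x <- r | P x) F x y).
Proof.
move=> hF; elim: r => [|x r IH].
  by apply: (@polyfun_ext (fun=> 0)) (polyfunC _) => y; rewrite big_nil.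
apply: (@polyfun_ext (fun y => (if P x then F x y else 0) + \sum_(x <- r | P x) F x y)).
  by move=> y; rewrite big_cons; case: ifP; rewrite ?add0r.
by apply: polyfunD => //; case: (P x); [apply: hF | apply: polyfunC].
Qed.

Lemma polyfun_prod (T : Type) (r : seq T) (P : pred T) (F : T -> (I -> K) -> K) :
  (forall x, polyfun (F x)) -> polyfun (fun y => \prod_(x <- r | P x) F x y).
Proof.
move=> hF; elim: r => [|x r IH].
  by apply: (@polyfun_ext (fun=> 1)) (polyfunC _) => y; rewrite big_nil.
apply: (@polyfun_ext (fun y => (if P x then F x y else 1) * \prod_(x <- r | P x) F x y)).
  by move=> y; rewrite big_cons; case: ifP; rewrite ?mul1r.
by apply: polyfunM => //; case: (P x); [apply: hF | apply: polyfunC].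
Qed.

Lemma polyfun_meval n (q : {mpoly K[n]}) (F : 'I_n -> (I -> K) -> K) :
  (forall i, polyfun (F i)) -> polyfun (fun y => q.@[fun i => F i y]).
Proof.
move=> hF; apply: (@polyfun_ext
  (fun y => \sum_(m <- msupp q) q@_m * \prod_i F i y ^+ m i)).
  by move=> y; rewrite mevalE.
apply: polyfun_sum => m; apply: polyfunM; first exact: polyfunC.
by apply: polyfun_prod => i; apply: polyfunX.
Qed.

Lemma polyfun_det n (M : (I -> K) -> 'M[K]_n) :
  (forall i j, polyfun (fun y => M y i j)) -> polyfun (fun y => \det (M y)).
Proof.
move=> hM; apply: polyfun_sum => s; apply: polyfunM; first exact: polyfunC.
by apply: polyfun_prod => i; apply: hM.
Qed.

(** Identity principle: on the line joining [v] to [v0] both functions are polynomials in one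
    variable, and the one given by [g] is nonzero because of its value at [v0]. *)
Lemma polyfun_zero f g v0 : polyfun f -> polyfun g -> g v0 != 0 ->
  (forall v, g v != 0 -> f v = 0) -> forall v, f v = 0.
Proof.
move=> [e hf] [e' hg] gv0 h v.
have [p _ hp] := hf v (fun i => v0 i - v i); have [q _ hq] := hg v (fun i => v0 i - v i).
have q0 : q != 0.
  apply: contraNneq gv0 => q0; have := hq 1; rewrite q0 horner0 => <-.
  by apply/eqP; congr g; apply: functional_extensionality => i; ring.
have p0 : p = 0 by apply: (poly_vanish q0) => x; rewrite -hq -hp; apply: h.
have <- : f (fun i => v i + 0 * (v0 i - v i)) = f v.
  by congr f; apply: functional_extensionality => i; ring.
by rewrite hp p0 horner0.
Qed.

Lemma polyfun_nz_and f g : polyfun f -> polyfun g ->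
  (exists v, f v != 0) -> (exists v, g v != 0) -> exists v, f v != 0 /\ g v != 0.
Proof.
move=> hf hg [v fv] [w gw]; apply: NNPP => h.
suff f0 : forall v, f v = 0 by rewrite f0 eqxx in fv.
apply: (polyfun_zero hf hg gw) => x gx; apply/eqP/negPn/negP => fx.
by apply: h; exists x.
Qed.

Lemma polyfun_nz_prod (T : finType) (F : T -> (I -> K) -> K) :
  (forall x, polyfun (F x)) -> (forall x, exists v, F x v != 0) ->
  exists v, forall x, F x v != 0.
Proof.
move=> hF nF.
suff [v hv] : exists v, \prod_(x <- enum T) F x v != 0.
  exists v => x; have : x \in enum T by rewrite mem_enum.
  by move: hv; rewrite prodf_seq_neq0 => /allP H /H.
elim: (enum T) => [|x r IH].
  by exists (fun=> 0); rewrite big_nil oner_neq0.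
have [v [h1 h2]] := polyfun_nz_and (hF x) (@polyfun_prod _ r predT F hF) (nF x) IH.
by exists v; rewrite big_cons mulf_neq0.
Qed.

End Fun.

(** Only the behaviour on lines matters, so renaming, repeating or freezing variables needs no
    explicit polynomial. *)
Lemma polyfun_affine (I I' : Type) (f : (I -> K) -> K) (h : (I' -> K) -> I -> K) :
  polyfun f ->
  (forall u v, exists u' v', forall t i, h (fun j => u j + t * v j) i = u' i + t * v' i) ->
  polyfun (fun s => f (h s)).
Proof.
move=> [e hf] hh; exists e => u v; have [u' [v' E]] := hh u v.
have [q sq hq] := hf u' v'; exists q => // t; rewrite -hq; congr f.
by apply: functional_extensionality => i.
Qed.

Lemma polyfun_reindex (I I' : Type) (f : (I -> K) -> K) (s : I -> I') :
  polyfun f -> polyfun (fun y => f (fun i => y (s i))).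
Proof.
move=> hf; apply: (polyfun_affine (h := fun y i => y (s i)) hf) => u v.
by exists (fun i => u (s i)), (fun i => v (s i)).
Qed.

End PolyFun.

(** * Algebraic independence *)

Section Dense.
Variable K : closedFieldType.

Lemma digits_inj n B (m1 m2 : 'I_n -> nat) :
  (forall i, m1 i < B)%N -> (forall i, m2 i < B)%N ->
  (\sum_i m1 i * B ^ i = \sum_i m2 i * B ^ i)%N -> m1 =1 m2.
Proof.
elim: n m1 m2 => [|n IH] m1 m2 h1 h2; first by move=> _ [].
have E (m : 'I_n.+1 -> nat) : (\sum_i m i * B ^ i =
    m ord0 + (\sum_(i < n) m (lift ord0 i) * B ^ i) * B)%N.
  rewrite big_ord_recl expn0 muln1 big_distrl /=; congr (_ + _)%N.
  by apply: eq_bigr => i _; rewrite /bump /= add1n expnSr mulnA.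
rewrite !E => H.
have Em : m1 ord0 = m2 ord0.
  by rewrite -[LHS](modn_small (h1 _)) -[RHS](modn_small (h2 _)) -(modnMDl (\sum_(i < n) m1 (lift ord0 i) * B ^ i)%N)
    addnC H addnC modnMDl.
have B0 : (0 < B)%N by apply: leq_ltn_trans (h1 ord0).
have /IH {}IH : (\sum_(i < n) m1 (lift ord0 i) * B ^ i = \sum_(i < n) m2 (lift ord0 i) * B ^ i)%N.
  by apply/eqP; rewrite -(eqn_pmul2r B0); apply/eqP; lia.
move=> i; case: (unliftP ord0 i) => [j ->|-> //].
by apply: IH => k; [apply: h1 | apply: h2].
Qed.

(** Kronecker substitution: x_i = t^(B^i), with B = [msize q] beyond all exponents, keeps distinct
    monomials distinct by [digits_inj], so [q] becomes a nonzero polynomial in t. *)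
Lemma mpoly_nonroot n (q : {mpoly K[n]}) : q != 0 -> exists v, q.@[v] != 0.
Proof.
move=> q0.
pose wt (m : 'X_{1..n}) := (\sum_i m i * msize q ^ i)%N.
pose P := \sum_(m <- msupp q) q@_m *: 'X^(wt m) : {poly K}.
have hP t : P.[t] = q.@[fun i => t ^+ (msize q ^ i)].
  rewrite horner_sum mevalE; apply: eq_bigr => m _.
  rewrite hornerZ hornerXn; congr (_ * _).
  rewrite /wt (big_morph (fun k => t ^+ k) (exprD t) (expr0 t)).
  by apply: eq_bigr => i _; rewrite mulnC exprM.
have mB m : m \in msupp q -> forall i, (m i < msize q)%N.
  move=> /msize_mdeg_lt h i; apply: leq_ltn_trans h.
  by rewrite mdegE (bigD1 i) //= leq_addr.
suff /poly_nonroot[t] : P != 0 by rewrite hP => ?; exists (fun i => t ^+ (msize q ^ i)).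
have : mlead q \in msupp q by rewrite mlead_supp.
move=> hl; apply: contraTneq (hl) => P0; rewrite -mcoeff_eq0.
have -> : q@_(mlead q) = P`_(wt (mlead q)); last by rewrite P0 coef0.
rewrite coef_sum (bigD1_seq (mlead q)) ?msupp_uniq //= coefZ coefXn eqxx mulr1.
rewrite big_seq_cond big1 ?addr0 // => m /andP[hm ne].
rewrite coefZ coefXn; case: eqP => [E|_]; last by rewrite mulr0.
suff E2 : m = mlead q by rewrite E2 eqxx in ne.
apply/mnmP => i; move: E => /digits_inj E2.
by rewrite -E2 //; apply: mB.
Qed.

Lemma mpoly_vanish n (q : {mpoly K[n]}) : (forall v, q.@[v] = 0) -> q = 0.
Proof.
move=> h; apply/eqP/negPn/negP => /mpoly_nonroot[v].
by rewrite h eqxx.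
Qed.

(** Zariski density in affine space. For the image of a polynomial map it says that the components
    of the map are algebraically independent. *)
Definition dense n (X : ('I_n -> K) -> Prop) :=
  forall q : {mpoly K[n]}, (forall z, X z -> q.@[z] = 0) -> q = 0.

Lemma dense_sub n (X Y : ('I_n -> K) -> Prop) : (forall z, X z -> Y z) -> dense X -> dense Y.
Proof. by move=> h dX q hq; apply: dX => z /h /hq. Qed.

Lemma denseT n : dense (fun _ : 'I_n -> K => True).
Proof. by move=> q h; apply: mpoly_vanish => v; apply: h. Qed.

Lemma dense_open n (X : ('I_n -> K) -> Prop) (g : {mpoly K[n]}) :
  g != 0 -> dense X -> dense (fun z => X z /\ g.@[z] != 0).
Proof.
move=> g0 dX q hq; have : q * g = 0.
  apply: dX => z Xz; rewrite mevalM; case: (eqVneq g.@[z] 0) => [->|gz]; first by rewrite mulr0.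
  by rewrite hq ?mul0r.
by move/eqP; rewrite mulf_eq0 (negPf g0) orbF => /eqP.
Qed.

Definition join_fun n k (x : 'I_n -> K) (v : 'I_k -> K) (i : 'I_(n + k)) : K :=
  match split i with inl a => x a | inr b => v b end.

Lemma dense_prod n k (X : ('I_n -> K) -> Prop) (Y : ('I_k -> K) -> Prop) :
  dense X -> dense Y ->
  dense (fun z : 'I_(n + k) -> K => X (fun a => z (lshift k a)) /\ Y (fun b => z (rshift n b))).
Proof.
move=> dX dY q hq; apply: mpoly_vanish => z.
pose z1 a := z (lshift k a); pose z2 b := z (rshift n b).
have Ez : z = join_fun z1 z2.
  apply: functional_extensionality => i; rewrite /join_fun.
  by case: splitP => j E; congr z; apply: val_inj.
have J1 x v : (fun a => join_fun x v (lshift k a)) = x :> ('I_n -> K).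
  by apply: functional_extensionality => a; rewrite /join_fun (unsplitK (inl _ a)).
have J2 x v : (fun a => join_fun x v (rshift n a)) = v :> ('I_k -> K).
  by apply: functional_extensionality => a; rewrite /join_fun (unsplitK (inr _ a)).
pose qv (v : 'I_k -> K) : {mpoly K[n]} := q \mPo [tuple match split i with inl a => 'X_a | inr b => (v b)%:MP end | i < n + k].
have qvE v x : (qv v).@[x] = q.@[join_fun x v].
  rewrite comp_mpoly_meval; apply: meval_eq => i; rewrite tnth_mktuple /join_fun.
  by case: (split i) => j; rewrite ?mevalXU ?mevalC.
pose qx (x : 'I_n -> K) : {mpoly K[k]} := q \mPo [tuple match split i with inl a => (x a)%:MP | inr b => 'X_b end | i < n + k].
have qxE v x : (qx x).@[v] = q.@[join_fun x v].
  rewrite comp_mpoly_meval; apply: meval_eq => i; rewrite tnth_mktuple /join_fun.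
  by case: (split i) => j; rewrite ?mevalXU ?mevalC.
have qv0 v : Y v -> qv v = 0.
  by move=> Yv; apply: dX => x Xx; rewrite qvE; apply: hq; rewrite J1 J2.
have qx0 x : qx x = 0 by apply: dY => v Yv; rewrite qxE -qvE qv0 // meval0.
by rewrite Ez -qxE qx0 meval0.
Qed.

(* A relation q between the perturbed functions restricts, in lowest degree in t, to a relation
   between the leading values z. *)
Lemma dense_init n (X Z : ('I_n -> K) -> Prop) (w : 'I_n -> nat) :
  dense Z ->
  (forall z, Z z -> exists r : 'I_n -> {poly K}, exists2 g : {poly K}, g != 0 &
     forall t, g.[t] != 0 -> X (fun k => t ^+ w k * (z k + t * (r k).[t]))) ->
  dense X.
Proof.
move=> dZ hX q hq; apply/eqP/negPn/negP => q0.
pose wt (m : 'X_{1..n}) := (\sum_i m i * w i)%N.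
have hl : mlead q \in msupp q by rewrite mlead_supp.
have [m0 hm0 hmin] : exists2 m0, m0 \in msupp q & forall m, m \in msupp q -> (wt m0 <= wt m)%N.
  have ex : exists W, has (fun m => wt m == W) (msupp q).
    by exists (wt (mlead q)); apply/hasP; exists (mlead q).
  case: (ex_minnP ex) => W /hasP[m0 h0 /eqP E0] hW; exists m0 => // m hm.
  by rewrite E0; apply: hW; apply/hasP; exists m.
pose W := wt m0.
pose qW : {mpoly K[n]} := \sum_(m <- msupp q | wt m == W) q@_m *: 'X_[m].
have qW0 : qW != 0.
  apply: contraTneq (hm0) => E; rewrite -mcoeff_eq0.
  have -> : q@_m0 = qW@_m0; last by rewrite E mcoeff0.
  rewrite /qW raddf_sum /= big_mkcond (bigD1_seq m0) ?msupp_uniq //= eqxx mcoeffZ mcoeffX eqxx mulr1.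
  rewrite big1 ?addr0 // => m ne; case: ifP => // _.
  by rewrite mcoeffZ mcoeffX (negPf ne) mulr0.
suff : qW = 0 by move/eqP; rewrite (negPf qW0).
apply: dZ => z Zz; have [r [g g0 hr]] := hX _ Zz.
pose c k := (z k)%:P + 'X * r k.
(* [Q] is [q] at the perturbed point divided by t^W, W being the least weight in [q]; its value at t
   = 0 is the lowest part [qW] at [z]. *)
pose Q := \sum_(m <- msupp q) (q@_m)%:P * 'X^(wt m - W) * \prod_i c i ^+ m i.
have cE t k : (c k).[t] = z k + t * (r k).[t] by rewrite !hornerE.
have Q0 : Q = 0.
  apply: (@poly_vanish _ _ (g * 'X)); first by rewrite mulf_neq0 ?polyX_eq0.
  move=> t; rewrite hornerM hornerX mulf_eq0 negb_or => /andP[gt t0].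
  have := hq _ (hr _ gt); rewrite mevalE.
  have -> : \sum_(m <- msupp q) q@_m * \prod_i (t ^+ w i * (z i + t * (r i).[t])) ^+ m i
     = t ^+ W * Q.[t].
    rewrite /Q horner_sum big_distrr /= !big_seq; apply: eq_bigr => m hm.
    rewrite !hornerM hornerC hornerXn horner_prod !mulrA [t ^+ W * _]mulrC -!mulrA.
    congr (_ * _); rewrite mulrA -exprD subnKC ?hmin //.
    rewrite /wt (big_morph (fun k => t ^+ k) (exprD t) (expr0 t)) -big_split /=.
    by apply: eq_bigr => i _; rewrite exprMn -exprM mulnC horner_exp cE.
  by move/eqP; rewrite mulf_eq0 expf_eq0 (negPf t0) andbF /= => /eqP.
have := congr1 (fun p => p.[0]) Q0; rewrite horner0 => <-.
rewrite /qW raddf_sum /= big_mkcond horner_sum !big_seq; apply: eq_bigr => m hm.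
rewrite !hornerM hornerC hornerXn horner_prod expr0n subn_eq0 leqNgt ltn_neqAle hmin // andbT negbK eq_sym.
case: eqP => [E|_]; last by rewrite mulr0 mul0r.
rewrite mulr1 mevalZ mevalX; congr (_ * _); apply: eq_bigr => i _.
by rewrite horner_exp cE mul0r addr0.
Qed.

Lemma lin_dep (A G : finType) (M : A -> G -> K) : (#|G| < #|A|)%N ->
  exists2 c : A -> K, (exists a, c a != 0) & forall g, \sum_a c a * M a g = 0.
Proof.
move=> lt; pose MM : 'M[K]_(#|A|, #|G|) := \matrix_(i, j) M (enum_val i) (enum_val j).
have : kermx MM != 0.
  rewrite -mxrank_eq0 mxrank_ker subn_eq0 -ltnNge.
  by rewrite (leq_ltn_trans (rank_leq_col _)).
move/eqP; rewrite -row_matrixP.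
move=> h; have [i hi] : exists i, row i (kermx MM) != 0.
  apply: NNPP => hn; apply: h => i; rewrite row0; apply/eqP/negPn/negP => H.
  by apply: hn; exists i.
exists (fun a => row i (kermx MM) 0 (enum_rank a)).
  apply: NNPP => hn; move/eqP: hi; apply; apply/rowP => j; rewrite [RHS]mxE.
  apply/eqP/negPn/negP => H; apply: hn; exists (enum_val j); by rewrite enum_valK.
move=> g; have : row i (kermx MM) *m MM = 0 by rewrite -row_mul mulmx_ker row0.
move/rowP/(_ (enum_rank g)); rewrite [RHS]mxE mxE => H; apply: etrans H.
rewrite (reindex (@enum_val A predT)) /=; last by apply/onW_bij/enum_val_bij.
by apply: eq_bigr => a _; rewrite enum_valK (_ : MM a _ = M (enum_val a) g) ?[MM _ _]mxE ?enum_rankK.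
Qed.

Lemma grid_vanish m e (f : ('I_m -> K) -> K) (s : seq K) :
  linepoly e f -> uniq s -> (e < size s)%N ->
  (forall y, (forall i, y i \in s) -> f y = 0) -> forall y, f y = 0.
Proof.
move=> hf us ss h.
(* The coordinates are freed one at a time: those below [k] are arbitrary, the others still lie in
   [s]. In one coordinate, more than [e] zeros force a polynomial of degree at most [e] to
   vanish. *)
suff H k : (k <= m)%N -> forall y, (forall i : 'I_m, (k <= i)%N -> y i \in s) -> f y = 0.
  by move=> y; apply: (H m) => // i; rewrite leqNgt ltn_ord.
elim: k => [|k IH] km y hy; first by apply: h => i; apply: hy.
pose ik := Ordinal km; pose v (i : 'I_m) : K := (i == ik)%:R.
pose u (i : 'I_m) := if i == ik then 0 else y i.
have [q sq hq] := hf u v.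
have q0 : q = 0.
  apply: (roots_geq_poly_eq0 (rs := s)) => //; last by rewrite (leq_trans sq).
  apply/allP => t ts; rewrite rootE -hq; apply/eqP; apply: IH; first exact: ltnW.
  move=> i ki; rewrite /u /v; case: eqP => [_|ne]; first by rewrite add0r mulr1.
  rewrite mulr0 addr0; apply: hy; rewrite ltn_neqAle ki andbT.
  by apply: contra_notN ne => /eqP E; apply: val_inj; rewrite /= E.
have <- : f (fun i => u i + y ik * v i) = f y; last by rewrite hq q0 horner0.
congr f; apply: functional_extensionality => i; rewrite /u /v.
by case: eqP => [->|_]; rewrite ?add0r ?mulr1 ?mulr0 ?addr0.
Qed.

Lemma count_bound c m : exists2 B, (0 < B)%N & ((c * B) ^ m < B ^ m.+1)%N.
Proof.
exists (c ^ m).+1 => //; rewrite expnMn expnS ltn_pmul2r ?expn_gt0 //.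
Qed.

(** Siegel-type counting. There are B^n monomials in the f_k with exponents below B. On lines they
    have degree at most n e B, so a combination of them is zero once it vanishes on a grid with s =
    (n e + 1) B values per coordinate. For large B the s^m grid points are fewer than the monomials,
    and linear algebra gives a relation. *)
Lemma poly_dep n m (f : 'I_n -> ('I_m -> K) -> K) :
  (forall k, polyfun (f k)) -> (m < n)%N ->
  exists2 q : {mpoly K[n]}, q != 0 & forall y, q.@[fun k => f k y] = 0.
Proof.
move=> hf mn.
have [e he] : exists e, forall k, linepoly e (f k).
  have [E hE] : exists E : 'I_n -> nat, forall k, linepoly (E k) (f k).
    by apply: (@fin_all_exists _ (fun=> nat) (fun k e => linepoly e (f k))) => k; apply: hf.
  exists (\max_k E k)%N => k; apply: linepolyW (hE k); exact: leq_bigmax.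
have [B B0 hB] := count_bound (n * e).+1 m.
pose s := ((n * e).+1 * B)%N.
have [S [uS _ sS]] := inj_points K s.
pose A := {ffun 'I_n -> 'I_B}; pose G := {ffun 'I_m -> 'I_s}.
pose pt (g : G) (i : 'I_m) : K := S`_(g i).
have lt : (#|G| < #|A|)%N.
  rewrite !card_ffun !card_ord; apply: leq_trans (leq_trans hB _) => //.
  by rewrite leq_pexp2l.
have [c [a0 ca0] hc] := lin_dep (fun (a : A) (g : G) => \prod_k f k (pt g) ^+ a k) lt.
pose mm (a : A) : 'X_{1..n} := [multinom (a k : nat) | k < n].
exists (\sum_a c a *: 'X_[mm a]).
  apply: contraNneq ca0 => E.
  have <- : (\sum_a c a *: 'X_[mm a])@_(mm a0) = c a0; last by rewrite E mcoeff0.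
  rewrite raddf_sum /= (bigD1 a0) //= mcoeffZ mcoeffX eqxx mulr1 big1 ?addr0 // => a ne.
  rewrite mcoeffZ mcoeffX; case: eqP => [E2|_]; last by rewrite mulr0.
  case/eqP: ne; apply/ffunP => k; apply: val_inj.
  by have /mnmP/(_ k) := E2; rewrite !mnmE.
have ev y : (\sum_a c a *: 'X_[mm a]).@[fun k => f k y] = \sum_a c a * \prod_k f k y ^+ a k.
  rewrite raddf_sum /=; apply: eq_bigr => a _; rewrite mevalZ mevalX; congr (_ * _).
  by apply: eq_bigr => k _; rewrite mnmE.
move=> y; rewrite ev; move: y.
apply: (@grid_vanish m (n * (e * B)) _ S) => //; last first.
- have s0 : (0 < s)%N by rewrite /s muln_gt0.
  move=> y hy; pose g : G := [ffun i => insubd (Ordinal s0) (index (y i) S)].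
  have -> : y = pt g.
    apply: functional_extensionality => i; rewrite /pt ffunE val_insubd.
    have -> : (index (y i) S < s)%N by rewrite -[X in (_ < X)%N]sS index_mem.
    by rewrite nth_index.
  exact: hc.
- by rewrite sS /s; nia.
apply: linepoly_sum => a _.
rewrite -[X in linepoly X]add0n; apply: linepolyM; first exact: linepoly_const.
have -> : (fun y => \prod_k f k y ^+ a k) = (fun y => \prod_(k <- enum 'I_n) f k y ^+ a k).
  by apply: functional_extensionality => y; rewrite big_enum.
rewrite -[X in linepoly (X * _)](size_enum_ord n).
apply: linepoly_prod => k; apply: (@linepolyW _ _ (e * a k)); last exact: linepolyX.
by rewrite leq_mul2l (ltnW (ltn_ord _)) orbT.
Qed.

End Dense.

(** * Chains of irreducible closed sets *)

Section Chains.
Variable K : closedFieldType.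
Variable N : nat.
Implicit Types (p q : {mpoly K[N]}) (v w : 'I_N -> K) (Z : ('I_N -> K) -> Prop).

Lemma hom_poly_scale p : hom_poly p ->
  exists e, forall a v, p.@[fun j => a * v j] = a ^+ e * p.@[v].
Proof.
move=> [e he]; exists e => a v; rewrite !mevalE big_distrr /= !big_seq.
apply: eq_bigr => m /he <-; rewrite mulrCA mdegE; congr (_ * _).
rewrite (big_morph (fun k => a ^+ k) (exprD a) (expr0 a)) -big_split /=.
by apply: eq_bigr => i _; rewrite exprMn.
Qed.

Lemma hom_poly_pihomog e q : hom_poly (pihomog mdeg e q).
Proof. by exists e => m; apply/dhomogP; apply: pihomogP. Qed.

Lemma pihomog_sumE q : q = \sum_(e < msize q) pihomog mdeg e q.
Proof. exact: pihomog_partitionE. Qed.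

Lemma pihomog_scale e q a v :
  (pihomog mdeg e q).@[fun j => a * v j] = a ^+ e * (pihomog mdeg e q).@[v].
Proof.
rewrite !mevalE big_distrr /= !big_seq; apply: eq_bigr => m hm.
have E : mdeg m = e by have /dhomogP/(_ _ hm) := pihomogP mdeg e q.
rewrite -E mulrCA mdegE; congr (_ * _).
rewrite (big_morph (fun k => a ^+ k) (exprD a) (expr0 a)) -big_split /=.
by apply: eq_bigr => i _; rewrite exprMn.
Qed.

Lemma pihomog_large e q : (msize q <= e)%N -> pihomog mdeg e q = 0.
Proof.
move=> h; rewrite pihomogE big_seq_cond big1 // => m /andP[/msize_mdeg_lt lt /eqP E]; by move: lt; rewrite (E : mdeg m = e) ltnNge h.
Qed.

(** Along the line through 0 and [v], the values of the homogeneous components are the coefficients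
    of a polynomial in the scalar. *)
Lemma pihomog_vanish q v :
  (forall a, a != 0 -> q.@[fun j => a * v j] = 0) ->
  forall e, (pihomog mdeg e q).@[v] = 0.
Proof.
move=> h e; pose P := \poly_(e < msize q) (pihomog mdeg e q).@[v].
have P0 : P = 0.
  apply: (@poly_vanish _ _ 'X); first by rewrite polyX_eq0.
  move=> a; rewrite hornerX => /h; rewrite {1}[q]pihomog_sumE raddf_sum /= => <-.
  rewrite horner_poly; apply: eq_bigr => i _.
  by rewrite pihomog_scale mulrC.
case: (ltnP e (msize q)) => he; last by rewrite pihomog_large // meval0.
by have := coef_poly (msize q) (fun e => (pihomog mdeg e q).@[v]) e; rewrite -/P P0 coef0 he.
Qed.

Lemma vnz_scale a v : a != 0 -> vnz v -> vnz (fun j => a * v j).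
Proof. by move=> a0 [i vi]; exists i; rewrite mulf_neq0. Qed.

Lemma pclosed_scale Z a v : pclosed Z -> a != 0 -> Z v -> Z (fun j => a * v j).
Proof.
move=> [P [hP hZ]] a0 /hZ[v0 h]; apply/hZ; split; first exact: vnz_scale.
move=> p Pp; have [e ->] := hom_poly_scale (hP p Pp).
by rewrite h // mulr0.
Qed.

Lemma pclosed_vnz Z v : pclosed Z -> Z v -> vnz v.
Proof. by move=> [P [_ h]] /h[]. Qed.

Lemma pclosure_closed Z : pclosed (pclosure Z).
Proof.
exists (fun p => hom_poly p /\ forall w, vnz w -> Z w -> p.@[w] = 0).
split=> [p []//|v]; split=> [[v0 h]|[v0 h]]; split=> // p; first by move=> []; apply: h.
by move=> hp hw; apply: h.
Qed.

Lemma pclosed_zero p : hom_poly p -> pclosed (fun v => vnz v /\ p.@[v] = 0).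
Proof.
move=> hp; exists (eq p); split=> [_ <- //|v]; split=> [[v0 h]|[v0 h]]; split=> //; first by move=> _ <-.
exact: h.
Qed.

(** The functions on an irreducible cone form a domain. Irreducibility only speaks of sets cut out
    by homogeneous polynomials, so [g] is treated one homogeneous component at a time. *)
Lemma pirred_cancel Z h g : pirred Z -> hom_poly h -> (exists2 v, Z v & h.@[v] != 0) ->
  (forall v, Z v -> h.@[v] * g.@[v] = 0) -> forall v, Z v -> g.@[v] = 0.
Proof.
move=> [cZ [_ irr]] hh [v0 Zv0 hv0] H.
suff G e v : Z v -> (pihomog mdeg e g).@[v] = 0.
  by move=> v Zv; rewrite [g]pihomog_sumE raddf_sum big1 //= => e _; apply: G.
have [] := irr (fun v => vnz v /\ h.@[v] = 0) (fun v => vnz v /\ (pihomog mdeg e g).@[v] = 0).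
- exact: pclosed_zero.
- exact/pclosed_zero/hom_poly_pihomog.
- move=> w Zw; have w0 := pclosed_vnz cZ Zw.
  case: (eqVneq h.@[w] 0) => hw; [by left | right; split=> //].
  apply: pihomog_vanish => a a0.
  have [d hd] := hom_poly_scale hh.
  have /eqP := H _ (pclosed_scale cZ a0 Zw); rewrite hd !mulf_eq0 expf_eq0.
  by rewrite (negPf a0) (negPf hw) andbF => /eqP.
- by move=> /(_ _ Zv0)[_ /eqP]; rewrite (negPf hv0).
- by move=> h2 /h2[].
Qed.

(** * Independent equations along a chain *)

Section Upper.
Variables (r : nat) (C : nat -> ('I_N -> K) -> Prop) (f : 'I_r.+1 -> {mpoly K[N]}) (j0 : 'I_N).
Hypothesis Cirr : forall i, (i <= r)%N -> pirred (C i).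
Hypothesis Csub : forall i, (i < r)%N -> psubset (C i) (C i.+1).
Hypothesis fhom : forall i, hom_poly (f i).
Hypothesis fnz : forall i : 'I_r.+1, exists2 v, C i v & (f i).@[v] != 0.
Hypothesis fz : forall i : 'I_r.+1, (0 < i)%N -> forall v, C i.-1 v -> (f i).@[v] = 0.
Hypothesis f0 : f ord0 = 'X_j0.

(** From a relation on C_i the highest power of f_i is split off. Irreducibility cancels it, and
    restriction to C_(i-1), where f_i is zero, leaves a nonzero relation between the earlier
    functions. On C_0 the single coordinate f_0 takes all nonzero values by scaling. *)
Lemma chain_indep i (q : {mpoly K[r.+1]}) : (i <= r)%N ->
  (forall m, m \in msupp q -> forall k : 'I_r.+1, (i < k)%N -> m k = 0%N) ->
  (forall v, C i v -> q.@[fun k => (f k).@[v]] = 0) -> q = 0.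
Proof.
elim: i q => [|i IH] q ir hsupp hq.
  have hm m : m \in msupp q -> m = (U_(ord0) *+ m ord0)%MM.
    move=> hm; apply/mnmP => k; rewrite mulmnE mnmE.
    case: (eqVneq ord0 k) => [<-|ne]; first by rewrite mul1n.
    by apply: hsupp; rewrite // lt0n; apply: contraNneq ne => E; apply/eqP/val_inj.
  pose P := \sum_(m <- msupp q) q@_m *: 'X^(m ord0) : {poly K}.
  have qE (x : 'I_r.+1 -> K) : q.@[x] = P.[x ord0].
    rewrite mevalE horner_sum !big_seq; apply: eq_bigr => m /hm mE.
    rewrite hornerZ hornerXn (bigD1 ord0) //= big1 ?mulr1 // => k ne.
    by rewrite mE mulmnE mnmE eq_sym (negPf ne) mul0n.
  have P0 : P = 0.
    have [v Cv] := fnz ord0; rewrite f0 mevalXU => vj.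
    apply: (@poly_vanish _ _ 'X); first by rewrite polyX_eq0.
    move=> t; rewrite hornerX => t0.
    have [cC _] := Cirr ir.
    have t1 : t / v j0 != 0 by rewrite mulf_neq0 ?invr_eq0.
    have := hq _ (pclosed_scale cC t1 Cv); rewrite qE f0 mevalXU divfK //.
  apply: mpoly_vanish => x; rewrite qE P0 horner0 //.
apply/eqP/negPn/negP => q0.
pose ii : 'I_r.+1 := Ordinal (ir : i.+1 < r.+1)%N.
have [m0 hm0 hmin] : exists2 m0, m0 \in msupp q & forall m, m \in msupp q -> (m0 ii <= m ii)%N.
  have hl : mlead q \in msupp q by rewrite mlead_supp.
  have ex : exists W, has (fun m : 'X_{1..r.+1} => m ii == W) (msupp q).
    by exists (mlead q ii); apply/hasP; exists (mlead q).
  case: (ex_minnP ex) => W /hasP[m0 h0 /eqP E0] hW; exists m0 => // m hm.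
  by rewrite E0; apply: hW; apply/hasP; exists m.
pose k := m0 ii; pose sh (m : 'X_{1..r.+1}) := (m - U_(ii) *+ k)%MM.
pose q1 : {mpoly K[r.+1]} := \sum_(m <- msupp q) q@_m *: 'X_[sh m].
pose q2 : {mpoly K[r.+1]} := \sum_(m <- msupp q | m ii == k) q@_m *: 'X_[sh m].
have shE m : m \in msupp q -> m = (sh m + U_(ii) *+ k)%MM.
  move=> hm; rewrite /sh submK //; apply/mnm_lepP => j; rewrite mulmnE mnmE.
  by case: eqP => [<-|_]; rewrite ?mul1n ?hmin.
have qE x : q.@[x] = x ii ^+ k * q1.@[x].
  rewrite mevalE /q1 raddf_sum big_distrr /= !big_seq; apply: eq_bigr => m hm.
  rewrite mevalZ mulrCA; congr (_ * _); rewrite -mevalX {1}(shE m hm).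
  by rewrite mpolyXD -mpolyXn mevalM rmorphXn /= mevalXU mulrC.
have q1f v : C i.+1 v -> q1.@[fun k => (f k).@[v]] = 0.
  move=> Cv; pose g := q1 \mPo [tuple f k | k < r.+1].
  have gE w : g.@[w] = q1.@[fun k => (f k).@[w]].
    by rewrite comp_mpoly_meval; apply: meval_eq => j; rewrite tnth_mktuple.
  rewrite -gE; move: v Cv; apply: (@pirred_cancel _ (f ii ^+ k)) => //.
  - exact: Cirr.
  - have [e he] := fhom ii; exists (e * k)%N => m; apply/dhomogP/dhomogMn/dhomogP; exact: he.
  - by have [v Cv fv] := fnz ii; exists v => //; rewrite rmorphXn expf_neq0.
  - by move=> w Cw; rewrite rmorphXn gE -qE; apply: hq.
have q20 : q2 = 0.
  apply: IH; first exact: ltnW.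
    move=> m; rewrite mcoeff_msupp => hm j ij; apply: NNPP => mj.
    case/eqP: hm; rewrite /q2 raddf_sum big_seq_cond big1 //= => m' /andP[hm' /eqP mk].
    rewrite mcoeffZ mcoeffX; case: eqP => [E|_]; last by rewrite mulr0.
    case: mj; rewrite -E /sh mnmBE mulmnE mnmE; case: (eqVneq ii j) => [<-|ne]; first by rewrite mk mul1n subnn.
    rewrite mul0n subn0; apply: hsupp => //; rewrite ltn_neqAle ij andbT.
    by apply: contraNneq ne => E2; apply/eqP/val_inj.
  move=> v Cv; rewrite -[RHS](q1f v (Csub ir Cv)).
  rewrite /q1 /q2 !raddf_sum big_mkcond /= !big_seq; apply: eq_bigr => m hm.
  case: eqP => // mk; rewrite mevalZ mevalX (bigD1 ii) //=.
  rewrite (@fz ii) // /sh mnmBE mulmnE mnmE eqxx mul1n expr0n subn_eq0.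
  by rewrite leqNgt ltn_neqAle eq_sym hmin // andbT; move/eqP: mk => /negPf ->; rewrite !(mul0r, mulr0).
have : q2@_(sh m0) = q@_m0.
  rewrite /q2 raddf_sum big_mkcond (bigD1_seq m0) ?msupp_uniq //= eqxx mcoeffZ mcoeffX eqxx mulr1.
  rewrite big_seq_cond big1 ?addr0 // => m /andP[hm ne]; case: eqP => // mk.
  rewrite mcoeffZ mcoeffX; case: eqP => [E|_]; last by rewrite mulr0.
  by case/eqP: ne; rewrite (shE m hm) E -(shE m0 hm0).
by rewrite q20 mcoeff0 => /esym/eqP; rewrite mcoeff_eq0 hm0.
Qed.

End Upper.

(** By strictness some equation of C_(i-1) fails on C_i; these equations, preceded by a coordinate
    that is nonzero on C_0, are the functions [f]. A relation along [Phi] passes to [Z], hence to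
    C_r: stability of the image under scaling makes its homogeneous components vanish separately. *)
Lemma upper_chain (T : Type) (Phi : T -> 'I_N -> K) Z r :
  (forall p, hom_poly p -> (forall y, p.@[Phi y] = 0) -> forall v, Z v -> p.@[v] = 0) ->
  (forall a y, a != 0 -> exists y', Phi y' = fun j => a * Phi y j) ->
  pchain Z r ->
  exists f : 'I_r.+1 -> {mpoly K[N]}, forall q : {mpoly K[r.+1]},
    (forall y, q.@[fun k => (f k).@[Phi y]] = 0) -> q = 0.
Proof.
move=> hZ hcone [C [Cirr [Cstr CZ]]].
have [_ [[v0 Cv0] _]] := Cirr 0%N (leq0n _).
have [j0 vj0] : vnz v0 by have [cC _] := Cirr 0%N (leq0n _); apply: pclosed_vnz cC Cv0.
pose good (i : 'I_r.+1) (f : {mpoly K[N]}) := [/\ hom_poly f, exists2 v, C i v & f.@[v] != 0,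
  (0 < i)%N -> forall v, C i.-1 v -> f.@[v] = 0 & i = ord0 -> f = 'X_j0].
have [f hf] : exists f, forall i, good i (f i).
  apply: (@fin_all_exists _ (fun=> {mpoly K[N]}) good) => -[[|i] /= ir].
    exists 'X_j0; split=> //; last by exists v0; rewrite ?mevalXU.
    by exists 1%N => m; rewrite msuppX inE => /eqP ->; rewrite mdeg1.
  have [_ [v [Cv nCv]]] := Cstr i ir.
  have [[P [hP hC]] _] := Cirr i (ltnW ir : (i <= r)%N).
  have [p [Pp pv]] : exists p, P p /\ p.@[v] <> 0.
    apply: NNPP => hn; apply: nCv; apply/hC; split.
      by have [cC _] := Cirr i.+1 ir; apply: pclosed_vnz cC Cv.
    by move=> p Pp; apply: NNPP => pv; apply: hn; exists p.
  exists p; split=> //; [exact: hP | by exists v => //; apply/eqP |].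
  by move=> _ w /hC[_]; apply.
exists f => q hq.
apply: (@chain_indep r C f j0 Cirr _ _ _ _ _ r) => //.
- by move=> i /Cstr[].
- by move=> i; have [] := hf i.
- by move=> i; have [] := hf i.
- by move=> i; have [] := hf i.
- by have [_ _ _] := hf ord0; apply.
- by move=> m _ k; rewrite ltnNge -ltnS ltn_ord.
move=> v /CZ Zv; pose g := q \mPo [tuple f k | k < r.+1].
have gE w : g.@[w] = q.@[fun k => (f k).@[w]].
  by rewrite comp_mpoly_meval; apply: meval_eq => j; rewrite tnth_mktuple.
rewrite -gE [g]pihomog_sumE raddf_sum big1 //= => e _.
apply: (hZ _ (hom_poly_pihomog _ _)) => // y; apply: pihomog_vanish => a a0.
by have [y' <-] := hcone a y a0; rewrite gE.
Qed.

Definition cone (T : Type) (F : T -> 'I_N -> K) v := exists a y, v = fun j => a * F y j.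

Lemma cone_vanish (T : Type) (F : T -> 'I_N -> K) p : hom_poly p ->
  (forall y, p.@[F y] = 0) -> forall v, vnz v -> cone F v -> p.@[v] = 0.
Proof.
by move=> hp h v _ [a [y ->]]; have [e ->] := hom_poly_scale hp; rewrite h mulr0.
Qed.

(** If neither closed set contains the cone, each has an equation that is not identically zero on
    the parameters. At a parameter where both equations and a coordinate are nonzero, the point lies
    in neither set. *)
Lemma pirred_cone m (F : ('I_m -> K) -> 'I_N -> K) :
  (forall j, polyfun (fun y => F y j)) -> (exists y, vnz (F y)) -> pirred (pclosure (cone F)).
Proof.
move=> hF [y0 [j yj]].
have sub y : vnz (F y) -> pclosure (cone F) (F y).
  move=> nz; split=> // p hp; apply=> //; exists 1, y.
  by apply: functional_extensionality => i; rewrite mul1r.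
split; first exact: pclosure_closed.
split; first by exists (F y0); apply: sub; exists j.
move=> Z1 Z2 c1 c2 h12; apply: NNPP => /not_or_and[n1 n2].
have wit Z : pclosed Z -> ~ psubset (pclosure (cone F)) Z ->
    exists p, [/\ hom_poly p, forall v, Z v -> p.@[v] = 0 & exists y, p.@[F y] != 0].
  move=> [P [hP hZ]] nZ; apply: NNPP => hn; apply: nZ => v [vn hv]; apply/hZ; split=> // p Pp.
  apply: hv; first exact: hP.
  apply: cone_vanish; first exact: hP.
  move=> y; apply/eqP/negPn/negP => ne; apply: hn; exists p; split; [exact: hP | | by exists y].
  by move=> w /hZ[_]; apply.
have [p1 [h1 z1 [y1 ny1]]] := wit _ c1 n1.
have [p2 [h2 z2 [y2 ny2]]] := wit _ c2 n2.
have P1 : polyfun (fun y => p1.@[F y]) by apply: polyfun_meval.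
have P2 : polyfun (fun y => p2.@[F y]) by apply: polyfun_meval.
have [y [g1 g2]] := polyfun_nz_and P1 P2 (ex_intro _ y1 ny1) (ex_intro _ y2 ny2).
have P12 := polyfunM P1 P2.
have [|z [ga gb]] := polyfun_nz_and P12 (hF j) _ (ex_intro _ y0 yj).
  by exists y; rewrite mulf_neq0.
have [/z1 E|/z2 E] := h12 (F z) (sub z (ex_intro _ j gb)).
  by rewrite E mul0r eqxx in ga.
by rewrite E mulr0 eqxx in ga.
Qed.

(** * Chains from independent coordinates *)

Section Lower.
Variables (n : nat) (psi : ('I_n -> K) -> 'I_N -> K) (J : 'I_n.+1 -> 'I_N).
Hypothesis psiP : forall j, polyfun (fun y => psi y j).
Hypothesis psi_dense : dense (fun z => exists a y, z = fun k => a * psi y (J k)).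

(** The parameters from index [i] on are frozen at [al]; member [i] of the chain is the cone over
    what the first [i] parameters sweep out. *)
Let fixed (al : 'I_n -> K) (i : nat) (y : 'I_n -> K) (j : 'I_n) :=
  if (i <= j)%N then al j else y j.

Let sfix (i : nat) (j : 'I_n) : unit + 'I_n + 'I_n :=
  if (i <= j)%N then inr j else inl (inr j).

(** The n+1 coordinates and y_i are n+2 functions of n+1 quantities, so they satisfy a relation
    [q i]. Putting al_i for its last variable gives an equation of member [i], where y_i = al_i. For
    generic [al] it fails on member i+1, so the inclusion is strict. *)
Lemma lower_chain Z : (forall v, pclosure (cone psi) v -> Z v) -> pchain Z n.
Proof.
move=> hZ.
pose rel (i : 'I_n) (q : {mpoly K[n.+1 + 1]}) := q != 0 /\
  forall a y, q.@[join_fun (fun k => a * psi y (J k)) (fun=> y i)] = 0.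
have [q hq] : exists q : 'I_n -> {mpoly K[n.+1 + 1]}, forall i, rel i (q i).
  apply: (@fin_all_exists _ (fun=> {mpoly K[n.+1 + 1]}) rel) => i.
  pose yy (s : 'I_n.+1 -> K) (j : 'I_n) := s (lift ord0 j).
  have [| |q q0 hq] := @poly_dep K (n.+1 + 1) n.+1 (fun k s =>
     join_fun (fun k => s ord0 * psi (yy s) (J k)) (fun=> yy s i) k).
  - move=> k; rewrite /join_fun; case: (split k) => k'; last exact: polyfun_coord.
    apply: polyfunM; first exact: polyfun_coord.
    by apply: (polyfun_reindex (f := fun y => psi y (J k'))).
  - by rewrite addn1.
  exists q; split=> // a y.
  pose s j := oapp y a (unlift ord0 j).
  have E : yy s = y by apply: functional_extensionality => j; rewrite /yy /s liftK.
  by have := hq s; rewrite E /s unlift_none.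
pose al (s : unit + 'I_n + 'I_n -> K) (j : 'I_n) := s (inr j).
pose yy (s : unit + 'I_n + 'I_n -> K) (j : 'I_n) := s (inl (inr j)).
(* [Some i] expresses strictness of step [i]; [None] provides a nonzero point in every member. *)
pose H (o : option 'I_n) (s : unit + 'I_n + 'I_n -> K) := match o with
  | Some i => (q i).@[fun k => join_fun (fun k => s (inl (inl tt)) * psi (fixed (al s) i.+1 (yy s)) (J k))
       (fun=> al s i) k]
  | None => psi (al s) (J ord0) end.
have fixedE s i : fixed (al s) i (yy s) = fun j => s (sfix i j).
  by apply: functional_extensionality => j; rewrite /fixed /sfix; case: ifP.
have psi_fix i j : polyfun (fun s => psi (fixed (al s) i (yy s)) j).
  apply: (@polyfun_ext _ _ (fun s => psi (fun j => s (sfix i j)) j)); first by move=> s; rewrite fixedE.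
  by apply: (polyfun_reindex (f := fun y => psi y j)).
have HP o : polyfun (H o).
  case: o => [i|] /=; last by apply: (polyfun_reindex (f := fun y => psi y (J ord0))).
  apply: polyfun_meval => k; rewrite /join_fun; case: (split k) => k'; last exact: polyfun_coord.
  by apply: polyfunM => //; apply: polyfun_coord.
have Hn o : exists s, H o s != 0.
  apply: NNPP => hn; have {}hn s : H o s = 0 by apply/eqP/negPn/negP => ?; apply: hn; exists s.
  pose mk (a : K) (y al : 'I_n -> K) (x : unit + 'I_n + 'I_n) : K :=
    match x with inl (inl _) => a | inl (inr j) => y j | inr j => al j end.
  case: o hn => [i|] /= hn.
    have [/eqP q0 _] := hq i; apply: q0.
    apply: (dense_prod psi_dense (@denseT K 1)) => z [[a [y Ez]] _].
    (* Density supplies a point [y] and an unrelated value T for the last variable. Taking [al]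
       equal to [y] except for al_i = T does not change the point, because y_i is still free at
       stage i+1. *)
    pose T := z (rshift n.+1 ord0).
    pose s := mk a y (fun j => if j == i then T else y j).
    have := hn s; rewrite /al /= eqxx => <-; apply: meval_eq => k; rewrite /join_fun.
    case: splitP => k' Ek.
      have -> : k = lshift 1 k' by apply: val_inj.
      have := congr1 (fun f => f k') Ez => /= ->; congr (_ * psi _ _).
      apply: functional_extensionality => j; rewrite /fixed /= /yy /al /=.
      by case: ifP => // ij; case: eqP => // E; move: ij; rewrite E ltnn.
    by rewrite /T; congr z; apply: val_inj; rewrite /= Ek; case: k' {Ek} => [[]].
  have : 'X_ord0 = 0 :> {mpoly K[n.+1]}.
    apply: psi_dense => z [a [y ->]]; rewrite mevalXU.
    by rewrite (hn (mk 0 y y)) mulr0.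
  move/(congr1 (meval (fun=> 1))); rewrite mevalXU meval0 => /eqP.
  by rewrite oner_eq0.
have [s hs] := polyfun_nz_prod HP Hn.
pose F i y := psi (fixed (al s) i y).
have FP i j : polyfun (fun y => F i y j).
  apply: (polyfun_affine (f := fun y => psi y j)) => // u u'.
  exists (fun j : 'I_n => if (i <= j)%N then al s j else u j), (fun j : 'I_n => if (i <= j)%N then 0 else u' j) => t k.
  by rewrite /fixed; case: ifP; rewrite ?mulr0 ?addr0.
have Fal i : F i (al s) = psi (al s).
  by rewrite /F; congr psi; apply: functional_extensionality => j; rewrite /fixed; case: ifP.
have sub i : forall v, cone (F i) v -> cone (F i.+1) v.
  move=> v [a [y ->]]; exists a, (fixed (al s) i y); congr (fun f => _).
  apply: functional_extensionality => j; congr (_ * psi _ _).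
  apply: functional_extensionality => k; rewrite /fixed.
  by case: (ltnP i k) => h; rewrite ?(ltnW h).
exists (fun i => pclosure (cone (F i))); split; [|split].
- move=> i _; apply: pirred_cone => //; exists (al s); rewrite Fal.
  by exists (J ord0); apply: (hs None).
- move=> i lt; pose ii := Ordinal lt; split.
    by move=> v [v0 hv]; split=> // p hp h; apply: hv => // w w0 /sub; apply: h.
  pose w j := s (inl (inl tt)) * F i.+1 (yy s) j.
  pose g := q ii \mPo [tuple match split k with inl k' => 'X_(J k') | inr _ => (al s ii)%:MP end | k < n.+1 + 1] : {mpoly K[N]}.
  have gE v : g.@[v] = (q ii).@[join_fun (fun k => v (J k)) (fun=> al s ii)].
    rewrite comp_mpoly_meval; apply: meval_eq => k; rewrite tnth_mktuple /join_fun.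
    by case: (split k) => k'; rewrite ?mevalXU ?mevalC.
  have gw : g.@[w] != 0 by rewrite gE; apply: (hs (Some ii)).
  have gc v : cone (F i) v -> g.@[v] = 0.
    move=> [a [y ->]]; rewrite gE.
    have [_ /(_ a (fixed (al s) i y))] := hq ii.
    by rewrite {2}/fixed /= leqnn.
  exists w; split; last first.
    move=> [w0 hw]; case/eqP: gw; rewrite [g]pihomog_sumE raddf_sum big1 //= => e _.
    apply: hw; first exact: hom_poly_pihomog.
    move=> v v0 [a [y Ev]]; apply: pihomog_vanish => b b0; apply: gc.
    exists (b * a), y; apply: functional_extensionality => j; rewrite Ev mulrA //.
  have wc : cone (F i.+1) w by exists (s (inl (inl tt))), (yy s).
  have w0 : vnz w.
    apply: NNPP => hn; case/eqP: gw; apply: gc; exists 0, (yy s).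
    apply: functional_extensionality => j; rewrite mul0r.
    by apply/eqP/negPn/negP => h; apply: hn; exists j.
  by split=> // p _; apply.
- move=> v Cv; apply: hZ; suff -> : psi = F n by [].
  apply: functional_extensionality => y; congr psi; apply: functional_extensionality => j.
  by rewrite /fixed leqNgt ltn_ord.
Qed.

End Lower.
End Chains.

(** * Ternary forms *)

Section Mons.
Implicit Types d a b : nat.

Lemma mem_mons d ab : (ab \in mons d) = (ab.1 + ab.2 <= d)%N.
Proof.
case: ab => a b /=; apply/allpairsPdep/idP => [[x [y [hx hy [-> ->]]]]|h].
  by move: hx hy; rewrite !mem_iota; lia.
by exists a, b; rewrite !mem_iota; split=> //; lia.
Qed.

Lemma uniq_mons d : uniq (mons d).
Proof.
apply: allpairs_uniq_dep => [||[x y] [x' y'] _ _ [-> ->]] //; first exact: iota_uniq.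
by move=> x _; apply: iota_uniq.
Qed.

Lemma size_mons d : nforms d = 'C(d.+2, 2).
Proof.
rewrite /nforms /mons size_allpairs_dep.
rewrite (eq_map (g := fun a => (d.+1 - a)%N)); last by move=> a; rewrite size_iota.
have E n : sumn [seq (n - a)%N | a <- iota 0 n] = 'C(n.+1, 2).
  elim: n => [|n IH] //; rewrite -[iota 0 n.+1]/(0%N :: iota 1 n) /= subn0.
  rewrite (iotaDl 1 0 n) -map_comp (eq_map (g := fun a => (n - a)%N)).
    by rewrite IH [RHS]binS bin1 addnC.
  by move=> a /=; rewrite add1n subSS.
exact: E.
Qed.

End Mons.

Section Forms.
Variable K : closedFieldType.
Implicit Types (C : nat -> nat -> K) (x u v w : 'I_3 -> K).

Definition x0 x := x ord0.
Definition x1 x := x (inord 1).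
Definition x2 x := x (inord 2).
Definition mk3 (a b c : K) (i : 'I_3) : K :=
  match val i with 0%N => a | 1%N => b | _ => c end.

Lemma mk3_0 a b c : x0 (mk3 a b c) = a. Proof. by []. Qed.
Lemma mk3_1 a b c : x1 (mk3 a b c) = b. Proof. by rewrite /x1 /mk3 /= inordK. Qed.
Lemma mk3_2 a b c : x2 (mk3 a b c) = c. Proof. by rewrite /x2 /mk3 /= inordK. Qed.
Definition mk3E := (mk3_0, mk3_1, mk3_2).

Lemma ext3 x y : x0 x = x0 y -> x1 x = x1 y -> x2 x = x2 y -> x = y.
Proof.
move=> h0 h1 h2; apply: functional_extensionality => i.
have : i \in [:: ord0; inord 1; inord 2 : 'I_3].
  by case: i => [[|[|[|]]] //= h]; rewrite !inE -!val_eqE /= !inordK.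
by rewrite !inE => /or3P[] /eqP ->.
Qed.

Lemma all3 (P : 'I_3 -> Prop) : (forall i, P i) <-> [/\ P ord0, P (inord 1) & P (inord 2)].
Proof.
split=> [h|[h0 h1 h2] i]; first by split.
have : i \in [:: ord0; inord 1; inord 2 : 'I_3].
  by case: i => [[|[|[|]]] //= h]; rewrite !inE -!val_eqE /= !inordK.
by rewrite !inE => /or3P[] /eqP ->.
Qed.

Lemma vnz3 x : vnz x <-> [|| x0 x != 0, x1 x != 0 | x2 x != 0].
Proof.
split=> [[i]|/or3P[]]; [|by exists ord0 | by exists (inord 1) | by exists (inord 2)].
  have := (all3 (fun i => x i != 0 -> [|| x0 x != 0, x1 x != 0 | x2 x != 0])).2.
  by apply; split; rewrite /x0 /x1 /x2 => ->; rewrite ?orbT.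
Qed.

Lemma vnz3P x : ~ vnz x -> [/\ x0 x = 0, x1 x = 0 & x2 x = 0].
Proof.
move=> h; have /negP : ~ [|| x0 x != 0, x1 x != 0 | x2 x != 0] by move/vnz3.
by rewrite !negb_or !negbK => /and3P[/eqP -> /eqP -> /eqP ->].
Qed.

Definition dot u x := x0 u * x0 x + x1 u * x1 x + x2 u * x2 x.

Lemma on_lineE u x : on_line u x <-> dot u x = 0.
Proof.
rewrite /on_line !big_ord_recl big_ord0 addr0 addrA /dot /x0 /x1 /x2.
have -> : lift ord0 ord0 = inord 1 :> 'I_3 by apply: val_inj; rewrite /= inordK.
by have -> : lift ord0 (lift ord0 ord0) = inord 2 :> 'I_3 by apply: val_inj; rewrite /= inordK.
Qed.

Definition cross u v := mk3 (x1 u * x2 v - x2 u * x1 v) (x2 u * x0 v - x0 u * x2 v)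
  (x0 u * x1 v - x1 u * x0 v).

Definition det3 u v w := dot u (cross v w).

Lemma det3E u v w : det3 u v w = x0 u * (x1 v * x2 w - x2 v * x1 w) +
  x1 u * (x2 v * x0 w - x0 v * x2 w) + x2 u * (x0 v * x1 w - x1 v * x0 w).
Proof. by rewrite /det3 /dot /cross !mk3E. Qed.

Lemma det3C u v w : det3 u v w = - det3 u w v. Proof. rewrite !det3E; ring. Qed.
Lemma det3R u v w : det3 u v w = det3 v w u. Proof. rewrite !det3E; ring. Qed.
Lemma det3_id u w : det3 u u w = 0. Proof. rewrite !det3E; ring. Qed.

Lemma cross_prop u v x : dot u x = 0 -> dot v x = 0 -> vnz (cross u v) ->
  exists k, x = fun i => k * cross u v i.
Proof.
rewrite /dot => hu hv /vnz3; set c := cross u v.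
have E0 : x0 c = x1 u * x2 v - x2 u * x1 v by rewrite /c mk3E.
have E1 : x1 c = x2 u * x0 v - x0 u * x2 v by rewrite /c mk3E.
have E2 : x2 c = x0 u * x1 v - x1 u * x0 v by rewrite /c mk3E.
have h01 : x0 x * x1 c = x1 x * x0 c.
  apply/eqP; rewrite -subr_eq0 E0 E1; apply/eqP.
  have -> : x0 x * (x2 u * x0 v - x0 u * x2 v) - x1 x * (x1 u * x2 v - x2 u * x1 v) =
    x2 u * (x0 v * x0 x + x1 v * x1 x + x2 v * x2 x) - x2 v * (x0 u * x0 x + x1 u * x1 x + x2 u * x2 x) by ring.
  by rewrite hu hv !mulr0 subr0.
have h02 : x0 x * x2 c = x2 x * x0 c.
  apply/eqP; rewrite -subr_eq0 E0 E2; apply/eqP.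
  have -> : x0 x * (x0 u * x1 v - x1 u * x0 v) - x2 x * (x1 u * x2 v - x2 u * x1 v) =
    x1 v * (x0 u * x0 x + x1 u * x1 x + x2 u * x2 x) - x1 u * (x0 v * x0 x + x1 v * x1 x + x2 v * x2 x) by ring.
  by rewrite hu hv !mulr0 subr0.
have h12 : x1 x * x2 c = x2 x * x1 c.
  apply/eqP; rewrite -subr_eq0 E1 E2; apply/eqP.
  have -> : x1 x * (x0 u * x1 v - x1 u * x0 v) - x2 x * (x2 u * x0 v - x0 u * x2 v) =
    x0 u * (x0 v * x0 x + x1 v * x1 x + x2 v * x2 x) - x0 v * (x0 u * x0 x + x1 u * x1 x + x2 u * x2 x) by ring.
  by rewrite hu hv !mulr0 subr0.
case/or3P => nz.
- exists (x0 x / x0 c); apply: ext3.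
  + by rewrite -[RHS]/(_ * x0 c) divfK.
  + by rewrite -[RHS]/(_ * x1 c) mulrAC h01 mulfK.
  + by rewrite -[RHS]/(_ * x2 c) mulrAC h02 mulfK.
- exists (x1 x / x1 c); apply: ext3.
  + by rewrite -[RHS]/(_ * x0 c) mulrAC -h01 mulfK.
  + by rewrite -[RHS]/(_ * x1 c) divfK.
  + by rewrite -[RHS]/(_ * x2 c) mulrAC h12 mulfK.
- exists (x2 x / x2 c); apply: ext3.
  + by rewrite -[RHS]/(_ * x0 c) mulrAC -h02 mulfK.
  + by rewrite -[RHS]/(_ * x1 c) mulrAC -h12 mulfK.
  + by rewrite -[RHS]/(_ * x2 c) divfK.
Qed.

Lemma dot_cross_l u v : dot u (cross u v) = 0.
Proof. by rewrite -/(det3 _ _ _) det3_id. Qed.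

Lemma dot_cross_r u v : dot v (cross u v) = 0.
Proof. by rewrite -/(det3 _ _ _) det3C det3_id oppr0. Qed.

Lemma same_pt_cross u v : vnz u -> vnz v -> ~ vnz (cross u v) -> same_pt u v.
Proof.
move=> /vnz3 nu /vnz3 nv /vnz3P; rewrite /cross !mk3E.
move=> [/eqP h12 /eqP h20 /eqP h01]; rewrite !subr_eq0 in h12 h20 h01.
move/eqP: h12 => h12; move/eqP: h20 => h20; move/eqP: h01 => h01.
pose f k i := k * v i.
suff [k hk] : exists k, u = f k.
  exists k; split; last by move=> i; rewrite {1}hk.
  apply: contraTneq nu => k0; rewrite hk k0 /f /x0 /x1 /x2 !mul0r eqxx //.
case/or3P: nv => nz.
- exists (x0 u / x0 v); apply: ext3.
  + by rewrite -[RHS]/(_ * x0 v) divfK.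
  + by rewrite -[RHS]/(_ * x1 v) mulrAC h01 mulfK.
  + by rewrite -[RHS]/(_ * x2 v) mulrAC -h20 mulfK.
- exists (x1 u / x1 v); apply: ext3.
  + by rewrite -[RHS]/(_ * x0 v) mulrAC -h01 mulfK.
  + by rewrite -[RHS]/(_ * x1 v) divfK.
  + by rewrite -[RHS]/(_ * x2 v) mulrAC h12 mulfK.
- exists (x2 u / x2 v); apply: ext3.
  + by rewrite -[RHS]/(_ * x0 v) mulrAC h20 mulfK.
  + by rewrite -[RHS]/(_ * x1 v) mulrAC -h12 mulfK.
  + by rewrite -[RHS]/(_ * x2 v) divfK.
Qed.

(* Coefficient functions: [C a b] is the coefficient of x0^(d-a-b) x1^a x2^b. *)
Definition td d C := forall a b, (d < a + b)%N -> C a b = 0.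

Definition ev d C x := \sum_(ab <- mons d)
  C ab.1 ab.2 * (x0 x ^+ (d - ab.1 - ab.2) * x1 x ^+ ab.1 * x2 x ^+ ab.2).

Lemma evE d C x : ev d C x = \sum_(0 <= a < d.+1) \sum_(0 <= b < d.+1 - a)
  C a b * (x0 x ^+ (d - a - b) * x1 x ^+ a * x2 x ^+ b).
Proof.
rewrite /ev /mons big_allpairs_dep /= /index_iota subn0.
by apply: eq_bigr => a _; rewrite subn0.
Qed.

(** Only the exponents of x1 and x2 are recorded, so multiplication by x0 leaves the coefficient
    function as it is: the same [C] read in degree d+1 is x0 times the form. *)
Definition lmul u C a b : K := x0 u * C a b + x1 u * (if a is a'.+1 then C a' b else 0)
  + x2 u * (if b is b'.+1 then C a b' else 0).

Definition one3 (a b : nat) : K := ((a == 0%N) && (b == 0%N))%:R.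

Lemma td_lmul d u C : td d C -> td d.+1 (lmul u C).
Proof.
move=> h a b ab; rewrite /lmul h ?mulr0 ?add0r; last by lia.
case: a ab => [|a] ab; case: b ab => [|b] ab; rewrite ?h ?mulr0 ?addr0 //; lia.
Qed.

Lemma td_one : td 0 one3.
Proof. by move=> [|a] [|b]. Qed.

Lemma ev_one x : ev 0 one3 x = 1.
Proof. by rewrite evE !big_nat1 /one3 /= !expr0 !mulr1. Qed.

Lemma evD d C C' x : ev d (fun a b => C a b + C' a b) x = ev d C x + ev d C' x.
Proof. by rewrite /ev -big_split; apply: eq_bigr => ab _; rewrite mulrDl. Qed.

Lemma evZ d k C x : ev d (fun a b => k * C a b) x = k * ev d C x.
Proof. by rewrite /ev big_distrr /=; apply: eq_bigr => ab _; rewrite -!mulrA. Qed.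

Lemma ev_sum d (T : Type) (r : seq T) (P : pred T) (F : T -> nat -> nat -> K) x :
  ev d (fun a b => \sum_(i <- r | P i) F i a b) x = \sum_(i <- r | P i) ev d (F i) x.
Proof. by rewrite /ev exchange_big; apply: eq_bigr => ab _ /=; rewrite big_distrl. Qed.

Lemma td_sum d (T : Type) (r : seq T) (P : pred T) (F : T -> nat -> nat -> K) :
  (forall i, td d (F i)) -> td d (fun a b => \sum_(i <- r | P i) F i a b).
Proof. by move=> h a b ab; rewrite big1 // => i _; apply: h. Qed.

Lemma tdD d C C' : td d C -> td d C' -> td d (fun a b => C a b + C' a b).
Proof. by move=> h h' a b ab; rewrite h // h' // addr0. Qed.

Lemma tdZ d k C : td d C -> td d (fun a b => k * C a b).
Proof. by move=> h a b ab; rewrite h // mulr0. Qed.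

Lemma tdW d d' C : (d <= d')%N -> td d C -> td d' C.
Proof. by move=> le h a b ab; apply: h; lia. Qed.

Lemma ev_lmul d u C x : td d C -> ev d.+1 (lmul u C) x = dot u x * ev d C x.
Proof.
move=> h.
have E0 : ev d.+1 C x = x0 x * ev d C x.
  rewrite !evE big_nat_recr //= [X in _ + X]big1_seq ?addr0; last first.
    by move=> b _; rewrite h ?mul0r //; lia.
  rewrite big_distrr; apply: eq_big_nat => a /andP[_ ad] /=.
  have -> : (d.+2 - a = (d.+1 - a).+1)%N by lia.
  rewrite big_nat_recr //= h ?mul0r ?addr0; last by lia.
  rewrite big_distrr; apply: eq_big_nat => b /andP[_ bd] /=.
  have -> : (d.+1 - a - b = (d - a - b).+1)%N by lia.
  by rewrite exprS; ring.
have E1 : ev d.+1 (fun a b => if a is a'.+1 then C a' b else 0) x = x1 x * ev d C x.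
  rewrite !evE big_nat_recl //= [X in X + _]big1_seq ?add0r; last by move=> b _; rewrite mul0r.
  rewrite big_distrr; apply: eq_big_nat => a _ /=.
  rewrite big_distrr subSS; apply: eq_big_nat => b _ /=.
  by rewrite subSS exprS; ring.
have E2 : ev d.+1 (fun a b => if b is b'.+1 then C a b' else 0) x = x2 x * ev d C x.
  rewrite !evE big_nat_recr //= !subSS subSnn big_nat1 mul0r addr0 big_distrr.
  apply: eq_big_nat => a /andP[_ ad] /=.
  have -> : (d.+2 - a = (d.+1 - a).+1)%N by lia.
  rewrite big_nat_recl //= mul0r add0r big_distrr; apply: eq_big_nat => b _ /=.
  have -> : (d.+1 - a - b.+1 = d - a - b)%N by lia.
  by rewrite exprS; ring.
by rewrite /lmul !evD !evZ E0 E1 E2 /dot; ring.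
Qed.

Definition prodL (us : seq ('I_3 -> K)) := foldr lmul one3 us.

Lemma td_prodL us : td (size us) (prodL us).
Proof. by elim: us => [|u us IH]; [apply: td_one | apply: td_lmul]. Qed.

Lemma ev_prodL us x : ev (size us) (prodL us) x = \prod_(u <- us) dot u x.
Proof.
elim: us => [|u us IH]; first by rewrite big_nil ev_one.
by rewrite big_cons -IH -ev_lmul //; apply: td_prodL.
Qed.

(** At (1, s, t) the form is a polynomial in s whose coefficients are polynomials in t; both levels
    vanish identically. *)
Lemma ev_inj d C : td d C -> (forall x, ev d C x = 0) -> forall a b, C a b = 0.
Proof.
move=> tC h.
suff H a b : (a + b <= d)%N -> C a b = 0.
  by move=> a b; case: (leqP (a + b) d) => [/H|/tC].
move=> ab.
have E s t : \sum_(0 <= a < d.+1) (\sum_(0 <= b < d.+1 - a) C a b * t ^+ b) * s ^+ a = 0.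
  rewrite -[RHS](h (mk3 1 s t)) evE; apply: eq_bigr => a' _; rewrite big_distrl /=.
  apply: eq_bigr => b1 _; rewrite !mk3E expr1n; ring.
have E1 t : \sum_(0 <= b < d.+1 - a) C a b * t ^+ b = 0.
  pose P := \poly_(a < d.+1) (\sum_(0 <= b < d.+1 - a) C a b * t ^+ b).
  have P0 : P = 0.
    by apply: poly_vanishT => s; rewrite horner_poly -[RHS](E s t) big_mkord.
  have := coef_poly d.+1 (fun a => \sum_(0 <= b < d.+1 - a) C a b * t ^+ b) a.
  by rewrite -/P P0 coef0 ltnS (leq_trans (leq_addr b a) ab).
pose P := \poly_(b < d.+1 - a) C a b.
have P0 : P = 0.
  by apply: poly_vanishT => s; rewrite horner_poly -[RHS](E1 s) big_mkord.
have := coef_poly (d.+1 - a) (fun b => C a b) b.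
rewrite -/P P0 coef0; have -> : (b < d.+1 - a)%N by lia.
by [].
Qed.

Lemma ev_scale d C k x : ev d C (fun i => k * x i) = k ^+ d * ev d C x.
Proof.
rewrite /ev big_distrr !big_seq; apply: eq_bigr => ab; rewrite mem_mons => h /=.
rewrite -[x0 (fun _ => _)]/(k * x0 x) -[x1 (fun _ => _)]/(k * x1 x) -[x2 (fun _ => _)]/(k * x2 x).
have -> : k ^+ d = k ^+ (d - ab.1 - ab.2) * k ^+ ab.1 * k ^+ ab.2.
  by rewrite -!exprD; congr (_ ^+ _); lia.
by rewrite !exprMn; ring.
Qed.

Definition vec d C (i : 'I_(nforms d)) : K :=
  let ab := nth (0, 0)%N (mons d) i in C ab.1 ab.2.

Definition unvec d (c : 'I_(nforms d) -> K) a b : K :=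
  \sum_(i < nforms d | nth (0, 0)%N (mons d) i == (a, b)) c i.

Lemma eval_vec d C x : eval_form (@vec d C) x = ev d C x.
Proof.
rewrite /eval_form /ev (big_nth (0, 0)%N) big_mkord; apply: eq_bigr => i _.
by rewrite /vec !mulrA.
Qed.

Lemma unvecK d (c : 'I_(nforms d) -> K) : @vec d (unvec c) = c.
Proof.
apply: functional_extensionality => i; rewrite /vec /unvec -surjective_pairing (bigD1 i) //=.
rewrite big1 ?addr0 // => j /andP[/eqP E ne]; case/eqP: ne; apply: val_inj => /=.
by apply/eqP; rewrite -(nth_uniq (0, 0)%N _ _ (uniq_mons d)) ?E //; apply: ltn_ord.
Qed.

Lemma vec_coord d a b : (a + b <= d)%N ->
  exists i : 'I_(nforms d), forall C, vec C i = C a b.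
Proof.
move=> h; have hm : (a, b) \in mons d by rewrite mem_mons.
have hi : (index (a, b) (mons d) < nforms d)%N by rewrite /nforms index_mem.
by exists (Ordinal hi) => C'; rewrite /vec /= nth_index.
Qed.

Lemma td_unvec d (c : 'I_(nforms d) -> K) : td d (unvec c).
Proof.
move=> a b ab; rewrite /unvec big_pred0 // => i; apply: contraTF ab => /eqP E.
have := mem_nth (0, 0)%N (ltn_ord i : (i < size (mons d))%N); rewrite E mem_mons /=.
by rewrite leqNgt.
Qed.

Lemma eval_unvec d (c : 'I_(nforms d) -> K) x : eval_form c x = ev d (unvec c) x.
Proof. by rewrite -eval_vec unvecK. Qed.

Lemma vecK d C : td d C -> unvec (@vec d C) = C.
Proof.
move=> tC; have E := unvecK (@vec d C).
apply: functional_extensionality => a; apply: functional_extensionality => b.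
case: (leqP (a + b) d) => ab; last by rewrite td_unvec // tC.
by have [m hm] := vec_coord ab; rewrite -!hm E.
Qed.

End Forms.

(** * Vectors and forms depending polynomially on parameters *)

Section PolyVec.
Variables (K : closedFieldType) (I : Type).
Implicit Types (u v : (I -> K) -> 'I_3 -> K).

Definition pvec u := forall k, polyfun (fun y => u y k).

Lemma pvec_const x : pvec (fun=> x).
Proof. by move=> k; apply: polyfunC. Qed.

Lemma pvec_mk3 (a b c : (I -> K) -> K) : polyfun a -> polyfun b -> polyfun c ->
  pvec (fun y => mk3 (a y) (b y) (c y)).
Proof. by move=> ha hb hc [[|[|k]] hk]. Qed.

Lemma polyfun_dot u v : pvec u -> pvec v -> polyfun (fun y => dot (u y) (v y)).
Proof. by move=> hu hv; apply: polyfunD; [apply: polyfunD|]; apply: polyfunM; [apply: hu|apply: hv|apply: hu|apply: hv|apply: hu|apply: hv]. Qed.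

Lemma pvec_cross u v : pvec u -> pvec v -> pvec (fun y => cross (u y) (v y)).
Proof.
by move=> hu hv; apply: pvec_mk3; apply: polyfunB; apply: polyfunM; first [apply: hu|apply: hv].
Qed.

Lemma polyfun_det3 u v w : pvec u -> pvec v -> pvec w -> polyfun (fun y => det3 (u y) (v y) (w y)).
Proof. by move=> hu hv hw; apply: polyfun_dot => //; apply: pvec_cross. Qed.

Definition pform (C : (I -> K) -> nat -> nat -> K) := forall a b, polyfun (fun y => C y a b).

Lemma pform_lmul u C : pvec u -> pform C -> pform (fun y => lmul (u y) (C y)).
Proof.
move=> hu hC a b; apply: polyfunD; [apply: polyfunD|]; apply: polyfunM; try exact: hu.
- exact: hC.
- by case: a => [|a]; [apply: polyfunC | apply: hC].
- by case: b => [|b]; [apply: polyfunC | apply: hC].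
Qed.

Lemma pform_prodL (T : Type) (r : seq T) (us : T -> (I -> K) -> 'I_3 -> K) :
  (forall t, pvec (us t)) -> pform (fun y => prodL [seq us t y | t <- r]).
Proof.
move=> h; elim: r => [|t r IH]; first by move=> a b; apply: polyfunC.
exact: (pform_lmul (h t) IH).
Qed.

Lemma pform_sum (T : Type) (r : seq T) (P : pred T) (F : T -> (I -> K) -> nat -> nat -> K) :
  (forall t, pform (F t)) -> pform (fun y a b => \sum_(t <- r | P t) F t y a b).
Proof. by move=> h a b; apply: polyfun_sum => t; apply: h. Qed.

Lemma pformZ c C : polyfun c -> pform C -> pform (fun y a b => c y * C y a b).
Proof. by move=> hc hC a b; apply: polyfunM. Qed.

Lemma polyfun_ev d C u : pform C -> pvec u -> polyfun (fun y => ev d (C y) (u y)).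
Proof.
move=> hC hu; apply: polyfun_sum => ab; apply: polyfunM; first exact: hC.
by apply: polyfunM; [apply: polyfunM|]; apply: polyfunX; apply: hu.
Qed.

End PolyVec.

(** * Curves through a star configuration *)

Section Star.
Variable K : closedFieldType.
Variable l : nat.
Implicit Types (C : nat -> nat -> K) (x u v w z : 'I_3 -> K) (L : 'I_l -> 'I_3 -> K) (d : nat).

(** General position through cross products and determinants, for indices in any order. It agrees
    with [in_D] when l >= 2 and, unlike it, quantifies over no points. *)
Definition Dgood L := (forall i j, i != j -> vnz (cross (L i) (L j))) /\
  (forall i j k, i != j -> j != k -> i != k -> det3 (L i) (L j) (L k) != 0).

Definition Idl d L C := td d C /\ forall i j, i != j -> ev d C (cross (L i) (L j)) = 0.

Lemma cross_vnz_l u v : vnz (cross u v) -> vnz u.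
Proof.
move=> h; apply: NNPP => /vnz3P[h0 h1 h2]; have /vnz3 := h; rewrite /cross !mk3E.
by rewrite h0 h1 h2 !mul0r subrr eqxx.
Qed.

Lemma in_D_good L : in_D L -> Dgood L.
Proof.
move=> [h1 [h2 h3]].
have h4 i j : i != j -> vnz (cross (L i) (L j)).
  by move=> ij; apply: NNPP => h; apply: (h2 _ _ ij); apply: same_pt_cross.
split=> // i j k ij jk ik; apply/eqP => E.
have h5 (a b c : 'I_l) : a != b -> det3 (L a) (L b) (L c) = 0 -> concurrent (L a) (L b) (L c).
  move=> ab dE; exists (cross (L a) (L b)); split; first exact: h4.
  rewrite !on_lineE dot_cross_l dot_cross_r; split=> //; split=> //.
  by rewrite -/(det3 _ _ _) det3R.
have E1 : det3 (L j) (L k) (L i) = 0 by rewrite -det3R.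
have E2 : det3 (L k) (L i) (L j) = 0 by rewrite -det3R.
have E3 : det3 (L i) (L k) (L j) = 0 by rewrite det3C E oppr0.
have E4 : det3 (L k) (L j) (L i) = 0 by rewrite -det3R.
have E5 : det3 (L j) (L i) (L k) = 0 by rewrite det3C E1 oppr0.
have ne (a b : 'I_l) : a != b -> (a < b)%N \/ (b < a)%N.
  by move=> ab; apply/orP; rewrite -neq_ltn.
have lne (a b : 'I_l) : (a < b)%N -> a != b by move=> ab; rewrite -val_eqE /= ltn_eqF.
have [a|a] := ne _ _ ij; have [b|b] := ne _ _ jk; have [c|c] := ne _ _ ik.
- exact: (h3 _ _ _ a b (h5 _ _ _ ij E)).
- by lia.
- exact: (h3 _ _ _ c b (h5 _ _ _ (lne _ _ c) E3)).
- exact: (h3 _ _ _ c a (h5 _ _ _ (lne _ _ c) E2)).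
- exact: (h3 _ _ _ a c (h5 _ _ _ (lne _ _ a) E5)).
- exact: (h3 _ _ _ b c (h5 _ _ _ (lne _ _ b) E1)).
- by lia.
- exact: (h3 _ _ _ b a (h5 _ _ _ (lne _ _ b) E4)).
Qed.

Lemma good_in_D L : (2 <= l)%N -> Dgood L -> in_D L.
Proof.
move=> l2 [h1 h2]; split; [|split].
- move=> i; have [j ij] : exists j, i != j.
    have [o0 o1] : (0 < l)%N /\ (1 < l)%N by lia.
    case: (eqVneq i (Ordinal o0)) => [->|ne]; last by exists (Ordinal o0).
    by exists (Ordinal o1).
  exact: cross_vnz_l (h1 _ _ ij).
- move=> i j ij [t [t0 E]]; have /vnz3 := h1 _ _ ij; rewrite /cross !mk3E /x0 /x1 /x2 !E.
  by rewrite -!mulrA ![t * (L j _ * _)]mulrA ![t * L j _]mulrC -!mulrA ![L j _ * (t * _)]mulrCA ![L j (inord 2) * L j (inord 1)]mulrC ![L j (inord 2) * L j ord0]mulrC ![L j (inord 1) * L j ord0]mulrC !subrr eqxx.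
- move=> i j k ij jk [x [xn [/on_lineE hi [/on_lineE hj /on_lineE hk]]]].
  have nij : i != j by rewrite -val_eqE /= ltn_eqF.
  have njk : j != k by rewrite -val_eqE /= ltn_eqF.
  have nik : i != k by rewrite -val_eqE /= ltn_eqF // (ltn_trans ij).
  have [c Ec] := cross_prop hi hj (h1 _ _ nij).
  have c0 : c != 0.
    by apply: contraPneq xn => c0 [a]; rewrite Ec c0 mul0r eqxx.
  have := h2 _ _ _ nij njk nik; rewrite det3R det3R.
  suff -> : det3 (L k) (L i) (L j) = 0 by rewrite eqxx.
  apply/eqP; have /eqP := hk; rewrite Ec /det3.
  have -> : dot (L k) (fun i0 => c * cross (L i) (L j) i0) = c * dot (L k) (cross (L i) (L j)).
    by rewrite /dot /x0 /x1 /x2; ring.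
  by rewrite mulf_eq0 (negPf c0).
Qed.

Lemma star_Idl d L (c : 'I_(nforms d) -> K) : Dgood L ->
  contains_star c L <-> Idl d L (unvec c).
Proof.
move=> [h1 h2]; split=> [h|[_ h] i j ij x xn /on_lineE hi /on_lineE hj].
  split; first exact: td_unvec.
  move=> i j ij; rewrite -eval_unvec.
  move: (ij); rewrite neq_ltn => /orP[lt|lt].
    apply: (h i j lt); [exact: h1 | apply/on_lineE; exact: dot_cross_l | apply/on_lineE; exact: dot_cross_r].
  apply: (h j i lt); [exact: h1 | apply/on_lineE; exact: dot_cross_r | apply/on_lineE; exact: dot_cross_l].
have nij : i != j by rewrite -val_eqE /= ltn_eqF.
have [k ->] := cross_prop hi hj (h1 _ _ nij).
by rewrite eval_unvec ev_scale h ?mulr0.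
Qed.

(** An auxiliary line off the star: each pair of lines excludes the zeros of one nonzero linear form
    in z. *)
Lemma generic_form L : (forall i j, i != j -> vnz (cross (L i) (L j))) ->
  exists z, forall i j, i != j -> dot z (cross (L i) (L j)) != 0.
Proof.
move=> h; pose F (p : 'I_l * 'I_l) z := if p.1 == p.2 then 1 else dot z (cross (L p.1) (L p.2)).
have [p|p|z hz] := @polyfun_nz_prod K 'I_3 ('I_l * 'I_l)%type F.
- rewrite /F; case: eqP => _; first exact: polyfunC.
  by apply: polyfun_dot; [move=> k; apply: polyfun_coord | apply: pvec_const].
- rewrite /F; case: eqVneq => [_|/h/vnz3/or3P[] nz]; first by exists (fun=> 0); rewrite oner_eq0.
  + by exists (mk3 1 0 0); rewrite /dot mk3_0 mk3_1 mk3_2 mul1r !mul0r !addr0.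
  + by exists (mk3 0 1 0); rewrite /dot mk3_0 mk3_1 mk3_2 mul1r !mul0r addr0 add0r.
  + by exists (mk3 0 0 1); rewrite /dot mk3_0 mk3_1 mk3_2 mul1r !mul0r !add0r.
by exists z => i j ij; have := hz (i, j); rewrite /F /= (negPf ij).
Qed.

Definition others (P : pred 'I_l) L := [seq L k | k <- enum 'I_l & P k].

Lemma size_others (P : pred 'I_l) L : size (others P L) = #|P|.
Proof. by rewrite size_map size_filter -sum1_count -sum1_card big_enum_cond; apply: eq_bigl. Qed.

Definition omit1 L i := prodL (others (fun k => k != i) L).

Lemma prod_others (P : pred 'I_l) L x :
  \prod_(u <- others P L) dot u x = \prod_(k | P k) dot (L k) x.
Proof. by rewrite big_map big_filter big_enum_cond. Qed.

Lemma td_omit1 L i : td (l - 1) (omit1 L i).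
Proof.
have -> : (l - 1)%N = size (others (fun k => k != i) L).
  by rewrite size_others cardC1 card_ord subn1.
exact: td_prodL.
Qed.

Lemma ev_omit1 L i x : ev (l - 1) (omit1 L i) x = \prod_(k | k != i) dot (L k) x.
Proof.
have -> : (l - 1)%N = size (others (fun k => k != i) L).
  by rewrite size_others cardC1 card_ord subn1.
by rewrite ev_prodL prod_others.
Qed.

Lemma ev_omit1_star L i a b : a != b -> ev (l - 1) (omit1 L i) (cross (L a) (L b)) = 0.
Proof.
move=> ab; rewrite ev_omit1; have [k ki kab] : exists2 k, k != i & k \in [:: a; b].
  case: (eqVneq a i) => [<-|ai]; [exists b | exists a]; rewrite ?inE ?eqxx ?orbT // eq_sym //.
rewrite (bigD1 k) //=; move: kab; rewrite !inE => /orP[] /eqP ->.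
  by rewrite dot_cross_l mul0r.
by rewrite dot_cross_r mul0r.
Qed.

(** Interpolation form for the point of lines i and j: the l-2 other lines pass through all other
    points, and a power of z fills up the degree. *)
Definition bump2 z d L i j :=
  prodL (nseq (d + 2 - l) z ++ others (fun k => (k != i) && (k != j)) L).

Lemma size_bump2 z d L i j : i != j -> (l <= d + 2)%N ->
  size (nseq (d + 2 - l) z ++ others (fun k => (k != i) && (k != j)) L) = d.
Proof.
move=> ij ld; rewrite size_cat size_nseq size_others.
have -> : #|[pred k | (k != i) && (k != j)]| = (l - 2)%N.
  rewrite (eq_card (B := [predC (pred2 i j)])); last by move=> k; rewrite !inE negb_or.
  by have := cardC (pred2 i j); rewrite card2 ij card_ord => E; rewrite -[X in (X - 2)%N]E addKn.
have := ltn_ord i; have := ltn_ord j; move: ij; rewrite -val_eqE /=; lia.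
Qed.

Lemma td_bump2 z d L i j : i != j -> (l <= d + 2)%N -> td d (bump2 z d L i j).
Proof. by move=> ij ld; rewrite -{1}(@size_bump2 z d L i j) //; apply: td_prodL. Qed.

Lemma ev_bump2 z d L i j x : i != j -> (l <= d + 2)%N ->
  ev d (bump2 z d L i j) x = dot z x ^+ (d + 2 - l) * \prod_(k | (k != i) && (k != j)) dot (L k) x.
Proof.
move=> ij ld; rewrite -{1}(@size_bump2 z d L i j) // ev_prodL big_cat prod_others /=.
by rewrite big_nseq iter_mulr_1.
Qed.

Definition pairs := {p : 'I_l * 'I_l | (p.1 < p.2)%N}.

Lemma pair_neq (p : pairs) : (val p).1 != (val p).2.
Proof. by rewrite -val_eqE /= ltn_eqF // (valP p). Qed.

Lemma card_pairs : #|{: pairs}| = 'C(l, 2).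
Proof.
rewrite card_sig -sum1_card (eq_bigl (fun p : 'I_l * 'I_l => (p.1 < p.2)%N)) //.
rewrite -bin2_sum big_mkord.
rewrite (eq_bigl (fun p : 'I_l * 'I_l => xpredT p.1 && (p.1 < p.2)%N)) //.
rewrite -(pair_big_dep xpredT (fun i j : 'I_l => (i < j)%N) (fun _ _ => 1%N)) /=.
rewrite (exchange_big_dep xpredT) //=; apply: eq_bigr => j _.
rewrite -(big_ord_widen _ (fun _ => 1%N) (ltnW (ltn_ord j))).
by rewrite sum1_card card_ord.
Qed.

Definition pt L (p : pairs) := cross (L (val p).1) (L (val p).2).

Lemma bump2_off z d L (p p' : pairs) : (l <= d + 2)%N -> p != p' ->
  ev d (bump2 z d L (val p).1 (val p).2) (pt L p') = 0.
Proof.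
move=> ld ne; rewrite ev_bump2 ?pair_neq // /pt.
have [k kp kab] : exists2 k, (k != (val p).1) && (k != (val p).2) & k \in [:: (val p').1; (val p').2].
  case: p p' ne => [[a b] /= ab] [[a' b'] /= ab']; rewrite -val_eqE /= xpair_eqE => ne.
  case: (boolP ((a' != a) && (a' != b))) => ha; first by exists a'; rewrite ?inE ?eqxx.
  exists b'; last by rewrite !inE eqxx orbT.
  move: ha ne; rewrite negb_and !negbK -!val_eqE /= => ha ne.
  apply/andP; split; apply/negP => /eqP E; move: ha ne; rewrite ?E; lia.
rewrite (bigD1 k) //=; move: kab; rewrite !inE => /orP[] /eqP ->.
  by rewrite dot_cross_l mul0r mulr0.
by rewrite dot_cross_r mul0r mulr0.
Qed.

Lemma bump2_on z d L (p : pairs) : (l <= d + 2)%N -> Dgood L ->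
  (forall i j, i != j -> dot z (cross (L i) (L j)) != 0) ->
  ev d (bump2 z d L (val p).1 (val p).2) (pt L p) != 0.
Proof.
move=> ld [h1 h2] hz; have pn := pair_neq p; rewrite ev_bump2 // /pt mulf_neq0 ?expf_neq0 ?hz //.
apply/prodf_neq0 => k /andP[k1 k2]; rewrite -/(det3 _ _ _).
by apply: h2 => //.
Qed.

(** * Independence of the conditions at the star points *)

Section Matrices.
Variable d : nat.
Hypothesis ld : (l <= d + 2)%N.
Local Notation N := (nforms d).
Local Notation q := #|{: pairs}|.

Definition rowf C : 'rV[K]_N := \row_m vec C m.

Definition evmx L : 'M[K]_(N, q) := \matrix_(m, p)
  let ab := nth (0, 0)%N (mons d) m in
  let x := pt L (enum_val p) in x0 x ^+ (d - ab.1 - ab.2) * x1 x ^+ ab.1 * x2 x ^+ ab.2.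

Lemma evmxE L (c : 'rV[K]_N) p : (c *m evmx L) 0 p = ev d (unvec (c 0)) (pt L (enum_val p)).
Proof.
rewrite mxE -eval_unvec /eval_form; apply: eq_bigr => m _.
by rewrite mxE !mulrA.
Qed.

Lemma evmx_Idl L (c : 'rV[K]_N) : (forall i j, i != j -> vnz (cross (L i) (L j))) ->
  c *m evmx L = 0 <-> Idl d L (unvec (c 0)).
Proof.
move=> hL; split=> [/rowP h|[_ h]]; last first.
  by apply/rowP => p; rewrite evmxE mxE h // pair_neq.
split; first exact: td_unvec.
have H (i j : 'I_l) : (i < j)%N -> ev d (unvec (c 0)) (cross (L i) (L j)) = 0.
  move=> ij; pose p : pairs := exist (fun p : 'I_l * 'I_l => (p.1 < p.2)%N) (i, j) ij.
  by have := h (enum_rank p); rewrite evmxE enum_rankK mxE.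
move=> i j; rewrite neq_ltn => /orP[/H //|/H E].
have -> : cross (L i) (L j) = fun k => -1 * cross (L j) (L i) k.
  apply: ext3; rewrite -?[RHS]/(-1 * x0 (cross _ _)) -?[RHS]/(-1 * x1 (cross _ _)) -?[RHS]/(-1 * x2 (cross _ _)) /cross.
  + by rewrite -[RHS]/(-1 * x0 _) !mk3E; ring.
  + by rewrite -[RHS]/(-1 * x1 _) !mk3E; ring.
  + by rewrite -[RHS]/(-1 * x2 _) !mk3E; ring.
by rewrite ev_scale E mulr0.
Qed.

Definition dlt z L (p : pairs) := ev d (bump2 z d L (val p).1 (val p).2) (pt L p).
Definition dltall z L := \prod_p dlt z L p.

(** Each interpolation form is multiplied by the values [dlt] belonging to the other points. All
    diagonal entries of the product with [evmx] then coincide without any division, and the matrix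
    stays polynomial in the lines. *)
Definition bmx z L : 'M[K]_(q, N) := \matrix_(p, m)
  ((\prod_(p' | p' != enum_val p) dlt z L p') *
   vec (bump2 z d L (val (enum_val p)).1 (val (enum_val p)).2) m).

Lemma bmx_evmx z L : bmx z L *m evmx L = (dltall z L)%:M.
Proof.
apply/row_matrixP => p; rewrite row_mul; apply/rowP => p'.
rewrite evmxE.
set P := enum_val p.
have E : unvec ((row p (bmx z L)) 0) = fun a b => (\prod_(p' | p' != P) dlt z L p') *
    bump2 z d L (val P).1 (val P).2 a b.
  rewrite -[RHS](@vecK _ d); last by apply: tdZ; apply: td_bump2; rewrite ?pair_neq.
  by congr unvec; apply: functional_extensionality => m; rewrite !mxE.
rewrite E evZ !mxE; case: (eqVneq p p') => [<-|ne].
  by rewrite mulr1n /dltall [RHS](bigD1 P) //= [RHS]mulrC.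
rewrite mulr0n bump2_off ?mulr0 //.
by apply: contraNneq ne => /enum_val_inj ->.
Qed.

Lemma dltall_neq0 z L : Dgood L -> (forall i j, i != j -> dot z (cross (L i) (L j)) != 0) ->
  dltall z L != 0.
Proof. by move=> hL hz; apply/prodf_neq0 => p _; apply: bump2_on. Qed.

Lemma rank_evmx L : Dgood L -> \rank (evmx L) = q.
Proof.
move=> hL; have [z hz] := generic_form hL.1.
have d0 := dltall_neq0 hL hz.
apply/eqP; rewrite eqn_leq rank_leq_col /=.
rewrite -[X in (X <= _)%N](mxrank1 K q) -(mxrank_scale_nz _ d0) scalemx1 -(bmx_evmx z L).
exact: mxrankM_maxr.
Qed.

End Matrices.

End Star.

(** * Forms of degree l - 1 and normalized lines *)

Section Span.
Variable K : closedFieldType.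
Variable l : nat.
Hypothesis l2 : (2 <= l)%N.
Implicit Types (C : nat -> nat -> K) (x u v w z : 'I_3 -> K) (L : 'I_l -> 'I_3 -> K) (d : nat).

Definition comb L (g : 'I_l -> K) a b := \sum_i g i * omit1 L i a b.

Lemma td_comb L g : td (l - 1) (comb L g).
Proof. by apply: td_sum => i; apply/tdZ/td_omit1. Qed.

Lemma ev_comb L g x : ev (l - 1) (comb L g) x = \sum_i g i * \prod_(k | k != i) dot (L k) x.
Proof. by rewrite ev_sum; apply: eq_bigr => i _; rewrite evZ ev_omit1. Qed.

Lemma Idl_comb L g : Idl (l - 1) L (comb L g).
Proof.
split=> [|i j ij]; first exact: td_comb.
by rewrite ev_sum big1 // => k _; rewrite evZ ev_omit1_star // mulr0.
Qed.

Lemma comb_at_node L g z i :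
  ev (l - 1) (comb L g) (cross (L i) z) = g i * \prod_(k | k != i) det3 (L k) (L i) z.
Proof.
rewrite ev_comb (bigD1 i) //= [X in _ + X]big1 ?addr0 // => j ji.
by rewrite (bigD1 i) 1?eq_sym //= dot_cross_l mul0r mulr0.
Qed.

Lemma node_neq0 L z i : (forall i j, i != j -> dot z (cross (L i) (L j)) != 0) ->
  \prod_(k | k != i) det3 (L k) (L i) z != 0.
Proof. by move=> hz; apply/prodf_neq0 => k ki; rewrite -det3R; apply: hz. Qed.

(** The point of line i on z is a zero of every product but the one omitting line i, so the l
    products are independent. They span because binom(l+1,2) - binom(l,2) = l. *)
Lemma Idl_span L C : Dgood L -> Idl (l - 1) L C -> exists g, C = comb L g.
Proof.
move=> hL hC; have [z hz] := generic_form hL.1.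
pose N := nforms (l - 1); pose P : 'M[K]_(l, N) := \matrix_(i, m) vec (omit1 L i) m.
have PE (g : 'rV[K]_l) : unvec ((g *m P) 0) = comb L (g 0).
  rewrite -[RHS](@vecK _ (l - 1)) ?td_comb //; last exact: td_comb.
  congr unvec; apply: functional_extensionality => m; rewrite mxE /vec /comb.
  by apply: eq_bigr => i _; rewrite mxE.
have fP : row_free P.
  apply: inj_row_free => v hv; apply/rowP => i; rewrite [RHS]mxE.
  have := comb_at_node L (v 0) z i; rewrite -PE hv.
  have -> : unvec ((0 : 'rV[K]_N) 0) = fun _ _ => 0.
    apply: functional_extensionality => a; apply: functional_extensionality => b.
    by rewrite /unvec big1 // => ? _; rewrite mxE.
  rewrite /ev big1; last by move=> ab _; rewrite mul0r.
  by move/esym/eqP; rewrite mulf_eq0 (negPf (node_neq0 _ hz)) orbF => /eqP.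
have ld : (l <= l - 1 + 2)%N by lia.
have sub : (P <= kermx (evmx (l - 1) L))%MS.
  apply/sub_kermxP/row_matrixP => i; rewrite row_mul row0.
  apply/(evmx_Idl _ hL.1); have -> : unvec (row i P 0) = omit1 L i.
    rewrite -[RHS](@vecK _ (l - 1)); last exact: td_omit1.
    by congr unvec; apply: functional_extensionality => m; rewrite !mxE.
  by split=> [|a b ab]; [exact: td_omit1 | exact: ev_omit1_star].
have sub2 : (kermx (evmx (l - 1) L) <= P)%MS.
  rewrite -(mxrank_leqif_sup sub) mxrank_ker rank_evmx // (eqP fP) card_pairs size_mons.
  have -> : (l - 1).+2 = l.+1 by lia.
  by rewrite binS bin1 addKn.
have : (rowf (l - 1) C <= P)%MS.
  apply: submx_trans sub2; apply/sub_kermxP/(evmx_Idl _ hL.1).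
  have -> : unvec ((rowf (l - 1) C) 0) = C.
    rewrite -[RHS](@vecK _ (l - 1)); last by case: hC.
    by congr unvec; apply: functional_extensionality => m; rewrite !mxE.
  exact: hC.
move/submxP => [g hg]; exists (g 0); rewrite -PE -hg.
rewrite -[LHS](@vecK _ (l - 1)); last by case: hC.
by congr unvec; apply: functional_extensionality => m; rewrite !mxE.
Qed.

(** A power of z lifts the form to degree l-1, where it is a combination of the products omitting
    one line. Since it vanishes along z, evaluation at the point of line i on z kills the i-th
    coefficient. *)
Lemma Idl_empty L C d : (d < l - 1)%N -> Dgood L -> Idl d L C -> forall a b, C a b = 0.
Proof.
move=> dl hL [tC hC]; have [z hz] := generic_form hL.1.
pose C' k := iter k (lmul z) C.
have hC' k : td (k + d) (C' k) /\ forall x, ev (k + d) (C' k) x = dot z x ^+ k * ev d C x.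
  elim: k => [|k [IH1 IH2]]; first by split=> // x; rewrite expr0 mul1r.
  split; first exact: td_lmul.
  by move=> x; rewrite addSn /C' iterS ev_lmul // -/(C' k) IH2 exprS mulrA.
pose k := (l - 1 - d)%N.
have [tk ek] := hC' k; have Ek : (k + d = l - 1)%N by rewrite /k; lia.
rewrite Ek in tk ek.
have [g hg] : exists g, C' k = comb L g.
  by apply: Idl_span => //; split=> // i j ij; rewrite ek hC ?mulr0.
have g0 i : g i = 0.
  have := comb_at_node L g z i; rewrite -hg ek dot_cross_r expr0n.
  have -> : (k == 0%N) = false by rewrite /k; lia.
  by rewrite mul0r => /esym/eqP; rewrite mulf_eq0 (negPf (node_neq0 _ hz)) orbF => /eqP.
apply: (ev_inj tC).
have [o0 o1] : (0 < l)%N /\ (1 < l)%N by lia.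
pose i0 := Ordinal o0; pose i1 := Ordinal o1.
apply: (polyfun_zero (g := fun x => dot z x) (v0 := cross (L i0) (L i1))).
- apply: (@polyfun_ev K 'I_3 d (fun=> C) (fun x => x)); first by move=> a b; apply: polyfunC.
  by move=> k'; apply: polyfun_coord.
- apply: (@polyfun_dot K 'I_3 (fun=> z) (fun x => x)); first exact: pvec_const.
  by move=> k'; apply: polyfun_coord.
- exact: hz.
move=> x zx; have := ek x; rewrite hg ev_comb big1; last by move=> i _; rewrite g0 mul0r.
by move/esym/eqP; rewrite mulf_eq0 expf_eq0 (negPf zx) andbF => /eqP.
Qed.

Definition lines := ('I_l + 'I_l -> K).
(** First coefficient 1 leaves two parameters for each line, as the dimension count requires; [Lof]
    keeps all three coefficients free. *)
Definition Ln (y : lines) i := mk3 1 (y (inl i)) (y (inr i)).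
Definition Lof (y : 'I_l * 'I_3 -> K) (i : 'I_l) (k : 'I_3) := y (i, k).

Lemma pvec_Ln i : pvec (fun y => Ln y i).
Proof. by apply: pvec_mk3; [apply: polyfunC | apply: polyfun_coord | apply: polyfun_coord]. Qed.

Lemma pvec_Lof i : pvec (fun y => Lof y i).
Proof. by move=> k; apply: polyfun_coord. Qed.

Definition e0 : 'I_3 -> K := mk3 1 0 0.

(* the line x0 = 0 is in general position with respect to the lines of L *)
Definition Dstar L := (forall i j, i != j -> det3 e0 (L i) (L j) != 0) /\
  (forall i j k, i != j -> j != k -> i != k -> det3 (L i) (L j) (L k) != 0).

Lemma Dstar_good L : Dstar L -> Dgood L.
Proof.
move=> [h1 h2]; split=> // i j ij; apply: NNPP => /vnz3P[a b c].
by have := h1 _ _ ij; rewrite /det3 /dot a b c !mulr0 !addr0 eqxx.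
Qed.

Lemma ex_Dstar : exists G : lines -> K, [/\ polyfun G, exists y, G y != 0 &
  forall y, G y != 0 -> Dstar (Ln y)].
Proof.
pose F (p : 'I_l * 'I_l * option 'I_l) (y : lines) : K := match p with
  | (i, j, None) => if i == j then 1 else det3 e0 (Ln y i) (Ln y j)
  | (i, j, Some k) => if [|| i == j, j == k | i == k] then 1 else det3 (Ln y i) (Ln y j) (Ln y k)
  end.
have FP p : polyfun (F p).
  case: p => [[i j] [k|]]; rewrite /F.
    case: [|| i == j, j == k | i == k] => /=; first exact: polyfunC.
    exact: (polyfun_det3 (pvec_Ln i) (pvec_Ln j) (pvec_Ln k)).
  case: (i == j) => /=; first exact: polyfunC.
  exact: (polyfun_det3 (pvec_const _ e0) (pvec_Ln i) (pvec_Ln j)).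
exists (fun y => \prod_p F p y); split.
- exact: polyfun_prod.
(* Lines (1, t, t^2) with distinct nonzero t: the determinants are products of differences, those
   with [e0] having additional factors t. *)
- have [s [us s0 ss]] := inj_points K l.
  pose t (i : 'I_l) := s`_i.
  have tn i j : i != j -> t j - t i != 0.
    by move=> ij; rewrite subr_eq0 nth_uniq ?ss ?ltn_ord // eq_sym.
  have t0 i : t i != 0.
    by apply: contraNneq s0 => <-; rewrite mem_nth // ss.
  exists (fun o => match o with inl i => t i | inr i => t i ^+ 2 end).
  apply/prodf_neq0 => -[[i j] [k|]] _ /=; case: ifP; rewrite ?oner_neq0 //.
    move/negbT; rewrite !negb_or => /and3P[ij jk ik].
    rewrite det3E !mk3E.
    suff -> : 1 * (t j * t k ^+ 2 - t j ^+ 2 * t k) + t i * (t j ^+ 2 * 1 - 1 * t k ^+ 2) +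
      t i ^+ 2 * (1 * t k - t j * 1) = (t j - t i) * (t k - t j) * (t k - t i).
      by rewrite !mulf_neq0 ?tn.
    by ring.
  move/negbT => ij; rewrite det3E !mk3E.
  suff -> : 1 * (t i * t j ^+ 2 - t i ^+ 2 * t j) + 0 * (t i ^+ 2 * 1 - 1 * t j ^+ 2) + 0 * (1 * t j - t i * 1)
    = t i * t j * (t j - t i) by rewrite !mulf_neq0 ?tn.
  by ring.
- move=> y hy; have H p : F p y != 0.
    by move: hy; rewrite (bigD1 p) //= mulf_eq0 negb_or => /andP[].
  split=> [i j ij|i j k ij jk ik].
    by have := H (i, j, None); rewrite /= (negPf ij).
  by have := H (i, j, Some k); rewrite /= (negPf ij) (negPf jk) (negPf ik).
Qed.

(** A tuple with nonzero first coefficients is a rescaled normalized tuple; the remaining tuples,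
    and those excluded by [G], are reached by the identity principle. *)
Lemma norm_lines (F : ('I_l * 'I_3 -> K) -> K) (G : lines -> K) :
  polyfun F -> polyfun G -> (exists y, G y != 0) ->
  (forall s y, (forall i, s i != 0) -> G y != 0 ->
     F (fun p => s p.1 * Ln y p.1 p.2) = 0) -> forall Y, F Y = 0.
Proof.
move=> hF hG [y0 Gy0] h.
have h1 s y : (forall i, s i != 0) -> F (fun p => s p.1 * Ln y p.1 p.2) = 0.
  move=> s0; apply: (polyfun_zero (f := fun y => F (fun p => s p.1 * Ln y p.1 p.2)) _ hG Gy0).
    apply: (polyfun_affine (h := fun y p => s p.1 * Ln y p.1 p.2) hF) => u u'.
    exists (fun p => s p.1 * Ln u p.1 p.2), (fun p => s p.1 * mk3 0 (u' (inl p.1)) (u' (inr p.1)) p.2) => t [i [[|[|k]] hk]];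
    by rewrite /Ln /mk3 /=; ring.
  by move=> y' Gy'; apply: h.
have hP : polyfun (fun Y : 'I_l * 'I_3 -> K => \prod_(i < l) Y (i, ord0)).
  by apply: polyfun_prod => i; apply: polyfun_coord.
apply: (polyfun_zero hF hP (v0 := fun=> 1)); first by rewrite big1 ?oner_neq0.
move=> Y /prodf_neq0 L0.
rewrite -[RHS](h1 (fun i => Y (i, ord0)) (fun o => match o with
  inl i => Y (i, inord 1) / Y (i, ord0) | inr i => Y (i, inord 2) / Y (i, ord0) end)) //; last first.
  by move=> i; apply: L0.
congr F; apply: functional_extensionality => -[i k] /=.
have := (all3 (fun k => Y (i, k) = Y (i, ord0) * Ln (fun o => match o with
  inl i => Y (i, inord 1) / Y (i, ord0) | inr i => Y (i, inord 2) / Y (i, ord0) end) i k)).2; apply.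
rewrite -![Ln _ _ _]/(x0 (Ln _ _)) -?[Ln _ _ (inord 1)]/(x1 (Ln _ _)) -?[Ln _ _ (inord 2)]/(x2 (Ln _ _)).
by split; rewrite /Ln ?mk3E ?mulr1 // mulrC divfK // L0.
Qed.

End Span.

(** * The parametrization of S(d,l) *)

Section Param.
Variable K : closedFieldType.
Variables l d : nat.
Hypothesis l2 : (2 <= l)%N.
Hypothesis ld : (l <= d + 2)%N.
Local Notation N := (nforms d).
Local Notation q := #|{: pairs l}|.
Local Notation lines := (lines K l).
Implicit Types (C : nat -> nat -> K) (z : 'I_3 -> K) (L : 'I_l -> 'I_3 -> K).

(** Subtracting the interpolation of its values at the star points sends any form into the forms
    through the star. The factor [dltall] clears the denominators, so on those forms [pr] is
    multiplication by [dltall]. *)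
Definition pr z L : 'M[K]_N := (dltall d z L)%:M - evmx d L *m bmx d z L.

Lemma pr_evmx z L : pr z L *m evmx d L = 0.
Proof.
by rewrite mulmxBl -mulmxA bmx_evmx // mul_scalar_mx mul_mx_scalar subrr.
Qed.

Lemma pr_id z L (c : 'rV[K]_N) : c *m evmx d L = 0 -> c *m pr z L = dltall d z L *: c.
Proof. by move=> h; rewrite mulmxBr mulmxA h mul0mx subr0 mul_mx_scalar. Qed.

Section Poly.
Variables (I : Type) (L : (I -> K) -> 'I_l -> 'I_3 -> K).
Hypothesis hL : forall i, pvec (fun y => L y i).

Lemma pvec_pt p : pvec (fun y => pt (L y) p).
Proof. exact: (pvec_cross (hL _) (hL _)). Qed.

Lemma pform_bump2 z i j : pform (fun y => bump2 z d (L y) i j).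
Proof.
have -> : (fun y => bump2 z d (L y) i j) = fun y => prodL [seq (if o is Some k then L y k else z) |
    o <- nseq (d + 2 - l) None ++ [seq Some k | k <- enum 'I_l & (k != i) && (k != j)]].
  by apply: functional_extensionality => y; rewrite /bump2 map_cat map_nseq -map_comp.
apply: (@pform_prodL K I _ _ (fun o y => if o is Some k then L y k else z)).
by move=> [k|]; [apply: hL | apply: pvec_const].
Qed.

Lemma polyfun_dlt z p : polyfun (fun y => dlt d z (L y) p).
Proof. by apply: polyfun_ev; [apply: pform_bump2 | apply: pvec_pt]. Qed.

Lemma polyfun_mulmx m n r (A : (I -> K) -> 'M[K]_(m, n)) (B : (I -> K) -> 'M[K]_(n, r)) :
  (forall i j, polyfun (fun y => A y i j)) -> (forall i j, polyfun (fun y => B y i j)) ->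
  forall i j, polyfun (fun y => (A y *m B y) i j).
Proof.
move=> hA hB i j; apply: (@polyfun_ext _ _ (fun y => \sum_k A y i k * B y k j)).
  by move=> y; rewrite mxE.
by apply: polyfun_sum => k; apply: polyfunM.
Qed.

Lemma polyfun_pr z i j : polyfun (fun y => pr z (L y) i j).
Proof.
apply: (@polyfun_ext _ _ (fun y => (\prod_p dlt d z (L y) p) *+ (i == j) -
   (evmx d (L y) *m bmx d z (L y)) i j)); first by move=> y; rewrite !mxE.
apply: polyfunB.
  case: (i == j); last exact: polyfunC.
  by apply: polyfun_prod => p; apply: polyfun_dlt.
apply: polyfun_mulmx => [m p|p m].
  apply: polyfun_ext (_ : polyfun (fun y =>
     let ab := nth (0, 0)%N (mons d) m in let x := pt (L y) (enum_val p) in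
     x0 x ^+ (d - ab.1 - ab.2) * x1 x ^+ ab.1 * x2 x ^+ ab.2)); first by move=> y; rewrite mxE.
  by apply: polyfunM; [apply: polyfunM|]; apply: polyfunX; apply: pvec_pt.
apply: polyfun_ext (_ : polyfun (fun y => ((\prod_(p' | p' != enum_val p) dlt d z (L y) p') *
   vec (bump2 z d (L y) (val (enum_val p)).1 (val (enum_val p)).2) m))); first by move=> y; rewrite mxE.
apply: polyfunM; last exact: pform_bump2.
by apply: polyfun_prod => p'; apply: polyfun_dlt.
Qed.
End Poly.

Lemma Idl_scale (s : 'I_l -> K) L C : (forall i, s i != 0) ->
  Idl d (fun i k => s i * L i k) C <-> Idl d L C.
Proof.
move=> s0.
have E i j : cross (fun k => s i * L i k) (fun k => s j * L j k) =
    fun k => s i * s j * cross (L i) (L j) k.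
  apply: ext3.
  + by rewrite -[RHS]/(_ * x0 _) /cross !mk3E /x0 /x1 /x2; ring.
  + by rewrite -[RHS]/(_ * x1 _) /cross !mk3E /x0 /x1 /x2; ring.
  + by rewrite -[RHS]/(_ * x2 _) /cross !mk3E /x0 /x1 /x2; ring.
split=> -[tC h]; split=> // i j ij; last by rewrite E ev_scale h ?mulr0.
have := h i j ij; rewrite E ev_scale => /eqP; rewrite mulf_eq0 expf_eq0 mulf_eq0.
by rewrite (negPf (s0 i)) (negPf (s0 j)) andbF => /eqP.
Qed.

Lemma Dgood_scale (s : 'I_l -> K) L : (forall i, s i != 0) ->
  Dgood L -> Dgood (fun i k => s i * L i k).
Proof.
move=> s0 [h1 h2]; split=> [i j ij|i j k ij jk ik].
  have [a ha] := h1 _ _ ij; exists a.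
  have -> : cross (fun k => s i * L i k) (fun k => s j * L j k) a = s i * s j * cross (L i) (L j) a.
    by case: a {ha} => [[|[|a]] ha]; rewrite /cross /mk3 /= /x0 /x1 /x2; ring.
  by rewrite !mulf_neq0.
have -> : det3 (fun k => s i * L i k) (fun k => s j * L j k) (fun k' => s k * L k k')
   = s i * s j * s k * det3 (L i) (L j) (L k).
  by rewrite !det3E /x0 /x1 /x2; ring.
by rewrite !mulf_neq0 // h2.
Qed.

(** [Th] is a basis of the forms through the star at y0. Its projection to another tuple is again a
    basis as long as the determinant in [G] does not vanish; at y0 the projection only rescales [Th]
    by a nonzero factor. *)
Lemma ex_param : exists (h : nat) (Th : 'M[K]_(h, N)) z (G : lines -> K),
  [/\ (h + q = N)%N, polyfun G, exists y, G y != 0 &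
   forall y, G y != 0 -> Dstar (Ln y) /\
     forall c : 'rV[K]_N, Idl d (Ln y) (unvec (c 0)) ->
       exists t : 'rV[K]_h, c = t *m Th *m pr z (Ln y)].
Proof.
have [GD [GDp [y0 Gy0] GDs]] := ex_Dstar K l.
have D0 := Dstar_good (GDs _ Gy0).
have [z hz] := generic_form D0.1.
pose E0 := evmx d (Ln y0); pose h := \rank (kermx E0).
pose Th : 'M[K]_(h, N) := row_base (kermx E0).
have fT : row_free Th by apply: row_base_free.
have [T' hT'] := row_freeP fT.
pose G y := GD y * \det (Th *m pr z (Ln y) *m T').
have hq : (h + q = N)%N.
  rewrite /h mxrank_ker rank_evmx // subnK //.
  by rewrite -(@rank_evmx K l d ld (Ln y0)) ?rank_leq_row.
have TE : Th *m E0 = 0.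
  by apply/sub_kermxP; rewrite eq_row_base.
exists h, Th, z, G; split=> //.
- apply: polyfunM => //; apply: polyfun_det; apply: polyfun_mulmx; last by move=> *; apply: polyfunC.
  apply: polyfun_mulmx => [*|i j]; first exact: polyfunC.
  by apply: polyfun_pr => k; apply: pvec_Ln.
- exists y0; rewrite /G mulf_neq0 //.
  have -> : Th *m pr z (Ln y0) = dltall d z (Ln y0) *: Th.
    apply/row_matrixP => i; rewrite row_mul pr_id ?linearZ //.
    by rewrite -row_mul TE row0.
  rewrite -scalemxAl hT' scalemx1 det_scalar expf_neq0 //.
  by apply: dltall_neq0.
move=> y; rewrite mulf_eq0 negb_or => /andP[/GDs hs hdet]; split=> //.
have Dy := Dstar_good hs.
pose A := Th *m pr z (Ln y).
have fA : row_free A.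
  apply/row_freeP; exists (T' *m invmx (A *m T')).
  by rewrite mulmxA mulmxV // unitmxE unitfE.
have sub : (A <= kermx (evmx d (Ln y)))%MS.
  by apply/sub_kermxP; rewrite -mulmxA pr_evmx mulmx0.
have sub2 : (kermx (evmx d (Ln y)) <= A)%MS.
  by rewrite -(mxrank_leqif_sup sub) mxrank_ker rank_evmx // (eqP fA) -hq addnK.
move=> c /(evmx_Idl _ Dy.1)/sub_kermxP/submx_trans/(_ sub2)/submxP[t ->].
by exists t; rewrite mulmxA.
Qed.

Lemma Sdl_intro L (c : 'I_N -> K) : Dgood L -> Idl d L (unvec c) -> vnz c -> @Sdl K d l c.
Proof.
by move=> hL hc cn; split=> //; exists L; split; [apply: good_in_D | apply/star_Idl].
Qed.

Lemma Sdl_elim (c : 'I_N -> K) : @Sdl K d l c -> exists2 L : 'I_l -> 'I_3 -> K, Dgood L & Idl d L (unvec c).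
Proof. by move=> [cn [L [/in_D_good hL]]] /(star_Idl _ hL); exists L. Qed.

(* Curves on non-generic tuples are reached because, for a fixed form, vanishing on the normalized
   generic tuples of lines propagates to all tuples. *)
Lemma param_closure h (Th : 'M[K]_(h, N)) z (G : lines -> K) (p : {mpoly K[N]}) :
  polyfun G -> (exists y, G y != 0) ->
  (forall y, G y != 0 -> Dstar (Ln y) /\
     forall c : 'rV[K]_N, Idl d (Ln y) (unvec (c 0)) ->
       exists t : 'rV[K]_h, c = t *m Th *m pr z (Ln y)) ->
  hom_poly p -> (forall y (t : 'rV[K]_h), p.@[(t *m Th *m pr z (Ln y)) 0] = 0) ->
  forall v, pclosure (@Sdl K d l) v -> p.@[v] = 0.
Proof.
move=> hG nG hsurj hp hv v [_]; apply=> // {}v _ /Sdl_elim[L0 hL0 hc].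
have [z0 hz0] := generic_form hL0.1.
pose c : 'rV[K]_N := \row_m v m.
have cE : c 0 = v by apply: functional_extensionality => m; rewrite mxE.
pose F (Y : 'I_l * 'I_3 -> K) := p.@[(c *m pr z0 (Lof Y)) 0].
have FP : polyfun F.
  apply: polyfun_meval => m; apply: polyfun_mulmx => [*|i j]; first exact: polyfunC.
  by apply: polyfun_pr => i'; apply: pvec_Lof.
have F0 : forall Y, F Y = 0.
  apply: (norm_lines FP hG nG) => s y s0 /hsurj[/Dstar_good Dy hy].
  pose L := Lof (fun p : 'I_l * 'I_3 => s p.1 * Ln y p.1 p.2).
  have hI : Idl d (Ln y) (unvec ((c *m pr z0 L) 0)).
    apply: (proj1 (@Idl_scale s (Ln y) _ s0)).
    apply/evmx_Idl; first by have [] := Dgood_scale s0 Dy.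
    by rewrite -mulmxA pr_evmx mulmx0.
  by have [t ht] := hy _ hI; rewrite /F ht.
have := F0 (fun p => L0 p.1 p.2); rewrite /F.
have -> : Lof (fun p => L0 p.1 p.2) = L0 by [].
rewrite pr_id; last by apply/(evmx_Idl _ hL0.1); rewrite cE.
have -> : (dltall d z0 L0 *: c) 0 = fun m => dltall d z0 L0 * v m.
  by apply: functional_extensionality => m; rewrite !mxE.
have [e ->] := hom_poly_scale hp.
by move/eqP; rewrite mulf_eq0 expf_eq0 (negPf (dltall_neq0 ld hL0 hz0)) andbF => /eqP.
Qed.

(** The coefficients listed in [J] are independent on forms through generic stars. Quantifying over
    [G] allows any open condition on the lines to be imposed later. *)
Definition Dens n (J : 'I_n -> nat * nat) := forall G : lines -> K,
  polyfun G -> (exists y, G y != 0) ->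
  dense (fun w => exists y C, [/\ G y != 0, Idl d (Ln y) C & w = fun k => C (J k).1 (J k).2]).

Lemma dense_nz n (X : ('I_n -> K) -> Prop) k : dense X -> exists2 w, X w & w k != 0.
Proof.
move=> dX; apply: NNPP => hn; have : 'X_k = 0 :> {mpoly K[n]}.
  apply: dX => w Xw; rewrite mevalXU; apply: NNPP => wk; apply: hn; exists w => //.
  exact/eqP.
move/(congr1 (meval (fun=> 1))); rewrite mevalXU meval0 => /eqP.
by rewrite oner_eq0.
Qed.

Lemma dense_inj n (X : ('I_n -> K) -> Prop) k k' : dense X ->
  (forall w, X w -> w k = w k') -> k = k'.
Proof.
move=> dX h; have : 'X_k - 'X_k' = 0 :> {mpoly K[n]}.
  by apply: dX => w /h E; rewrite mevalB !mevalXU E subrr.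
move/(congr1 (meval (fun i => (i == k)%:R))); rewrite mevalB !mevalXU meval0 eqxx => /eqP.
by rewrite subr_eq0; case: (eqVneq k' k) => //; rewrite oner_eq0.
Qed.

(** An index pair beyond degree [d] would give a coefficient that is always 0, against density. *)
Lemma Dens_coord n (J : 'I_n -> nat * nat) : Dens J ->
  exists J' : 'I_n -> 'I_N, forall k C, td d C -> vec C (J' k) = C (J k).1 (J k).2.
Proof.
move=> hJ; have [G [Gp Gn _]] := ex_Dstar K l.
pose good k (m : 'I_N) := forall C, td d C -> vec C m = C (J k).1 (J k).2.
suff [J' hJ'] : exists J' : 'I_n -> 'I_N, forall k, good k (J' k) by exists J'.
apply: (@fin_all_exists _ (fun=> 'I_N) good) => k.
have [_ [y [C [_ [tC _] ->]]] nz] := dense_nz k (hJ G Gp Gn).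
case: (leqP ((J k).1 + (J k).2) d) => h; last by rewrite tC // eqxx in nz.
by have [m hm] := vec_coord K h; exists m => C' _.
Qed.

(** The case c = 0 needs care, as 0 is not a curve and a homogeneous [p] may be constant: p(0) is
    found by scaling a nonzero curve to 0, and [Dens] guarantees that such a curve exists. *)
Lemma Sdl_vanish (p : {mpoly K[N]}) n (J : 'I_n.+1 -> nat * nat) :
  Dens J -> hom_poly p -> (forall v, vnz v -> @Sdl K d l v -> p.@[v] = 0) ->
  forall L (c : 'I_N -> K), Dgood L -> Idl d L (unvec c) -> p.@[c] = 0.
Proof.
move=> hJ hp hS L c hL hc.
have hSdl L' c' : Dgood L' -> Idl d L' (unvec c') -> vnz c' -> p.@[c'] = 0.
  by move=> h1 h2 h3; apply: hS => //; apply: Sdl_intro h1 h2 h3.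
case: (classic (vnz c)) => [cn|cn]; first exact: hSdl hL hc cn.
have [G [Gp Gn GD]] := ex_Dstar K l.
have [J' hJ'] := Dens_coord hJ.
have [_ [y [C [Gy [tC hC] ->]]] nz] := dense_nz ord0 (hJ G Gp Gn).
have p0 : p.@[vec C] = 0.
  apply: (hSdl _ _ (Dstar_good (GD _ Gy))); first by rewrite vecK.
  by exists (J' ord0); rewrite hJ'.
have [e he] := hom_poly_scale hp.
have -> : c = fun j => 0 * vec C j.
  apply: functional_extensionality => j; rewrite mul0r; apply/eqP/negPn/negP => cj.
  by apply: cn; exists j.
by rewrite he p0 mulr0.
Qed.

(** Such a chain would give r+1 independent functions of fewer parameters: 2l for the lines and N -
    q for the form. *)
Lemma expected_upper r : (l + l + (N - q) <= r)%N -> ~ pchain (pclosure (@Sdl K d l)) r.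
Proof.
move=> hr; have [h [Th [z [G [hq Gp Gn hs]]]]] := ex_param.
pose T := (lines * 'rV[K]_h)%type.
have hh : h = (N - q)%N by rewrite -hq addnK.
pose yl (y : 'I_(l + l + h) -> K) (o : 'I_l + 'I_l) := y (lshift h (unsplit o)).
pose yt (y : 'I_(l + l + h) -> K) : 'rV[K]_h := \row_k y (rshift (l + l) k).
pose Phi y := (yt y *m Th *m pr z (Ln (yl y))) 0.
have PhiP j : polyfun (fun y => Phi y j).
  apply: polyfun_mulmx => [i k|i k].
    apply: polyfun_mulmx => [i' k'|*]; last exact: polyfunC.
    apply: (@polyfun_ext _ _ (fun y => y (rshift (l + l) k'))); first by move=> y; rewrite mxE.
    exact: polyfun_coord.
  apply: (polyfun_reindex (f := fun y => pr z (Ln y) i k)).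
  by apply: polyfun_pr => i'; apply: pvec_Ln.
move=> /(upper_chain (Phi := Phi)) H.
have [||f hf] := H.
- move=> p hp hz; apply: (param_closure Gp Gn hs hp) => y t.
  pose y' (j : 'I_(l + l + h)) : K := match split j with inl o => y (split o) | inr k => t 0 k end.
  rewrite -[RHS](hz y'); congr (meval (_ 0) p); rewrite /Phi; congr (_ *m _ *m pr z (Ln _)).
    by apply/rowP => k; rewrite mxE /y' (unsplitK (inr _ k)).
  apply: functional_extensionality => o; rewrite /yl /y' (unsplitK (inl _ (unsplit o))).
  by rewrite unsplitK.
- move=> a y a0; exists (fun j => match split j with inl o => y j | inr k => a * y j end).
  rewrite /Phi; set y' := fun j => _.
  have -> : yl y' = yl y.
    by apply: functional_extensionality => o; rewrite /yl /y' (unsplitK (inl _ (unsplit o))).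
  have -> : yt y' = a *: yt y.
    by apply/rowP => k; rewrite !mxE /y' (unsplitK (inr _ k)).
  by apply: functional_extensionality => j; rewrite -!scalemxAl mxE.
have [||p p0 hp] := @poly_dep K r.+1 (l + l + h) (fun k y => (f k).@[Phi y]).
- by move=> k; apply: polyfun_meval.
- by rewrite ltnS hh.
by move: p0; rewrite (hf p) ?eqxx.
Qed.

(** The cone already contains a scalar, so the first coordinate of the form with respect to the
    moving basis is set to 1, which leaves [n] parameters. *)
Lemma expected_lower n (J : 'I_n.+1 -> nat * nat) : n.+1 = (l + l + (N - q))%N ->
  Dens J -> pchain (pclosure (@Sdl K d l)) n.
Proof.
move=> hn hJ; have [h [Th [z [G [hq Gp Gn hs]]]]] := ex_param.
have [J' hJ'] := Dens_coord hJ.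
have hh : h = (N - q)%N by rewrite -hq addnK.
have h0 : (0 < h)%N.
  rewrite lt0n; apply/eqP => h00.
  have [_ [y [C [Gy [tC hC] ->]]] nz] := dense_nz ord0 (hJ G Gp Gn).
  have [_ /(_ (rowf d C))] := hs _ Gy.
  have -> : unvec (rowf d C 0) = C.
    rewrite -[RHS](@vecK _ d) //; congr unvec; apply: functional_extensionality => m; rewrite mxE //.
  move=> /(_ (conj tC hC))[t ht]; case/eqP: nz; rewrite -hJ' //.
  have := congr1 (fun c : 'rV[K]_N => c 0 (J' ord0)) ht; rewrite mxE => ->.
  have -> : t = 0 by apply/rowP => k; have := ltn_ord k; rewrite [X in (_ < X)%N]h00.
  by rewrite !mul0mx mxE.
case: h h0 hq hh Th hs => // h _ hq hh Th hs.
have En : n = (l + l + h)%N by move: hn; rewrite -hh addnS => -[].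
subst n.
pose yl (y : 'I_(l + l + h) -> K) (o : 'I_l + 'I_l) := y (lshift h (unsplit o)).
pose yt (y : 'I_(l + l + h) -> K) : 'rV[K]_h.+1 := \row_k oapp (fun k => y (rshift (l + l) k)) 1 (unlift ord0 k).
pose psi y := (yt y *m Th *m pr z (Ln (yl y))) 0.
have psiP j : polyfun (fun y => psi y j).
  apply: polyfun_mulmx => [i k|i k].
    apply: polyfun_mulmx => [i' k'|*]; last exact: polyfunC.
    apply: (@polyfun_ext _ _ (fun y => oapp (fun k => y (rshift (l + l) k)) 1 (unlift ord0 k'))).
      by move=> y; rewrite mxE.
    by case: (unlift ord0 k') => [k2|] /=; [exact: polyfun_coord | exact: polyfunC].
  apply: (polyfun_reindex (f := fun y => pr z (Ln y) i k)).
  by apply: polyfun_pr => i'; apply: pvec_Ln.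
apply: (@lower_chain K N (l + l + h) psi J' psiP).
  move=> p hp; apply: (hJ G Gp Gn) => _ [y [C [Gy [tC hC] ->]]].
  have [_ /(_ (rowf d C))] := hs _ Gy.
  have -> : unvec (rowf d C 0) = C.
    rewrite -[RHS](@vecK _ d) //; congr unvec; apply: functional_extensionality => m; rewrite mxE //.
  move=> /(_ (conj tC hC))[t ht].
  have E k : C (J k).1 (J k).2 = (t *m Th *m pr z (Ln y)) 0 (J' k).
    by rewrite -hJ' // -ht mxE.
  (* Only forms whose first coordinate is nonzero can be normalized; for the others the identity
     principle in [t] is used. *)
  pose F (t : 'I_h.+1 -> K) := p.@[fun k => ((\row_j t j) *m Th *m pr z (Ln y)) 0 (J' k)].
  have F0 : forall t, F t = 0.
    apply: (@polyfun_zero _ _ F (fun t => t ord0) (fun=> 1)).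
    - apply: polyfun_meval => k; apply: polyfun_mulmx => [i j|*]; last exact: polyfunC.
      apply: polyfun_mulmx => [i' j'|*]; last exact: polyfunC.
      apply: (@polyfun_ext _ _ (fun t => t j')); [by move=> t'; rewrite mxE | exact: polyfun_coord].
    - exact: polyfun_coord.
    - exact: oner_neq0.
    move=> t' t0; pose y' (j : 'I_(l + l + h)) : K :=
       match split j with inl o => y (split o) | inr k => t' (lift ord0 k) / t' ord0 end.
    apply: hp; exists (t' ord0), y'; apply: functional_extensionality => k.
    have -> : \row_j t' j = t' ord0 *: yt y'.
      apply/rowP => j; rewrite !mxE; case: (unliftP ord0 j) => [j' ->|->] /=; last by rewrite mulr1.
      by rewrite /y' (unsplitK (inr _ j')) mulrC divfK.
    rewrite /psi; have -> : Ln (yl y') = Ln y.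
      congr Ln; apply: functional_extensionality => o.
      by rewrite /yl /y' (unsplitK (inl _ (unsplit o))) unsplitK.
    by rewrite -!scalemxAl mxE.
  rewrite -(F0 (t 0)); apply: meval_eq => k; rewrite E; congr ((_ *m _ *m _) _ _).
  by apply/rowP => j; rewrite mxE.
move=> v [vn hv]; split=> // p hp hS; apply: hv => // w w0.
apply: cone_vanish w0 => //.
have [GD [GDp [y0 Gy0] GDs]] := ex_Dstar K l.
pose g (y : 'I_(l + l + h) -> K) := GD (yl y).
apply: (@polyfun_zero _ _ _ g (fun j => match split j with inl o => y0 (split o) | inr _ => 0 end)).
- exact: polyfun_meval.
- exact: (polyfun_reindex (f := GD)).
- rewrite /g; suff -> : yl (fun j => match split j with inl o => y0 (split o) | inr _ => 0 end) = y0 by [].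
  by apply: functional_extensionality => o; rewrite /yl (unsplitK (inl _ (unsplit o))) unsplitK.
move=> y /GDs/Dstar_good Dy; apply: (Sdl_vanish hJ hp hS Dy).
by apply/evmx_Idl; [exact: Dy.1 | rewrite -mulmxA pr_evmx mulmx0].
Qed.

End Param.

(** * Degenerations raising d and l *)

Section Steps.
Variable K : closedFieldType.
Implicit Types (C : nat -> nat -> K) (z u x : 'I_3 -> K) (d l : nat).

Lemma lmul_e0 C : lmul (e0 K) C = C.
Proof.
apply: functional_extensionality => a; apply: functional_extensionality => b.
by rewrite /lmul /e0 !mk3E mul1r !mul0r !addr0.
Qed.

Lemma ev_succ d C x : td d C -> ev d.+1 C x = x0 x * ev d C x.
Proof.
move=> tC; rewrite -{1}(lmul_e0 C) ev_lmul // /dot /e0 !mk3_0 mk3_1 mk3_2.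
by rewrite mul1r !mul0r !addr0.
Qed.

Lemma Idl_lmul d l (L : 'I_l -> 'I_3 -> K) u C : Idl d L C -> Idl d.+1 L (lmul u C).
Proof.
by move=> [tC hC]; split=> [|i j ij]; [apply: td_lmul | rewrite ev_lmul // hC ?mulr0].
Qed.

Lemma Idl_add d l (L : 'I_l -> 'I_3 -> K) C C' : Idl d L C -> Idl d L C' ->
  Idl d L (fun a b => C a b + C' a b).
Proof.
move=> [tC hC] [tC' hC']; split=> [|i j ij]; first exact: tdD.
by rewrite evD hC // hC' // addr0.
Qed.

Lemma Idl_mulr d l (L : 'I_l -> 'I_3 -> K) k C : Idl d L C -> Idl d L (fun a b => k * C a b).
Proof.
move=> [tC hC]; split=> [|i j ij]; first exact: tdZ.
by rewrite evZ hC // mulr0.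
Qed.

Lemma ev_top d C x : x0 x = 0 ->
  ev d C x = \sum_(0 <= a < d.+1) C a (d - a)%N * (x1 x ^+ a * x2 x ^+ (d - a)).
Proof.
move=> hx; rewrite evE; apply: eq_big_nat => a /andP[_ ad].
have -> : (d.+1 - a = (d - a).+1)%N by lia.
rewrite big_nat_recr //= subnn expr0 mul1r big1_seq ?add0r // => b.
rewrite mem_index_iota => /andP[_ hb]; rewrite hx expr0n.
have -> : (d - a - b == 0)%N = false by lia.
by rewrite !mul0r mulr0.
Qed.

(** In degree l-1 the points of the lines on x0 = 0 separate the restrictions of the l products, so
    these are a basis. One degree higher, x2 times a form provides the pure power of x2, and x1
    times a form provides the monomials divisible by x1. *)
Lemma top_section d l (L : 'I_l -> 'I_3 -> K) (v : nat -> K) : (2 <= l)%N -> (l - 1 <= d)%N ->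
  Dstar L -> exists2 C, Idl d L C & forall a, (a <= d)%N -> C a (d - a)%N = v a.
Proof.
move=> l2; have {l2} l0 : (0 < l)%N by lia.
move=> ld hL; rewrite -(subnK ld); move: (d - (l - 1))%N => e.
elim: e v => [|e IH] v.
  pose TP : 'M[K]_l := \matrix_(i, a) omit1 L i a (l - 1 - a)%N.
  have TPE (g : 'rV[K]_l) (a : 'I_l) : (g *m TP) 0 a = comb L (g 0) a (l - 1 - a)%N.
    by rewrite mxE; apply: eq_bigr => i _; rewrite mxE.
  have fT : row_free TP.
    apply: inj_row_free => g hg; apply/rowP => i; rewrite [RHS]mxE.
    have := comb_at_node L (g 0) (e0 K) i.
    rewrite ev_top; last by rewrite /cross /e0 !mk3E mulr0 mulr0 subrr.
    rewrite big_nat big1; last first.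
      move=> a /andP[_ al]; have al' : (a < l)%N by lia.
      have := TPE g (Ordinal al'); rewrite hg mxE /= => <-; by rewrite mul0r.
    have nz : \prod_(k | k != i) det3 (L k) (L i) (e0 K) != 0.
      by apply/prodf_neq0 => k ki; rewrite -det3R; apply: hL.1.
    by move/esym/eqP; rewrite mulf_eq0 (negPf nz) orbF => /eqP.
  have uT : TP \in unitmx by rewrite -row_free_unit.
  pose g := (\row_(a < l) v a) *m invmx TP.
  exists (comb L (g 0)); first exact: Idl_comb.
  move=> a al; have al' : (a < l)%N by lia.
  by rewrite -(TPE g (Ordinal al')) mulmxKV // mxE.
have [r1 h1 t1] := IH (fun a => if a == 0%N then v 0%N else 0).
have [r2 h2 t2] := IH (fun a => v a.+1).
set D := (e + (l - 1))%N in h1 t1 h2 t2 *.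
exists (fun a b => lmul (mk3 0 0 1) r1 a b + lmul (mk3 0 1 0) r2 a b).
  by apply: Idl_add; apply: Idl_lmul.
rewrite addSn -/D => a aD; rewrite /lmul !mk3E !mul0r !mul1r !add0r !addr0.
have -> : (if (D.+1 - a)%N is b'.+1 then r1 a b' else 0) = if a == 0%N then v 0%N else 0.
  case: (ltnP a D.+1) => h.
    have -> : (D.+1 - a = (D - a).+1)%N by lia.
    by rewrite t1.
  have -> : (D.+1 - a = 0)%N by lia.
  by have -> : (a == 0%N) = false by lia.
case: a aD => [|a] aD /=; first by rewrite addr0.
by rewrite add0r subSS t2.
Qed.

Definition join_idx n k (J : 'I_n -> nat * nat) (J' : 'I_k -> nat * nat) (i : 'I_(n + k)) :=
  match split i with inl a => J a | inr b => J' b end.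

Lemma Dens_succ d l n (J : 'I_n -> nat * nat) : (2 <= l)%N -> (l - 1 <= d.+1)%N ->
  @Dens K l d n J ->
  @Dens K l d.+1 _ (join_idx J (fun b : 'I_d.+2 => (b : nat, d.+1 - b)%N)).
Proof.
move=> l2 ld hJ G Gp Gn.
have [GD [GDp GDn GDs]] := ex_Dstar K l.
have [y0 [gy0 gdy0]] := polyfun_nz_and Gp GDp Gn GDn.
have nn : exists y, G y * GD y != 0 by exists y0; rewrite mulf_neq0.
have dX := dense_prod (hJ _ (polyfunM Gp GDp) nn) (@denseT K d.+2).
(* Weight 1 on the new coefficients: they belong to monomials without x0, to which x0 times the old
   form contributes nothing. *)
apply: (dense_init (w := fun k => if split k is inl _ then 0%N else 1%N) dX).
move=> w [[y [C [Gy [tC hC] EC]]] _].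
move: Gy; rewrite mulf_eq0 negb_or => /andP[Gy /GDs Dy].
pose v (a : nat) := w (rshift n (inord a)).
have [r hr tr] := top_section v l2 ld Dy.
exists (fun k => match split k with inl a => (r (J a).1 (J a).2)%:P | inr _ => 0 end).
exists 1 => [|t _]; first exact: oner_neq0.
exists y, (fun a b => C a b + t * r a b); split=> //.
  apply: Idl_add; last exact: Idl_mulr.
  split=> [|i j ij]; first exact: tdW tC.
  by rewrite ev_succ // hC ?mulr0.
apply: functional_extensionality => k; rewrite /join_idx.
case: (splitP k) => [a Ea|b Eb].
  have -> : k = lshift d.+2 a by apply: val_inj.
  rewrite expr0 mul1r hornerC; congr (_ + _).
  by have := congr1 (fun f => f a) EC.
rewrite tC ?add0r; last by have := ltn_ord b; rewrite /=; lia.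
rewrite horner0 mulr0 addr0 expr1 /= tr; last by rewrite -ltnS.
by rewrite /v; congr (_ * w _); apply: val_inj; rewrite /= Eb inord_val.
Qed.

(* For e = false, only the first entry of g is used, as a constant. *)
Definition gmul (e : bool) (g : 'I_3 -> K) C :=
  if e then lmul g C else fun a b => x0 g * C a b.

Definition fam (e : bool) l (L g : 'I_l -> 'I_3 -> K) a b := \sum_i gmul e (g i) (omit1 L i) a b.

Lemma fam_Idl (e : bool) l (L g : 'I_l -> 'I_3 -> K) : Idl (l - 1 + e) L (fam e L g).
Proof.
case: e; rewrite /fam /gmul.
  split=> [|i j ij].
    by apply: td_sum => i; rewrite addn1; apply: td_lmul; apply: td_omit1.
  rewrite ev_sum big1 // => k _; rewrite addn1 ev_lmul; last exact: td_omit1.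
  by rewrite ev_omit1_star ?mulr0.
rewrite addn0; split=> [|i j ij].
  by apply: td_sum => i; apply: tdZ; apply: td_omit1.
by rewrite ev_sum big1 // => k _; rewrite evZ ev_omit1_star ?mulr0.
Qed.

Lemma pform_omit1 (I : Type) l (L : (I -> K) -> 'I_l -> 'I_3 -> K) i :
  (forall i, pvec (fun y => L y i)) -> pform (fun y => omit1 (L y) i).
Proof.
by move=> hL; apply: (@pform_prodL K I _ _ (fun k y => L y k)).
Qed.

Lemma pform_fam (I : Type) (e : bool) l (L g : (I -> K) -> 'I_l -> 'I_3 -> K) :
  (forall i, pvec (fun y => L y i)) -> (forall i, pvec (fun y => g y i)) ->
  pform (fun y => fam e (L y) (g y)).
Proof.
move=> hL hg; apply: pform_sum => i; rewrite /gmul; case: e.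
  by apply: pform_lmul => //; apply: pform_omit1.
by apply: pformZ; [apply: hg | apply: pform_omit1].
Qed.

(** The lines are arbitrary vectors, in no general position, so degenerate families can be used to
    prove density. *)
Definition DensFull (e : bool) l n (J : 'I_n -> nat * nat) :=
  dense (fun w => exists L g : 'I_l -> 'I_3 -> K, w = fun k => fam e L g (J k).1 (J k).2).

(** Rescaling the lines does not change the forms through the star, so [norm_lines] replaces
    arbitrary tuples by generic normalized ones. *)
Lemma DensFull_Dens (e : bool) l n (J : 'I_n -> nat * nat) : @DensFull e l n J -> @Dens K l (l - 1 + e) n J.
Proof.
move=> hJ G Gp Gn p hp; apply: hJ => _ [L [g ->]].
pose F (Y : 'I_l * 'I_3 -> K) := p.@[fun k => fam e (Lof Y) g (J k).1 (J k).2].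
have FP : polyfun F.
  apply: polyfun_meval => k; apply: (@pform_fam _ e l (@Lof K l) (fun=> g)) => i.
    exact: pvec_Lof.
  exact: pvec_const.
rewrite -[RHS](norm_lines FP Gp Gn (_ : _) (fun p => L p.1 p.2)) //.
move=> s y s0 Gy; apply: hp; exists y, (fam e (fun i k => s i * Ln y i k) g); split=> //.
apply: (proj1 (@Idl_scale K l (l - 1 + e) s (Ln y) _ s0)); exact: fam_Idl.
Qed.

Lemma ev_delta d a b x : (a + b <= d)%N ->
  ev d (fun a' b' => ((a' == a) && (b' == b))%:R) x = x0 x ^+ (d - a - b) * x1 x ^+ a * x2 x ^+ b.
Proof.
move=> ab; rewrite /ev (bigD1_seq (a, b)) ?mem_mons ?uniq_mons //= !eqxx mul1r.
rewrite big1 ?addr0 // => -[a' b'] /=; rewrite xpair_eqE => /negPf ->.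
by rewrite mul0r.
Qed.

Lemma lift3_1 : lift ord0 ord0 = inord 1 :> 'I_3.
Proof. by apply: val_inj; rewrite /= inordK. Qed.

Lemma lift3_2 : lift ord0 (lift ord0 ord0) = inord 2 :> 'I_3.
Proof. by apply: val_inj; rewrite /= inordK. Qed.

(** * Adjoining a line *)

Section Bstep.
Variable l : nat.
Hypothesis l3 : (3 <= l)%N.
Implicit Types (L : 'I_l -> 'I_3 -> K) (g : 'I_l -> 'I_3 -> K).

Definition prodall L := prodL [seq L k | k <- enum 'I_l].

Lemma td_prodall L : td l (prodall L).
Proof. by have := @td_prodL K [seq L k | k <- enum 'I_l]; rewrite size_map size_enum_ord. Qed.

Lemma ev_prodall L x : ev l (prodall L) x = \prod_k dot (L k) x.
Proof.
have := ev_prodL [seq L k | k <- enum 'I_l] x.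
by rewrite size_map size_enum_ord big_map big_enum.
Qed.

Lemma form_ext d C C' : td d C -> td d C' -> (forall x, ev d C x = ev d C' x) -> C = C'.
Proof.
move=> h h' E; apply: functional_extensionality => a; apply: functional_extensionality => b.
apply/eqP; rewrite -subr_eq0 -[- _]mulN1r; apply/eqP.
apply: (@ev_inj _ d (fun a b => C a b + -1 * C' a b)); first by apply: tdD => //; apply: tdZ.
by move=> x; rewrite evD evZ E mulN1r subrr.
Qed.

Lemma td_fam0 L g : td (l - 1) (fam false L g).
Proof. by have [] := fam_Idl false L g; rewrite addn0. Qed.

Lemma ev_fam0 l' (L g : 'I_l' -> 'I_3 -> K) x : ev (l' - 1) (fam false L g) x =
  \sum_i x0 (g i) * \prod_(k | k != i) dot (L k) x.
Proof. by rewrite ev_sum; apply: eq_bigr => i _; rewrite evZ ev_omit1. Qed.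

Definition adjoin T (t : T) (f : 'I_l -> T) (i : 'I_l.+1) : T := oapp f t (unlift ord0 i).

Lemma adjoin_fam L g u c : fam false (adjoin u L) (adjoin (mk3 c 0 0) g) =
  fun a b => lmul u (fam false L g) a b + c * prodall L a b.
Proof.
have t1 : td l (fam false (adjoin u L) (adjoin (mk3 c 0 0) g)).
  by have [] := fam_Idl false (adjoin u L) (adjoin (mk3 c 0 0) g); rewrite addn0 subn1.
have t2 : td l (lmul u (fam false L g)).
  have := @td_lmul K (l - 1) u _ (@td_fam0 L g); have -> : (l - 1).+1 = l by lia.
  by [].
apply: (form_ext t1) => [|x]; first by apply: tdD => //; apply/tdZ/td_prodall.
have := ev_fam0 (adjoin u L) (adjoin (mk3 c 0 0) g) x; rewrite subn1 /= => ->.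
rewrite evD evZ ev_prodall.
have := @ev_lmul K (l - 1) u _ x (@td_fam0 L g); have -> : (l - 1).+1 = l by lia.
move=> ->; rewrite ev_fam0 big_ord_recl /adjoin unlift_none /= mk3E addrC.
congr (_ + _ * _).
  rewrite big_distrr; apply: eq_bigr => i _ /=; rewrite liftK /= mulrCA; congr (_ * _).
  rewrite big_mkcond big_ord_recl /= unlift_none /= [in RHS]big_mkcond; congr (_ * _).
  by apply: eq_bigr => k _; rewrite liftK /= (inj_eq lift_inj).
rewrite big_mkcond big_ord_recl eqxx /= mul1r.
by apply: eq_bigr => k _; rewrite liftK.
Qed.

Definition shift1 C a b := if a is a'.+1 then C a' b else 0 : K.
Definition shift2 C a b := if b is b'.+1 then C a b' else 0 : K.

(** The monomials x1^b x2^(l-b) for b = 0, 1, 2; a form of degree l-1 read in degree l has none of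
    them. *)
Definition newidx (b : 'I_3) : nat * nat := (b : nat, l - b)%N.

Definition bcol L g (c : 'I_3) := match val c with
  | 0%N => shift1 (fam false L g) | 1%N => shift2 (fam false L g) | _ => prodall L end.

Definition bmat L g : 'M[K]_3 := \matrix_(b, c) bcol L g c (newidx b).1 (newidx b).2.

(** One line is x1 - x2, all others are x2, and two constants are 1. The curve is x1 x2^(l-2) and
    the product of the lines is x1 x2^(l-1) - x2^l, so up to the order of columns the matrix is
    triangular with diagonal entries 1 or -1 in every characteristic. *)
Lemma ex_bmat : exists L g, \det (bmat L g) != 0.
Proof.
have o0 : (0 < l)%N by lia. have o1 : (1 < l)%N by lia.
pose i0 := Ordinal o0; pose i1 := Ordinal o1.
pose L (k : 'I_l) := if k == i1 then mk3 0 1 (-1) else mk3 0 0 1 : 'I_3 -> K.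
pose g (k : 'I_l) := mk3 ((k == i0) || (k == i1))%:R 0 0 : 'I_3 -> K.
have dL (k : 'I_l) x : k != i1 -> dot (L k) x = x2 x.
  by move=> /negPf h; rewrite /L h /dot mk3_0 mk3_1 mk3_2 !mul0r mul1r !add0r.
have dL1 x : dot (L i1) x = x1 x - x2 x.
  by rewrite /L eqxx /dot mk3_0 mk3_1 mk3_2 !mul0r mul1r add0r mulN1r.
have pr1 x : \prod_(k | k != i1) dot (L k) x = x2 x ^+ (l - 1).
  rewrite (eq_bigr (fun=> x2 x)) => [|k ki]; last exact: dL.
  by rewrite prodr_const cardC1 card_ord subn1.
have pr01 x : \prod_(k | (k != i0) && (k != i1)) dot (L k) x = x2 x ^+ (l - 2).
  rewrite (eq_bigr (fun=> x2 x)) => [|k /andP[_ ki]]; last exact: dL.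
  rewrite prodr_const; congr (_ ^+ _).
  rewrite (eq_card (B := [predC (pred2 i0 i1)])); last by move=> k; rewrite !inE negb_or.
  have := cardC (pred2 i0 i1); rewrite card2 card_ord /= => E.
  by rewrite -[X in _ = (X - 2)%N]E addKn.
have pr0 x : \prod_(k | k != i0) dot (L k) x = (x1 x - x2 x) * x2 x ^+ (l - 2).
  by rewrite (bigD1 i1) //= dL1 pr01.
have El1 : (l - 1 = (l - 2).+1)%N by lia.
have E1 : fam false L g = fun a b => ((a == 1%N) && (b == (l - 2)%N))%:R.
  apply: (@form_ext (l - 1)); first exact: td_fam0.
    move=> a b ab; have -> : (a == 1%N) && (b == (l - 2)%N) = false by lia.
    by [].
  move=> x; rewrite ev_fam0 ev_delta; last by lia.
  have -> : (l - 1 - 1 - (l - 2) = 0)%N by lia.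
  rewrite (bigD1 i0) //= [X in _ + X](bigD1 i1) //= [X in _ + (_ + X)]big1 => [|k /andP[k0 k1]].
    rewrite /g !mk3E !eqxx /= pr0 pr1 El1 exprS; ring.
  by rewrite /g mk3E (negPf k0) (negPf k1) mul0r.
have E2 : prodall L = fun a b => ((a == 1%N) && (b == (l - 1)%N))%:R
     + -1 * ((a == 0%N) && (b == l))%:R.
  apply: (@form_ext l); first exact: td_prodall.
    move=> a b ab; have -> : (a == 1%N) && (b == (l - 1)%N) = false by lia.
    have -> : (a == 0%N) && (b == l) = false by lia.
    by rewrite mulr0 addr0.
  move=> x; rewrite ev_prodall evD evZ !ev_delta; try by lia.
  have -> : (l - 1 - (l - 1) = 0)%N by lia.
  have -> : (l - 0 - l = 0)%N by lia.
  rewrite (bigD1 i1) //= pr1 dL1.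
  have {3}-> : (l = (l - 1).+1)%N by lia.
  rewrite !exprS; ring.
have ME (b c : 'I_3) : bmat L g b c = nth 0 (nth [::] [:: [:: 0; 0; -1]; [:: 0; 1; 1]; [:: 1; 0; 0]] b) c.
  have e0 : (l - 0)%N = (l - 1).+1 by lia.
  have e1 : (l - 1)%N = (l - 2).+1 by lia.
  have e2 : (l - 2)%N = (l - 3).+1 by lia.
  rewrite mxE /bcol /newidx /= E1 E2 /shift1 /shift2.
  case: b => [[|[|[|]]]//= _]; case: c => [[|[|[|]]]//= _].
  - by rewrite e0.
  - by rewrite subn0 eqxx mulr1 add0r.
  - by rewrite e1 /= eqxx.
  - by rewrite eqxx mulr0 addr0.
  - by rewrite eqxx.
  - by rewrite e2.
  - by rewrite mulr0 addr0.
exists L, g; suff : bmat L g \in unitmx by rewrite unitmxE unitfE.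
rewrite -row_free_unit; apply: inj_row_free => v /rowP hv; apply/rowP.
have [q0 q1 q2] : [/\ v 0 (inord 2) = 0, v 0 (inord 1) = 0 & v 0 ord0 = 0].
  have h (c : 'I_3) : v 0 ord0 * bmat L g ord0 c + v 0 (inord 1) * bmat L g (inord 1) c
      + v 0 (inord 2) * bmat L g (inord 2) c = 0.
    have := hv c; rewrite [RHS]mxE mxE !big_ord_recl big_ord0 addr0 addrA lift3_1 lift3_2 => <-.
    by [].
  have := h ord0; have := h (inord 1); have := h (inord 2).
  rewrite !ME !inordK //= !mulr0 !mulr1 mulrN1 !add0r !addr0 => ha hb hc.
  by move: ha; rewrite hb addr0 => /eqP; rewrite oppr_eq0 => /eqP.
by apply: (all3 (fun i => v 0 i = (0 : 'rV[K]_3) 0 i)).2; rewrite !mxE.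
Qed.

(* The new line x0 + t (a x1 + b x2) and the new constant t c move the three new coordinates by t times
   the image of (a, b, c) under bmat. *)
Lemma DensFull_adjoin n (J : 'I_n -> nat * nat) :
  @DensFull false l n J -> @DensFull false l.+1 _ (join_idx J newidx).
Proof.
move=> hJ.
(* Invertibility of [bmat] is a nonempty open condition, so imposing it keeps the density. *)
have dX : dense (fun w => exists L g, \det (bmat L g) != 0 /\
    w = fun k => fam false L g (J k).1 (J k).2).
  move=> p hp; apply: hJ => _ [L [g ->]].
  pose I := ('I_l * 'I_3 + 'I_l * 'I_3)%type.
  pose LL (Y : I -> K) (i : 'I_l) (k : 'I_3) := Y (inl (i, k)).
  pose gg (Y : I -> K) (i : 'I_l) (k : 'I_3) := Y (inr (i, k)).
  have pL i : pvec (fun Y => LL Y i) by move=> k; apply: polyfun_coord.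
  have pg i : pvec (fun Y => gg Y i) by move=> k; apply: polyfun_coord.
  have pf := pform_fam false pL pg.
  have [L1 [g1 h1]] := ex_bmat.
  pose mk (L g : 'I_l -> 'I_3 -> K) (o : I) : K :=
    match o with inl p => L p.1 p.2 | inr p => g p.1 p.2 end.
  apply: (@polyfun_zero _ I (fun Y => p.@[fun k => fam false (LL Y) (gg Y) (J k).1 (J k).2])
    (fun Y => \det (bmat (LL Y) (gg Y))) (mk L1 g1) _ _ h1 _ (mk L g)).
  - by apply: polyfun_meval => k; apply: pf.
  - apply: polyfun_det => b c; apply: (@polyfun_ext _ _ (fun Y =>
      bcol (LL Y) (gg Y) c (newidx b).1 (newidx b).2)); first by move=> Y; rewrite mxE.
    rewrite /bcol; case: (val c) => [|[|_]].
    + by case: (newidx b).1 => [|a]; [apply: polyfunC | apply: pf].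
    + by case: (newidx b).2 => [|a]; [apply: polyfunC | apply: pf].
    + exact: (@pform_prodL K I _ _ (fun k Y => LL Y k)).
  - by move=> Y hY; apply: hp; exists (LL Y), (gg Y).
apply: (dense_init (w := fun k => if split k is inl _ then 0%N else 1%N)
  (dense_prod dX (@denseT K 3))).
move=> w [[L [g [hd EC]]] _].
pose v : 'cV[K]_3 := \col_b w (rshift n b).
pose s := invmx (bmat L g) *m v.
have hs : bmat L g *m s = v by rewrite mulKVmx // unitmxE unitfE.
pose s0 := s ord0 0; pose s1 := s (inord 1) 0; pose s2 := s (inord 2) 0.
have tf := @td_fam0 L g.
pose R a b := s0 * shift1 (fam false L g) a b + s1 * shift2 (fam false L g) a b + s2 * prodall L a b.
have hR (b : 'I_3) : R (newidx b).1 (newidx b).2 = w (rshift n b).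
  have := congr1 (fun m : 'cV[K]_3 => m b 0) hs; rewrite [RHS]mxE => <-.
  rewrite mxE !big_ord_recl big_ord0 addr0 addrA lift3_1 lift3_2 /R.
  have BE c : bmat L g b c = bcol L g c (newidx b).1 (newidx b).2 by rewrite mxE.
  rewrite !BE /bcol /= !inordK // -/s0 -/s1 -/s2.
  by congr (_ + _ + _); rewrite mulrC.
exists (fun k => match split k with inl a => (R (J a).1 (J a).2)%:P | inr _ => 0 end).
exists 1 => [|t _]; first exact: oner_neq0.
exists (adjoin (mk3 1 (t * s0) (t * s1)) L), (adjoin (mk3 (t * s2) 0 0) g).
have E a b : lmul (mk3 1 (t * s0) (t * s1)) (fam false L g) a b + t * s2 * prodall L a b
    = fam false L g a b + t * R a b.
  rewrite -[lmul _ _ a b]/(x0 _ * _ + x1 _ * shift1 _ a b + x2 _ * shift2 _ a b).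
  rewrite mk3_0 mk3_1 mk3_2 /R.
  set F0 := fam _ _ _ _ _; set F1 := shift1 _ _ _; set F2 := shift2 _ _ _; set F3 := prodall _ _ _.
  ring.
rewrite adjoin_fam; apply: functional_extensionality => k; rewrite E /join_idx.
case: (splitP k) => [a Ea|b Eb].
  have -> : k = lshift 3 a by apply: val_inj.
  rewrite expr0 mul1r hornerC; congr (_ + _).
  by have := congr1 (fun f => f a) EC.
rewrite tf ?add0r; last by have := ltn_ord b; rewrite /newidx /=; lia.
rewrite horner0 mulr0 addr0 expr1 hR; congr (_ * w _); exact: val_inj.
Qed.

End Bstep.
End Steps.

(** * Independence for small l *)

(* Symbolic forms: a term ((s, m), (c, (a, b)), e) stands for
   (-1)^s m (prod_(i <- e) y_i) x0^c x1^a x2^b, the y_i being parameters. *)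
Definition term := ((bool * nat) * (nat * (nat * nat)) * seq nat)%type.
Definition sform := seq term.

Definition smul (S T : sform) : sform :=
  [seq ((s.1.1.1 (+) t.1.1.1, s.1.1.2 * t.1.1.2)%N,
        (s.1.2.1 + t.1.2.1, (s.1.2.2.1 + t.1.2.2.1, s.1.2.2.2 + t.1.2.2.2))%N,
        s.2 ++ t.2) | s <- S, t <- T].

Definition sscale (s : bool) (m : nat) (T : sform) : sform :=
  [seq ((s (+) t.1.1.1, m * t.1.1.2)%N, t.1.2, t.2) | t <- T].

Definition sone : sform := [:: ((false, 1), (0, (0, 0)), [::])]%N.
Definition spar (v : nat) : sform := [:: ((false, 1), (0, (0, 0)), [:: v])]%N.
Definition svar (v : nat) : sform :=
  [:: ((false, 1), (1, (0, 0)), [:: v]); ((false, 1), (0, (1, 0)), [:: v.+1]);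
      ((false, 1), (0, (0, 1)), [:: v.+2])]%N.

Definition shomog (d : nat) (T : sform) := all (fun t => t.1.2.1 + t.1.2.2.1 + t.1.2.2.2 == d)%N T.

Definition twt (om : seq nat) (t : term) := foldr (fun i acc => nth 0 om i + acc)%N 0%N t.2.

Definition sel (T : sform) om (ab : nat * nat) w :=
  [seq t <- T | (t.1.2.2 == ab) && (twt om t <= w)%N].

Definition rowsum (inv : seq (seq int)) (e : seq nat) k : int :=
  foldr (fun i acc => nth 0 (nth [::] inv i) k + acc) 0 e.

(* With weight om on the parameters, the coefficient of the monomial numbered k in idx has a unique
   term of weight <= ws_k; its coefficient is 1 or -1, and the exponents of these terms form a matrix
   with inverse inv / D. *)
Definition trop_check (T : sform) (om : seq nat) (idx : seq (nat * nat)) (ws : seq nat)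
    (inv : seq (seq int)) (D : nat) : bool :=
  (0 < D)%N && all (fun k =>
    if sel T om (nth (0, 0)%N idx k) (nth 0%N ws k) is [:: t] then
      (t.1.1.2 == 1%N) &&
      all (fun k' => rowsum inv t.2 k' == if k == k' then D%:Z else 0) (iota 0 (size idx))
    else false) (iota 0 (size idx)).

Section Trop.
Variable K : closedFieldType.
Implicit Types (y : nat -> K) (x : 'I_3 -> K) (S T : sform) (t : term).

Definition tcoef y t : K := (-1) ^+ t.1.1.1 * t.1.1.2%:R * \prod_(i <- t.2) y i.
Definition sval T y x : K := \sum_(t <- T)
  tcoef y t * (x0 x ^+ t.1.2.1 * x1 x ^+ t.1.2.2.1 * x2 x ^+ t.1.2.2.2).

Lemma sval_cat S T y x : sval (S ++ T) y x = sval S y x + sval T y x.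
Proof. exact: big_cat. Qed.

Lemma sval_mul S T y x : sval (smul S T) y x = sval S y x * sval T y x.
Proof.
rewrite /sval /smul big_allpairs_dep big_distrl; apply: eq_bigr => s _.
rewrite big_distrr; apply: eq_bigr => t _ /=.
rewrite /tcoef /= signr_addb natrM big_cat !exprD /=.
move: ((-1) ^+ s.1.1.1) ((-1) ^+ t.1.1.1) (s.1.1.2%:R) (t.1.1.2%:R) => a1 a2 b1 b2.
ring.
Qed.

Lemma sval_scale s m T y x : sval (sscale s m T) y x = (-1) ^+ s * m%:R * sval T y x.
Proof.
rewrite /sval /sscale big_map big_distrr; apply: eq_bigr => t _.
rewrite /tcoef /= signr_addb natrM.
move: ((-1) ^+ s) ((-1) ^+ t.1.1.1) (m%:R) (t.1.1.2%:R) => a1 a2 b1 b2.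
ring.
Qed.

Lemma sval_one y x : sval sone y x = 1.
Proof. by rewrite /sval big_seq1 /tcoef /= big_nil !expr0 !mulr1. Qed.

Lemma sval_nil y x : sval [::] y x = 0.
Proof. exact: big_nil. Qed.

Lemma sval_par v y x : sval (spar v) y x = y v.
Proof. by rewrite /sval big_seq1 /tcoef /= big_seq1 !expr0 !mulr1 !mul1r. Qed.

Definition yvec y v := mk3 (y v) (y v.+1) (y v.+2).

Lemma sval_var v y x : sval (svar v) y x = dot (yvec y v) x.
Proof.
rewrite /sval !big_cons big_nil /tcoef /= !big_seq1 /dot /yvec mk3_0 mk3_1 mk3_2.
by rewrite !expr0 !expr1; ring.
Qed.

Definition scoef T y a b : K := \sum_(t <- T | t.1.2.2 == (a, b)) tcoef y t.

Lemma td_scoef d T y : shomog d T -> td d (scoef T y).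
Proof.
move=> /allP hT a b ab; rewrite /scoef big_seq_cond big1 // => t /andP[/hT /eqP E /eqP E2].
by move: E; rewrite E2 /=; lia.
Qed.

Lemma ev_scoef d T y x : shomog d T -> ev d (scoef T y) x = sval T y x.
Proof.
move=> /allP hT; rewrite /ev /scoef /sval.
under eq_bigr => ab _ do rewrite big_distrl big_mkcond /=.
rewrite exchange_big /= !big_seq; apply: eq_bigr => t /hT /eqP ht.
rewrite (bigD1_seq t.1.2.2) ?uniq_mons ?mem_mons //=; last by lia.
rewrite -surjective_pairing eqxx big1 ?addr0; last first.
  by move=> ab ne; rewrite -surjective_pairing eq_sym (negPf ne).
by congr (_ * (_ ^+ _ * _ * _)); lia.
Qed.

(** Monomial equations are solved explicitly: D-th roots of the targets z_k, up to sign, are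
    combined through the exponents [inv] into parameters at which the k-th lowest term equals z_k.
    The terms of higher weight form the perturbation. Roots exist in K even if the characteristic
    divides D. *)
Lemma trop_dense T om idx ws inv D : trop_check T om idx ws inv D ->
  dense (fun w : 'I_(size idx) -> K => exists y, w = fun k =>
    scoef T y (nth (0, 0)%N idx k).1 (nth (0, 0)%N idx k).2).
Proof.
move=> /andP[D0 /allP hc]; set n := size idx.
have {hc}hc (k : 'I_n) : exists t, [/\ sel T om (nth (0, 0)%N idx k) (nth 0%N ws k) = [:: t],
    t.1.1.2 = 1%N & forall k' : 'I_n, rowsum inv t.2 k' = if k == k' then D%:Z else 0].
  have /hc : (k : nat) \in iota 0 n by rewrite mem_iota /= ltn_ord.
  case: (sel _ _ _ _) => [|t [|]] // /andP[/eqP m1 /allP hr]; exists t; split=> // k'.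
  have /hr /eqP -> : (k' : nat) \in iota 0 n by rewrite mem_iota /= ltn_ord.
  by rewrite -val_eqE.
have [ld hld] := @fin_all_exists _ (fun=> term) _ hc.
pose wt := twt om.
(* The targets must be nonzero because [inv] may have negative entries. *)
have dZ : dense (fun z : 'I_n -> K => True /\ (\prod_k 'X_k : {mpoly K[n]}).@[z] != 0).
  apply: dense_open (@denseT K n).
  apply/prodf_neq0 => k _; apply/eqP => /(congr1 (meval (fun=> 1))).
  by rewrite mevalXU meval0 => /eqP; rewrite oner_eq0.
apply: (dense_init (w := fun k => wt (ld k)) dZ) => z [_ hz].
have z0 k : z k != 0.
  by move: hz; rewrite rmorph_prod /= => /prodf_neq0/(_ k isT); rewrite mevalXU.
have [ze hze] : exists ze : 'I_n -> K, forall k, ze k ^+ D = (-1) ^+ (ld k).1.1.1 * z k.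
  apply: (@fin_all_exists _ (fun=> K) (fun k u => u ^+ D = (-1) ^+ (ld k).1.1.1 * z k)) => k.
  have [u hu] := solve_monicpoly (nth 0 [:: (-1) ^+ (ld k).1.1.1 * z k]) D0.
  exists u; rewrite hu -(prednK D0).
  rewrite big_ord_recl /= expr0 mulr1 big1 ?addr0 // => i _.
  by rewrite nth_nil mul0r.
have ze0 k : ze k != 0.
  apply/eqP => E; have := hze k; rewrite E expr0n eqn0Ngt D0 => /esym/eqP.
  by rewrite mulf_eq0 signr_eq0 (negPf (z0 k)).
pose eta i := \prod_(k < n) ze k ^ (nth 0 (nth [::] inv i) k).
have etaE e : \prod_(i <- e) eta i = \prod_k ze k ^ rowsum inv e k.
  elim: e => [|i e IH]; first by rewrite big_nil big1.
  rewrite big_cons IH /eta -big_split; apply: eq_bigr => k _ /=.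
  by rewrite expfzDr.
have lead_eta k : \prod_(i <- (ld k).2) eta i = ze k ^+ D.
  have [_ _ hr] := hld k; rewrite etaE (bigD1 k) //= hr eqxx big1 ?mulr1 // => k' ne.
  by rewrite hr eq_sym (negPf ne).
pose yt (s : K) i := eta i * s ^+ nth 0%N om i.
have tE s t : tcoef (yt s) t = tcoef eta t * s ^+ wt t.
  rewrite /tcoef -[RHS]mulrA; congr (_ * _); rewrite /wt /twt.
  elim: (t.2) => [|i e IH]; first by rewrite !big_nil mulr1.
  by rewrite !big_cons IH /= exprD /yt; ring.
pose ab (k : nat) := nth (0, 0)%N idx k; pose w (k : nat) := nth 0%N ws k.
(* The exponent does not truncate: the terms collected here have weight above [w k], which is at
   least the weight of [ld k]. *)
pose r (k : 'I_n) : {poly K} := \sum_(t <- T | (t.1.2.2 == ab k) && ~~ (wt t <= w k)%N)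
   tcoef eta t *: 'X^(wt t - (wt (ld k)).+1).
exists (fun k => r k); exists 1 => [|s _]; first exact: oner_neq0.
exists (yt s); apply: functional_extensionality => k.
have [hs m1 _] := hld k.
have wle : (wt (ld k) <= w k)%N.
  have : ld k \in sel T om (ab k) (w k) by rewrite hs mem_head.
  by rewrite mem_filter => /andP[/andP[]].
rewrite /scoef -surjective_pairing (bigID (fun t => wt t <= w k)%N) /=.
rewrite -big_filter -/(sel T om (ab k) (w k)) hs big_seq1 mulrDr; congr (_ + _).
  rewrite tE mulrC /tcoef m1 mulr1 lead_eta hze mulrA -signr_addb addbb expr0 mul1r.
  by [].
rewrite horner_sum !big_distrr /=; apply: eq_bigr => t /andP[_]; rewrite -ltnNge => lt.
rewrite tE hornerZ hornerXn.
have -> : s ^+ wt t = s ^+ wt (ld k) * s * s ^+ (wt t - (wt (ld k)).+1).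
  by rewrite -exprSr -exprD subnKC //; apply: leq_ltn_trans lt.
by move: (tcoef eta t) (s ^+ wt (ld k)) (s ^+ (wt t - _)) => a b c; ring.
Qed.

End Trop.

Definition spow (m : sform) k : sform := iter k (smul m) sone.

Fixpoint sesym (ns : seq (sform * sform)) k : sform := match ns with
  | [::] => if k == 0%N then sone else [::]
  | n :: r => smul n.1 (sesym r k) ++ (if k is k'.+1 then smul n.2 (sesym r k') else [::])
  end.

(* sesym [:: (n_1, g_1); ...] k is the coefficient of z^k in prod_i (n_i + z g_i).
   With l_0 = s g_0 + m and l_i = n_i - s g_i, the curve sum_i g_i prod_(j != i) l_j has
   no term linear in s g_0; its leading monomials below then stay independent in every
   characteristic, including 2. *)
Definition sstar (s g0 m : sform) (ns : seq (sform * sform)) : sform :=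
  flatten [seq (if k == 1%N then [::] else
                sscale ((0 < k)%N && ~~ odd k) (if k is k'.+1 then k' else 1%N)
                  (smul (smul (spow s k) g0) (sesym ns k)))
             ++ (if k is k'.+1 then sscale (odd k') k (smul (smul (spow s k') m) (sesym ns k))
                 else [::]) | k <- iota 0 (size ns).+1].

(** All g_i are 1, since constants can be absorbed into the lines. With m = 0 the lines are l_0 and
    n_i - l_0, and there are 3l parameters. *)
Definition sdiag l := sstar (svar 0) sone [::] [seq (svar (3 + 3 * i), sone) | i <- iota 0 (l - 1)].
(** Quintics through five lines, with linear g_i: parameter 0 is the scalar s, and m, the five g_i
    and the four n_i have three parameters each, 31 in all. *)
Definition squin := sstar (spar 0) (svar 4) (svar 1)
  [seq (svar (7 + 6 * i), svar (10 + 6 * i)) | i <- iota 0 4].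

(** Certificates for [trop_check], with D = 1, 2, 2, 10, 2, 2 in order of appearance. For l = 2, 3,
    4 and for the quintics with l = 5 (suffix 55) the list [idx] contains all monomials, for
    quartics with l = 5 all but one, and for l = 6 all but three. *)
Definition om_2 : seq nat := [:: 19; 8; 11; 20; 16; 0].
Definition idx_2 : seq (nat * nat) := [:: (0,0); (1,0); (0,1)].
Definition wt_2 : seq nat := [:: 20; 16; 0].
Definition inv_2 : seq (seq int) := [:: [:: 0; 0; 0];
  [:: 0; 0; 0];
  [:: 0; 0; 0];
  [:: 1; 0; 0];
  [:: 0; 1; 0];
  [:: 0; 0; 1]].

Definition om_3 : seq nat := [:: 11; 16; 8; 14; 3; 18; 11; 9; 1].
Definition idx_3 : seq (nat * nat) := [:: (0,0); (1,0); (0,1); (2,0); (1,1); (0,2)].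
Definition wt_3 : seq nat := [:: 22; 14; 15; 12; 4; 16].
Definition inv_3 : seq (seq int) := [:: [:: 1; 0; 0; 0; 0; 0];
  [:: 0; 0; 0; 0; 0; 0];
  [:: 0; 0; 0; 0; 0; 1];
  [:: 0; 0; 0; 0; 0; 0];
  [:: 0; 0; - 2; 0; 2; 0];
  [:: 0; 0; 0; 0; 0; 0];
  [:: 0; 2; 2; 0; - 2; 0];
  [:: 0; 0; 2; 2; - 2; 0];
  [:: 0; 0; 2; 0; 0; 0]].

Definition om_4 : seq nat := [:: 28; 37; 33; 32; 42; 4; 1; 48; 33; 35; 11; 57].
Definition idx_4 : seq (nat * nat) := [:: (0,0); (1,0); (0,1); (2,0); (1,1); (0,2); (3,0); (2,1); (1,2); (0,3)].
Definition wt_4 : seq nat := [:: 57; 44; 40; 54; 16; 62; 85; 63; 48; 70].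
Definition inv_4 : seq (seq int) := [:: [:: 1; 0; 0; 0; - 1; 0; 0; 0; 0; 0];
  [:: 0; 0; 0; 0; 0; 0; 1; 0; 0; 0];
  [:: 0; 0; 0; 0; 0; 0; 0; 0; 0; 1];
  [:: 0; 2; 0; 0; - 2; 0; 0; 0; 0; 0];
  [:: 0; 0; 0; 2; - 2; 0; 0; 0; 0; 0];
  [:: 0; 0; 0; 0; 0; 0; 0; 0; 0; 0];
  [:: 0; 0; 0; 0; 2; 0; 0; 0; 0; 0];
  [:: 0; 0; 0; 0; 0; 0; 0; 2; 0; 0];
  [:: 0; 0; 0; 0; 0; 0; 0; 0; 2; 0];
  [:: 0; 0; 2; 0; - 2; 0; 0; 0; 0; 0];
  [:: 0; 0; 0; 0; 0; 0; 0; 0; 0; 0];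
  [:: 0; 0; 0; 0; - 2; 2; 0; 0; 0; 0]].

Definition om_6 : seq nat := [:: 46; 35; 49; 51; 26; 1; 50; 5; 59; 12; 9; 48; 16; 49; 42; 1; 40; 54].
Definition idx_6 : seq (nat * nat) := [:: (0,0); (1,0); (0,1); (2,0); (1,1); (0,2); (3,0); (1,2); (0,3); (4,0); (3,1); (1,3); (0,4); (5,0); (3,2); (2,3); (1,4); (0,5)].
Definition wt_6 : seq nat := [:: 121; 85; 80; 60; 35; 89; 57; 61; 112; 85; 65; 97; 142; 110; 97; 111; 146; 189].
Definition inv_6 : seq (seq int) := [:: [:: 5; 0; 0; - 3; - 2; 0; 0; - 2; 2; - 3; 0; 4; - 1; 3; 0; 0; 3; - 4];
  [:: 0; 0; 0; 2; 3; 0; - 5; - 2; - 3; 2; 0; - 1; 4; 3; 0; 0; - 2; 1];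
  [:: 0; 0; 0; 2; - 2; 0; 0; - 2; 2; 2; 0; - 1; - 1; - 2; 0; 0; 3; 1];
  [:: 0; 10; 0; - 8; - 2; 0; 0; - 2; 2; - 8; 0; 4; 4; 8; 0; 0; - 2; - 4];
  [:: 0; 0; 0; 2; - 2; 0; 0; - 2; 2; - 8; 0; 4; 4; 8; 0; 0; - 2; - 4];
  [:: 0; 0; 0; - 8; 8; 0; 0; - 2; 2; - 8; 0; 4; 4; 8; 0; 0; - 2; - 4];
  [:: 0; 0; 10; 2; - 12; 0; 0; - 2; 2; 2; 0; 4; - 6; - 2; 0; 0; 8; - 4];
  [:: 0; 0; 0; 2; - 2; 0; 0; - 2; 2; 2; 0; 4; - 6; - 2; 0; 0; 8; - 4];
  [:: 0; 0; 0; 2; - 12; 10; 0; - 2; 2; 2; 0; 4; - 6; - 2; 0; 0; 8; - 4];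
  [:: 0; 0; 0; 2; - 2; 0; 0; 8; 2; 2; 0; - 6; - 6; - 2; 0; 0; - 2; 6];
  [:: 0; 0; 0; - 8; - 2; 0; 10; 8; 2; 2; 0; - 6; - 6; - 2; 0; 0; - 2; 6];
  [:: 0; 0; 0; 2; - 2; 0; 0; - 2; 2; 2; 0; 4; - 6; - 2; 0; 0; - 2; 6];
  [:: 0; 0; 0; 2; 8; 0; 0; - 2; - 8; 2; 0; - 6; 4; - 2; 0; 0; - 2; 6];
  [:: 0; 0; 0; 12; - 2; 0; - 10; - 2; - 8; 2; 10; - 6; 4; - 2; 0; 0; - 2; 6];
  [:: 0; 0; 0; 2; - 2; 0; 0; 8; - 8; 2; 0; - 6; 4; - 2; 0; 0; - 2; 6];
  [:: 0; 0; 0; 2; - 2; 0; 0; - 2; 2; 2; 0; 4; 4; - 2; 0; 0; - 2; - 4];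
  [:: 0; 0; 0; 12; - 2; 0; - 10; - 12; 2; 2; 0; 4; 4; - 2; 10; 0; - 2; - 4];
  [:: 0; 0; 0; 12; - 2; 0; - 10; - 12; 2; 2; 0; 4; 4; - 2; 0; 10; - 2; - 4]].

Definition om_5 : seq nat := [:: 30; 43; 40; 2; 56; 52; 49; 57; 0; 13; 12; 55; 16; 0; 44; 0].
Definition idx_5 : seq (nat * nat) := [:: (0,0); (1,0); (0,1); (2,0); (1,1); (0,2); (3,0); (2,1); (1,2); (0,3); (4,0); (3,1); (2,2); (1,3)].
Definition wt_5 : seq nat := [:: 75; 62; 31; 63; 15; 59; 71; 14; 57; 82; 98; 68; 64; 80].
Definition inv_5 : seq (seq int) := [:: [:: 1; 0; 0; 0; - 1; 0; 0; 0; 0; 0; 0; 0; 0; 0];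
  [:: 0; 0; 0; 0; 0; 0; 0; - 1; 0; 1; 1; 0; 0; - 1];
  [:: 1; - 1; 0; 0; - 1; 0; 0; 0; 0; 1; 0; 0; 0; 0];
  [:: 0; 0; 0; 0; 0; 0; 0; 0; 0; 2; 0; 0; 0; - 2];
  [:: 0; 0; 0; 0; 0; 0; 0; - 2; 0; 2; 0; 2; 0; - 2];
  [:: 0; 0; 0; 0; 0; 0; 0; - 2; 0; 2; 0; 0; 2; - 2];
  [:: 0; 0; 0; 2; 0; 0; 0; - 2; 0; 0; 0; 0; 0; 0];
  [:: 0; 0; 0; 0; 0; 0; 2; - 2; 0; 0; 0; 0; 0; 0];
  [:: 0; 0; 0; 0; 0; 0; 0; 0; 0; 0; 0; 0; 0; 0];
  [:: 2; - 2; 0; 0; 0; 0; 0; 0; 0; 0; 0; 0; 0; 0];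
  [:: 2; - 2; 0; 0; - 2; 0; 0; 2; 0; 0; 0; 0; 0; 0];
  [:: 2; - 2; 0; 0; - 2; 0; 0; 0; 2; 0; 0; 0; 0; 0];
  [:: 0; 0; 2; 0; - 2; 0; 0; 0; 0; 0; 0; 0; 0; 0];
  [:: 0; 0; 0; 0; 0; 0; 0; 0; 0; 0; 0; 0; 0; 0];
  [:: 0; 0; 0; 0; - 2; 2; 0; 0; 0; 0; 0; 0; 0; 0];
  [:: - 2; 2; 0; 0; 2; 0; 0; 0; 0; - 2; 0; 0; 0; 2]].

Definition om_55 : seq nat := [:: 26; 56; 57; 0; 22; 7; 56; 59; 56; 2; 1; 42; 51; 42; 5; 24; 20; 21; 1; 6; 53; 46; 48; 31; 21; 20; 53; 44; 34; 9; 24].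
Definition idx_55 : seq (nat * nat) := [:: (0,0); (1,0); (0,1); (2,0); (1,1); (0,2); (3,0); (2,1); (1,2); (0,3); (4,0); (3,1); (2,2); (1,3); (0,4); (5,0); (4,1); (3,2); (2,3); (1,4); (0,5)].
Definition wt_55 : seq nat := [:: 121; 88; 69; 89; 32; 48; 80; 40; 47; 29; 121; 73; 22; 37; 53; 160; 106; 69; 62; 72; 91].
Definition inv_55 : seq (seq int) := [:: [:: 0; 0; 0; 0; - 1; 0; 1; - 1; 0; 2; 0; 0; - 1; 0; 0; 0; 0; 0; 0; 2; - 2];
  [:: 0; 2; 0; - 2; 0; 0; 0; 0; 0; 0; 0; 0; 0; 0; 0; 0; 0; 0; 0; 0; 0];
  [:: 0; 0; 0; 0; 0; 0; 0; 0; 0; 0; 0; 0; 0; 0; 0; 0; 0; 0; 0; 0; 0];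
  [:: 0; 0; 0; - 2; 2; 0; 0; 0; 0; 0; 0; 0; 0; 0; 0; 0; 0; 0; 0; 0; 0];
  [:: 2; 0; 0; - 2; 2; - 2; - 2; 2; 0; - 2; 0; 0; 2; 0; 0; 0; 0; 0; 0; - 2; 2];
  [:: 0; 0; 0; - 2; 2; 0; 0; 2; 0; - 2; 0; 0; 0; 0; 0; 0; 0; 0; 0; - 2; 2];
  [:: 0; 0; 0; 0; 0; 0; 0; 0; 0; 0; 0; 0; 0; 0; 0; 0; 0; 0; 0; 0; 0];
  [:: 0; 0; 0; 0; 0; 0; 0; 0; 0; 0; 0; 0; 0; 0; 0; 0; 0; 0; 0; 0; 0];
  [:: 0; 0; 0; 2; - 2; 0; 0; 0; 0; 2; 0; 0; - 2; 0; 0; 2; - 2; 2; 0; 0; 0];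
  [:: 0; 0; 0; 2; - 2; 0; 0; 0; 0; 2; 0; 0; - 2; 0; 0; 0; 0; 2; 0; 0; 0];
  [:: 0; 0; 0; 2; 0; 0; 0; 0; 0; 0; 0; 0; - 2; 0; 0; 0; 0; 2; 0; - 2; 2];
  [:: 0; 0; 0; 2; 0; 0; - 2; 0; 0; 0; 2; 0; - 2; 0; 0; 0; 0; 2; 0; - 2; 2];
  [:: 0; 0; 0; 0; 0; 0; 0; 0; 0; 0; 0; 0; 0; 0; 0; 0; 0; 0; 0; 0; 0];
  [:: 0; 0; 2; 0; - 2; 0; 0; 0; 0; 0; 0; 0; 0; 0; 0; 0; 0; 0; 0; 2; - 2];
  [:: 0; 0; 0; 0; 0; 0; 0; 0; 0; 0; 0; 0; 0; 0; 0; 0; 0; 0; 0; 2; - 2];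
  [:: 0; 0; 0; 0; 0; 0; 0; 0; 0; 0; 0; 0; 0; 0; 0; 0; 0; 0; 0; 0; 0];
  [:: 0; 0; 0; 0; 0; 2; 0; 0; 0; - 2; 0; 0; 0; 0; 0; 0; 0; 0; 0; 0; 0];
  [:: 0; 0; 0; 0; 0; 0; 0; 0; 0; 0; 0; 0; 0; 0; 0; 0; 0; 0; 0; 0; 0];
  [:: 0; 0; 0; 0; 0; 0; 0; 0; 0; 0; 0; 0; 0; 0; 0; 0; 0; 0; 0; 0; 0];
  [:: 0; 0; 0; 0; 0; 0; 0; 0; 0; 0; 0; 0; 2; 0; 0; 0; 0; - 2; 0; 0; 0];
  [:: 0; 0; 0; 0; 0; 0; 0; 0; 0; 0; 0; 0; 0; 0; 0; 0; 0; 0; 0; 0; 0];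
  [:: 0; 0; 0; 0; 0; 0; 0; 0; 0; 0; 0; 0; 0; 0; 0; 0; 0; - 2; 2; 0; 0];
  [:: 0; 0; 0; 0; 0; 0; 0; 0; 0; 0; 0; 0; 0; 0; 0; 0; 0; 0; 0; 0; 0];
  [:: 0; 0; 0; 0; 2; 0; - 2; 0; 0; - 2; 0; 0; 2; 0; 0; 0; 2; - 2; 0; - 2; 2];
  [:: 0; 0; 0; 0; 0; 0; 0; 0; 0; 0; 0; 0; 2; 0; - 2; 0; 0; - 2; 0; 0; 2];
  [:: 0; 0; 0; 0; 0; 0; 0; 0; 0; 0; 0; 0; 0; 0; 0; 0; 0; 0; 0; 0; 0];
  [:: 0; 0; 0; 0; 0; 0; 0; - 2; 0; 0; 0; 2; 0; 0; 0; 0; 0; 0; 0; 0; 0];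
  [:: 0; 0; 0; 0; 0; 0; 0; 0; 0; - 2; 0; 0; 0; 0; 2; 0; 0; 0; 0; 0; 0];
  [:: 0; 0; 0; 0; 0; 0; 0; 0; 2; - 2; 0; 0; 0; 0; 0; 0; 0; 0; 0; - 2; 2];
  [:: 0; 0; 0; 0; 0; 0; 0; 0; 0; - 2; 0; 0; 2; 0; 0; 0; 0; 0; 0; - 2; 2];
  [:: 0; 0; 0; 0; 0; 0; 0; 0; 0; - 2; 0; 0; 0; 2; 0; 0; 0; 0; 0; - 2; 2]].

Section Base.
Variable K : closedFieldType.
Implicit Types (y : nat -> K) (x : 'I_3 -> K).

Fixpoint kesym (ns : seq (K * K)) k : K := match ns with
  | [::] => (k == 0%N)%:R
  | n :: r => n.1 * kesym r k + (if k is k'.+1 then n.2 * kesym r k' else 0)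
  end.

Lemma sval_sesym ns k y x :
  sval (sesym ns k) y x = kesym [seq (sval n.1 y x, sval n.2 y x) | n <- ns] k.
Proof.
elim: ns k => [|n r IH] [|k] /=; rewrite ?sval_one ?sval_nil //.
  by rewrite sval_cat sval_mul sval_nil IH.
by rewrite sval_cat !sval_mul !IH.
Qed.

Lemma sval_pow s k y x : sval (spow s k) y x = sval s y x ^+ k.
Proof. by elim: k => [|k IH]; rewrite ?sval_one //= sval_mul IH exprS. Qed.

Lemma sval_flatten (r : seq sform) y x : sval (flatten r) y x = \sum_(T <- r) sval T y x.
Proof. by elim: r => [|T r IH]; rewrite ?big_nil ?sval_nil // big_cons -IH sval_cat. Qed.

(** The value of [sstar] at a point, in terms of numbers; its agreement with the star sum is then a
    polynomial identity for each fixed l. *)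
Definition kstar (s g0 m : K) (ns : seq (K * K)) : K := \sum_(k <- iota 0 (size ns).+1)
  ((if k == 1%N then 0 else (-1) ^+ ((0 < k)%N && ~~ odd k) * (if k is k'.+1 then k' else 1%N)%:R *
     (s ^+ k * g0 * kesym ns k)) +
   (if k is k'.+1 then (-1) ^+ (odd k') * k%:R * (s ^+ k' * m * kesym ns k) else 0)).

Lemma sval_star s g0 m ns y x : sval (sstar s g0 m ns) y x =
  kstar (sval s y x) (sval g0 y x) (sval m y x) [seq (sval n.1 y x, sval n.2 y x) | n <- ns].
Proof.
rewrite /sstar sval_flatten big_map /kstar size_map; apply: eq_bigr => k _.
rewrite sval_cat; congr (_ + _).
  case: (k == 1%N); first exact: sval_nil.
  by rewrite sval_scale !sval_mul sval_pow sval_sesym.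
case: k => [|k]; first exact: sval_nil.
by rewrite sval_scale !sval_mul sval_pow sval_sesym.
Qed.

Lemma dotB u v x : dot (fun c => u c - v c) x = dot u x - dot v x :> K.
Proof. by rewrite /dot /x0 /x1 /x2; ring. Qed.

Lemma dotZ k v x : dot (fun c => k * v c) x = k * dot v x :> K.
Proof. by rewrite /dot /x0 /x1 /x2; ring. Qed.

Lemma dotD u v x : dot (fun c => u c + v c) x = dot u x + dot v x :> K.
Proof. by rewrite /dot /x0 /x1 /x2; ring. Qed.

Lemma star_sum_nat l (f g : nat -> K) :
  \sum_(i < l) g i * \prod_(k < l | k != i) f k =
  \sum_(0 <= i < l) g i * \prod_(0 <= k < l | k != i) f k.
Proof. by rewrite big_mkord; apply: eq_bigr => i _; rewrite big_mkord. Qed.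

Definition diagL l y (i : 'I_l) : 'I_3 -> K :=
  if val i is i'.+1 then fun c => yvec y (3 * i'.+1) c - yvec y 0 c else yvec y 0.

Definition quinL y (i : 'I_5) : 'I_3 -> K :=
  if val i is i'.+1 then fun c => yvec y (7 + 6 * i') c - y 0%N * yvec y (10 + 6 * i') c
  else fun c => y 0%N * yvec y 4 c + yvec y 1 c.

Definition quing y (i : 'I_5) : 'I_3 -> K :=
  if val i is i'.+1 then yvec y (10 + 6 * i') else yvec y 4.

Lemma fam_ev_ext (e : bool) l (L g : 'I_l -> 'I_3 -> K) T y : shomog (l - 1 + e) T ->
  (forall x, sval T y x = ev (l - 1 + e) (fam e L g) x) -> scoef T y = fam e L g.
Proof.
move=> hT h; apply: (@form_ext K (l - 1 + e)); first exact: td_scoef.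
  by have [] := fam_Idl e L g.
by move=> x; rewrite ev_scoef // h.
Qed.

Lemma diag_fam l y : shomog (l - 1) (sdiag l) -> (l \in [:: 2; 3; 4; 5; 6])%N ->
  scoef (sdiag l) y = fam false (@diagL l y) (fun=> mk3 1 0 0).
Proof.
move=> hT hl; apply: fam_ev_ext; first by rewrite addn0.
move=> x; rewrite addn0 ev_fam0 sval_star sval_var sval_one sval_nil -map_comp.
pose f (k : nat) := if k is k'.+1 then dot (yvec y (3 * k'.+1)) x - dot (yvec y 0) x
  else dot (yvec y 0) x.
have E (i : 'I_l) : dot (diagL y i) x = f i.
  by case: i => [[|k] hk] //; exact: (dotB (yvec y (3 * k.+1)) (yvec y 0) x).
transitivity (\sum_(i < l) (fun=> 1) (i : nat) * \prod_(k < l | k != i) f k); last first.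
  by apply: eq_bigr => i _; rewrite mk3E; congr (_ * _); apply: eq_bigr => k _; rewrite E.
rewrite (star_sum_nat l f (fun=> 1)) {hT E} /f.
rewrite (eq_map (g := fun i => (dot (yvec y (3 * i.+1)) x, 1))); last first.
  by move=> i /=; rewrite sval_var sval_one mulnS.
move: hl; rewrite !inE => /or4P[|||/orP[]] /eqP -> {l}; rewrite /kstar unlock /=; ring.
Qed.

Lemma ev_fam1 l (L g : 'I_l -> 'I_3 -> K) x : ev (l - 1 + true) (fam true L g) x =
  \sum_i dot (g i) x * \prod_(k | k != i) dot (L k) x.
Proof.
rewrite ev_sum; apply: eq_bigr => i _.
by rewrite addn1 ev_lmul ?ev_omit1 //; apply: td_omit1.
Qed.

Lemma quin_fam y : scoef squin y = fam true (quinL y) (quing y).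
Proof.
apply: fam_ev_ext; first by vm_compute.
move=> x; rewrite sval_star sval_par !sval_var -map_comp.
rewrite ev_fam1.
pose f (k : nat) := if k is k'.+1 then dot (yvec y (7 + 6 * k')) x - y 0%N * dot (yvec y (10 + 6 * k')) x
  else y 0%N * dot (yvec y 4) x + dot (yvec y 1) x.
pose g (k : nat) := if k is k'.+1 then dot (yvec y (10 + 6 * k')) x else dot (yvec y 4) x.
have Ef (i : 'I_5) : dot (quinL y i) x = f i.
  case: i => [[|k] hk].
    by rewrite /quinL /= (dotD (fun c => y 0%N * yvec y 4 c) (yvec y 1)) dotZ.
  by rewrite /quinL /= (dotB (yvec y (7 + 6 * k)) (fun c => y 0%N * yvec y (10 + 6 * k) c)) dotZ.
have Eg (i : 'I_5) : dot (quing y i) x = g i by case: i => [[|k] hk].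
transitivity (\sum_(i < 5) g (i : nat) * \prod_(k < 5 | k != i) f k); last first.
  by apply: eq_bigr => i _; rewrite Eg; congr (_ * _); apply: eq_bigr => k _; rewrite Ef.
rewrite (star_sum_nat 5 f g) {Ef Eg} /f /g.
rewrite (eq_map (g := fun i => (dot (yvec y (7 + 6 * i)) x, dot (yvec y (10 + 6 * i)) x))); last first.
  by move=> i /=; rewrite !sval_var.
rewrite /kstar unlock /=; ring.
Qed.

Lemma diag_dense l om idx ws inv D : (l \in [:: 2; 3; 4; 5; 6])%N -> shomog (l - 1) (sdiag l) ->
  trop_check (sdiag l) om idx ws inv D ->
  DensFull K false l (fun k : 'I_(size idx) => nth (0, 0)%N idx k).
Proof.
move=> hl hT hc; apply: dense_sub (@trop_dense K _ _ _ _ _ _ hc) => _ [y ->].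
by exists (@diagL l y), (fun=> mk3 1 0 0); rewrite diag_fam.
Qed.

Lemma dense2 : DensFull K false 2 (fun k : 'I_3 => nth (0, 0)%N idx_2 k).
Proof. by apply: (@diag_dense 2 om_2 idx_2 wt_2 inv_2 1) => //; vm_compute. Qed.

Lemma dense3 : DensFull K false 3 (fun k : 'I_6 => nth (0, 0)%N idx_3 k).
Proof. by apply: (@diag_dense 3 om_3 idx_3 wt_3 inv_3 2) => //; vm_compute. Qed.

Lemma dense4 : DensFull K false 4 (fun k : 'I_10 => nth (0, 0)%N idx_4 k).
Proof. by apply: (@diag_dense 4 om_4 idx_4 wt_4 inv_4 2) => //; vm_compute. Qed.

Lemma dense6 : DensFull K false 6 (fun k : 'I_18 => nth (0, 0)%N idx_6 k).
Proof. by apply: (@diag_dense 6 om_6 idx_6 wt_6 inv_6 10) => //; vm_compute. Qed.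

Lemma dense55 : DensFull K true 5 (fun k : 'I_21 => nth (0, 0)%N idx_55 k).
Proof.
have dT : trop_check squin om_55 idx_55 wt_55 inv_55 2 by vm_compute.
apply: dense_sub (@trop_dense K _ _ _ _ _ _ dT) => _ [y ->].
by exists (quinL y), (quing y); rewrite -quin_fam.
Qed.

End Base.

(** * Lueroth quartics *)

Section Luroth.
Variable K : closedFieldType.
Implicit Types (t g w : 'I_5 -> K) (A B Q : {poly K}).

Definition Bpol t : {poly K} := \prod_i ('X - (t i)%:P).
Definition Lpol t i : {poly K} := \prod_(k | k != i) ('X - (t k)%:P).
Definition Apol t g : {poly K} := \sum_i g i *: Lpol t i.
(** A point of the plane enters through the quadratic [Q] in the parameter of the tangent lines: up
    to a factor, line k takes the value Q(t_k) at it. *)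
Definition starval t g Q := \sum_i g i * \prod_(k | k != i) Q.[t k].

Lemma Bpol_horner t s : (Bpol t).[s] = \prod_i (s - t i).
Proof. by rewrite horner_prod; apply: eq_bigr => i _; rewrite !hornerE. Qed.

Lemma Lpol_horner t i s : (Lpol t i).[s] = \prod_(k | k != i) (s - t k).
Proof. by rewrite horner_prod; apply: eq_bigr => k _; rewrite !hornerE. Qed.

Lemma Lpol_root t i s : (s - t i) * (Lpol t i).[s] = (Bpol t).[s].
Proof. by rewrite Bpol_horner Lpol_horner [RHS](bigD1 i). Qed.

Lemma Apol_horner t g s : (Apol t g).[s] = \sum_i g i * (Lpol t i).[s].
Proof. by rewrite horner_sum; apply: eq_bigr => i _; rewrite hornerZ. Qed.

Lemma Apol_node t g i : (Apol t g).[t i] = g i * \prod_(k | k != i) (t i - t k).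
Proof.
rewrite Apol_horner (bigD1 i) //= [X in _ + X]big1 ?addr0 ?Lpol_horner // => j ji.
by rewrite Lpol_horner (bigD1 i) 1?eq_sym //= subrr mul0r mulr0.
Qed.

Lemma size_Lpol t i : size (Lpol t i) = 5.
Proof.
rewrite size_prod => [|k _]; last by rewrite polyXsubC_eq0.
rewrite (eq_bigr (fun=> 2%N)) => [|k _]; last exact: size_XsubC.
by rewrite sum_nat_const cardC1 card_ord.
Qed.

Lemma size_Apol t g : (size (Apol t g) <= 5)%N.
Proof.
apply: (leq_trans (size_sum _ _ _)); apply/bigmax_leqP => i _.
by rewrite (leq_trans (size_scale_leq _ _)) // size_Lpol.
Qed.

(* The star form with constants g on lines tangent to a conic is a Bezoutian of A and B. *)
Lemma bezoutian t g s u :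
  (u - s) * \sum_i g i * ((Lpol t i).[s] * (Lpol t i).[u]) =
  (Apol t g).[s] * (Bpol t).[u] - (Apol t g).[u] * (Bpol t).[s].
Proof.
rewrite !Apol_horner !big_distrl /= -sumrB big_distrr; apply: eq_bigr => i _ /=.
by rewrite -!(Lpol_root t i); ring.
Qed.

Lemma starval_split t g c s u :
  starval t g (c *: (('X - s%:P) * ('X - u%:P))) =
  c ^+ 4 * \sum_i g i * ((Lpol t i).[s] * (Lpol t i).[u]).
Proof.
rewrite big_distrr; apply: eq_bigr => i _ /=; rewrite mulrCA; congr (_ * _).
rewrite !Lpol_horner -big_split /=.
rewrite (eq_bigr (fun k => c * ((s - t k) * (u - t k)))); last first.
  by move=> k _; rewrite hornerZ hornerM !hornerXsubC; ring.
by rewrite big_split /= prodr_const cardC1 card_ord.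
Qed.

(** For Q = c (X - s)(X - u) the value is c^4 times the Bezoutian of A and B at s and u, which is
    unchanged when a multiple of A is added to B. The case s = u is included because the identity in
    the second point is one of polynomials, tested away from s. *)
Lemma starval_pencil t g t' g' mu Q : size Q = 3 ->
  Apol t' g' = Apol t g -> Bpol t' = Bpol t + mu *: Apol t g ->
  starval t' g' Q = starval t g Q.
Proof.
move=> sQ eA eB.
have [rs hrs] := closed_field_poly_normal Q.
have Q0 : Q != 0 by rewrite -size_poly_eq0 sQ.
have srs : size rs = 2.
  move: sQ; rewrite hrs size_scale ?lead_coef_eq0 // size_prod_XsubC; lia.
case: rs hrs srs => [|s [|u []]] // -> _; rewrite !big_cons big_nil mulr1 !starval_split.
congr (_ * _).
pose F t g := \sum_i (g i * (Lpol t i).[s]) *: Lpol t i.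
have FE t1 g1 v : (F t1 g1).[v] = \sum_i g1 i * ((Lpol t1 i).[s] * (Lpol t1 i).[v]).
  by rewrite horner_sum; apply: eq_bigr => i _; rewrite hornerZ mulrA.
rewrite -!FE; congr horner; apply/eqP; rewrite -subr_eq0; apply/eqP.
apply: (@poly_vanish K _ ('X - s%:P)); first by rewrite polyXsubC_eq0.
move=> v; rewrite !hornerE => vs; apply/eqP; rewrite -(mulrI_eq0 _ (mulfI vs)) mulrBr.
by rewrite !FE !bezoutian eA eB !hornerE subr_eq0; apply/eqP; ring.
Qed.

Lemma lagrange t g A : injective t -> (size A <= 5)%N ->
  (forall i, g i = A.[t i] / \prod_(k | k != i) (t i - t k)) -> Apol t g = A.
Proof.
move=> it sA hg; apply/eqP; rewrite -subr_eq0; apply/eqP.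
apply: (@roots_geq_poly_eq0 _ _ [seq t i | i <- enum 'I_5]).
- apply/allP => _ /mapP[i _ ->]; rewrite rootE hornerD hornerN Apol_node hg divfK ?subrr //.
  by apply/prodf_neq0 => k ki; rewrite subr_eq0 (inj_eq it) eq_sym.
- by rewrite map_inj_uniq ?enum_uniq.
- rewrite size_map size_enum_ord (leq_trans (size_polyD _ _)) // geq_max size_polyN sA.
  by rewrite size_Apol.
Qed.

Lemma star_weights t w Q (L : 'I_5 -> K) : (forall i, w i != 0) ->
  (forall i, L i = w i * Q.[t i]) ->
  \sum_i \prod_(k | k != i) L k = (\prod_i w i) * starval t (fun i => (w i)^-1) Q.
Proof.
move=> w0 hL; rewrite big_distrr; apply: eq_bigr => i _ /=.
rewrite [X in _ = X * _](bigD1 i) //= -mulrA mulrCA mulVKf // -big_split.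
by apply: eq_bigr => k _; rewrite hL.
Qed.

(* Avoiding the roots of Z, another member B + mu A of the pencil gives five new lines. *)
Lemma pencil_move t w (Z : {poly K}) : injective t -> (forall i, w i != 0) -> Z != 0 ->
  exists t' w', [/\ forall i, w' i != 0, forall i, Z.[t' i] != 0 &
   forall Q, size Q = 3 -> (\prod_i w' i) * starval t' (fun i => (w' i)^-1) Q =
     (\prod_i w i) * starval t (fun i => (w i)^-1) Q].
Proof.
move=> it w0 Z0; pose g i := (w i)^-1; pose A := Apol t g; pose B := Bpol t.
have dt i : \prod_(k | k != i) (t i - t k) != 0.
  by apply/prodf_neq0 => k ki; rewrite subr_eq0 (inj_eq it) eq_sym.
have At i : A.[t i] != 0 by rewrite /A Apol_node mulf_neq0 ?invr_eq0.
have cop s : B.[s] = 0 -> A.[s] != 0.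
  rewrite /B Bpol_horner => /eqP; rewrite prodf_seq_eq0 => /hasP[i _ /=].
  by rewrite subr_eq0 => /eqP ->.
(* At a multiple root of B + mu A the Wronskian W vanishes; avoiding its roots makes the new
   parameters distinct. *)
pose W := B * A^`() - B^`() * A.
have Bt i : B.[t i] = 0 by rewrite /B -(Lpol_root t i) subrr mul0r.
have W0 : W != 0.
  apply/eqP => E; have := congr1 (fun p : {poly K} => p.[t ord0]) E.
  rewrite /W hornerD hornerN !hornerM Bt mul0r sub0r horner0 => /eqP.
  rewrite oppr_eq0 mulf_eq0 (negPf (At _)) orbF.
  have -> : B = ('X - (t ord0)%:P) * Lpol t ord0 by rewrite /B /Bpol (bigD1 ord0).
  rewrite derivM derivXsubC mul1r hornerD hornerM hornerXsubC subrr mul0r addr0 Lpol_horner.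
  by rewrite (negPf (dt _)).
have [rs hrs] := closed_field_poly_normal (Z * W).
have ZW0 : Z * W != 0 by rewrite mulf_neq0.
(* A and B have no common root, so each root of Z W excludes at most one value of mu. *)
have [mu hmu] : exists mu, \prod_(s <- rs) (B.[s] + mu * A.[s]) != 0.
  have /poly_nonroot[mu hm] : \prod_(s <- rs) (B.[s]%:P + 'X * A.[s]%:P) != 0.
    rewrite prodf_seq_neq0; apply/allP => s _ /=; apply/eqP => E.
    have h0 := congr1 (fun p : {poly K} => p.[0]) E.
    rewrite !hornerE ?mul0r ?addr0 in h0.
    have h1 := congr1 (fun p : {poly K} => p.[1]) E.
    rewrite !hornerE h0 ?add0r ?mul1r in h1.
    by have := cop _ h0; rewrite h1 eqxx.
  exists mu; move: hm; rewrite horner_prod; congr (_ != 0); apply: eq_bigr => s _.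
  by rewrite !hornerE.
pose Bm := B + mu *: A.
have mB : B \is monic by apply: monic_prod => i _; apply: monicXsubC.
have sB : size B = 6 by rewrite size_prod_XsubC /= /index_enum -enumT size_enum_ord.
have sAB : (size (mu *: A) < size B)%N.
  by rewrite sB ltnS (leq_trans (size_scale_leq _ _)) // size_Apol.
have sBm : size Bm = 6 by rewrite /Bm size_polyDl.
have mBm : Bm \is monic by rewrite monicE lead_coefDl // -monicE.
have [ts] := closed_field_poly_normal Bm; rewrite (eqP mBm) scale1r => hts.
have sts : size ts = 5 by move: sBm; rewrite hts size_prod_XsubC => -[].
pose t' (i : 'I_5) := ts`_i.
have eB : Bpol t' = Bm.
  by rewrite hts (big_nth 0) sts big_mkord.
have Bt' i : B.[t' i] + mu * A.[t' i] = 0.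
  by have := Lpol_root t' i (t' i); rewrite eB subrr mul0r /Bm hornerD hornerZ.
have ZWt' i : (Z * W).[t' i] != 0.
  apply: contraNneq hmu => E; rewrite prodf_seq_eq0; apply/hasP.
  exists (t' i); last by rewrite /= Bt'.
  have : root (Z * W) (t' i) by apply/eqP.
  by rewrite hrs rootZ ?lead_coef_eq0 // root_prod_XsubC.
have [Zt' Wt'] : (forall i, Z.[t' i] != 0) /\ (forall i, W.[t' i] != 0).
  by split=> i; have := ZWt' i; rewrite hornerM mulf_eq0 negb_or => /andP[].
have it' : injective t'.
  move=> i j E; apply/eqP/negPn/negP => ij.
  have /eqP := Wt' i; apply; rewrite /W hornerD hornerN !hornerM.
  have eBi : B.[t' i] = - (mu * A.[t' i]) by apply/eqP; rewrite -addr_eq0 Bt'.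
  have : Bm^`().[t' i] = 0.
    rewrite -eB /Bpol (bigD1 i) //= (bigD1 j) 1?eq_sym //= -E.
    rewrite !derivM derivXsubC !hornerE subrr; ring.
  rewrite /Bm derivD derivZ hornerD hornerZ => /eqP; rewrite addr_eq0 => /eqP ->.
  by rewrite eBi; ring.
have At' i : A.[t' i] != 0.
  apply/eqP => E; have := Bt' i; rewrite E mulr0 addr0 => /cop; by rewrite E eqxx.
have dt' i : \prod_(k | k != i) (t' i - t' k) != 0.
  by apply/prodf_neq0 => k ki; rewrite subr_eq0 (inj_eq it') eq_sym.
pose g' i := A.[t' i] / \prod_(k | k != i) (t' i - t' k).
have g'0 i : g' i != 0 by rewrite mulf_neq0 ?invr_eq0.
have eA : Apol t' g' = A by apply: lagrange => //; apply: size_Apol.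
(* The weights th / g'_i have product th^5 / prod g', and their inverses as constants contribute
   1/th. The fourth power of th is chosen so that the quartic itself, not just a multiple of it, is
   reproduced. *)
have [th hth] := solve_monicpoly (nth 0 [:: (\prod_i g' i) * (\prod_i w i)]) (isT : 0 < 4)%N.
have {}hth : th ^+ 4 = (\prod_i g' i) * (\prod_i w i).
  rewrite hth big_ord_recl /= expr0 mulr1 [X in _ + X]big1 ?addr0 // => i _.
  by rewrite nth_nil mul0r.
have th0 : th != 0.
  apply/eqP => E; move/eqP: hth; rewrite E expr0n eq_sym mulf_eq0 /= => /orP[]; apply/negP.
    exact/prodf_neq0.
  exact/prodf_neq0.
exists t', (fun i => th / g' i); split=> // [i|Q sQ]; first by rewrite mulf_neq0 ?invr_eq0.
have -> : starval t' (fun i => (th / g' i)^-1) Q = th^-1 * starval t' g' Q.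
  rewrite big_distrr; apply: eq_bigr => i _ /=; rewrite mulrA; congr (_ * _).
  by rewrite invfM invrK mulrC.
rewrite (starval_pencil sQ eA eB) mulrA; congr (_ * _).
rewrite big_split /= prodr_const card_ord prodfV.
have -> : th ^+ 5 = th * ((\prod_i g' i) * (\prod_i w i)) by rewrite exprS hth.
rewrite mulrC !mulrA mulVf // mul1r mulrAC divff ?mul1r //; exact/prodf_neq0.
Qed.

End Luroth.

(** * The conic tangent to five lines *)

Section Quartic.
Variable K : closedFieldType.

Definition unitg l (i : 'I_l) : 'I_3 -> K := mk3 1 0 0.

Lemma ev_unit l (L : 'I_l -> 'I_3 -> K) x :
  ev (l - 1) (fam false L (@unitg l)) x = \sum_i \prod_(k | k != i) dot (L k) x.
Proof. by rewrite ev_fam0; apply: eq_bigr => i _; rewrite mk3E mul1r. Qed.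

(* Five lines l0, ..., l4, with l3 = sum a_i l_i and l4 = sum b_i l_i, are tangent to the conic
   parametrized by t |-> sum_(i<3) -a_i t_i prod_(j != i) (t - t_j) l_i, where t_i = b_i/(b_i - a_i). *)
Section Conic.
Variables (l0 l1 l2 l3 l4 : 'I_3 -> K).
Let D := det3 l0 l1 l2.
Let a0 := det3 l3 l1 l2.
Let a1 := det3 l0 l3 l2.
Let a2 := det3 l0 l1 l3.
Let b0 := det3 l4 l1 l2.
Let b1 := det3 l0 l4 l2.
Let b2 := det3 l0 l1 l4.

Lemma cramer3 x : D * dot l3 x = a0 * dot l0 x + a1 * dot l1 x + a2 * dot l2 x.
Proof. rewrite /D /a0 /a1 /a2 !det3E /dot; ring. Qed.

Lemma cramer4 x : D * dot l4 x = b0 * dot l0 x + b1 * dot l1 x + b2 * dot l2 x.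
Proof. rewrite /D /b0 /b1 /b2 !det3E /dot; ring. Qed.

Hypothesis D0 : D != 0.
Hypotheses (a00 : a0 != 0) (a10 : a1 != 0) (a20 : a2 != 0).
Hypotheses (b00 : b0 != 0) (b10 : b1 != 0) (b20 : b2 != 0).
Hypotheses (d00 : b0 - a0 != 0) (d10 : b1 - a1 != 0) (d20 : b2 - a2 != 0).
Hypotheses (m01 : a0 * b1 - a1 * b0 != 0) (m02 : a0 * b2 - a2 * b0 != 0) (m12 : a1 * b2 - a2 * b1 != 0).

Let t0 := b0 / (b0 - a0).
Let t1 := b1 / (b1 - a1).
Let t2 := b2 / (b2 - a2).
Let k0 := - (a0 / D * t0).
Let k1 := - (a1 / D * t1).
Let k2 := - (a2 / D * t2).

Definition ctop x := k0 * dot l0 x + k1 * dot l1 x + k2 * dot l2 x.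

Definition cpol x : {poly K} := Poly [::
  k0 * (t1 * t2) * dot l0 x + k1 * (t0 * t2) * dot l1 x + k2 * (t0 * t1) * dot l2 x;
  - (k0 * (t1 + t2) * dot l0 x + k1 * (t0 + t2) * dot l1 x + k2 * (t0 + t1) * dot l2 x);
  ctop x].

Definition cvec s k := k0 * ((s - t1) * (s - t2)) * l0 k + k1 * ((s - t0) * (s - t2)) * l1 k
  + k2 * ((s - t0) * (s - t1)) * l2 k.

Lemma cpol_horner x s : (cpol x).[s] = dot (cvec s) x.
Proof. by rewrite /cpol horner_Poly /= /ctop /cvec /dot /x0 /x1 /x2; ring. Qed.

Lemma size_cpol x : ctop x != 0 -> size (cpol x) = 3.
Proof. by move=> h; rewrite /cpol (PolyK (c := 0)). Qed.

Lemma tneq : [/\ t0 - t1 != 0, t0 - t2 != 0, t1 - t2 != 0 & [/\ t0 != 0, t1 != 0 & t2 != 0]]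
  /\ [/\ 1 - t0 != 0, 1 - t1 != 0 & 1 - t2 != 0].
Proof.
have E (a b c d : K) : b - a != 0 -> d - c != 0 ->
    b / (b - a) - d / (d - c) = (a * d - c * b) / ((b - a) * (d - c)).
  by move=> h1 h2; field; rewrite h1 h2.
have E1 (a b : K) : b - a != 0 -> 1 - b / (b - a) = - a / (b - a) by move=> h; field.
split; first split.
- by rewrite /t0 /t1 E // mulf_neq0 // invr_eq0 mulf_neq0.
- by rewrite /t0 /t2 E // mulf_neq0 // invr_eq0 mulf_neq0.
- by rewrite /t1 /t2 E // mulf_neq0 // invr_eq0 mulf_neq0.
- by split; rewrite mulf_neq0 // invr_eq0.
by split; rewrite E1 // mulf_neq0 ?oppr_eq0 // invr_eq0.
Qed.

Let tt (i : 'I_5) := nth 0 [:: t0; t1; t2; 0; 1] i.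

Lemma tt_inj : injective tt.
Proof.
have U (a b c : K) : [/\ a - b != 0, a - c != 0, b - c != 0 & [/\ a != 0, b != 0 & c != 0]] ->
    [/\ 1 - a != 0, 1 - b != 0 & 1 - c != 0] -> uniq [:: a; b; c; 0; 1].
  rewrite !subr_eq0 => -[hab hac hbc [a0' b0' c0']] [a1' b1' c1'] /=.
  by rewrite !inE !negb_or hab hac hbc a0' b0' c0' !(eq_sym _ 1) a1' b1' c1' oner_neq0.
have [h1 h2] := tneq; have u := U _ _ _ h1 h2.
move=> i j /eqP; rewrite /tt nth_uniq ?(ltn_ord i) ?(ltn_ord j) // => /eqP; exact: val_inj.
Qed.

Let ww (i : 'I_5) := nth 0 [:: (k0 * ((t0 - t1) * (t0 - t2)))^-1; (k1 * ((t1 - t0) * (t1 - t2)))^-1;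
  (k2 * ((t2 - t0) * (t2 - t1)))^-1; (- (t0 * t1 * t2))^-1; ((1 - t0) * (1 - t1) * (1 - t2))^-1] i.

Lemma k_neq0 : [/\ k0 != 0, k1 != 0 & k2 != 0].
Proof.
have [[_ _ _ [n0 n1 n2]] _] := tneq.
by split; rewrite oppr_eq0 !mulf_neq0 ?invr_eq0.
Qed.

Lemma ww_neq0 i : ww i != 0.
Proof.
have [[h01 h02 h12 [n0 n1 n2]] [e0 e1 e2]] := tneq; have [q0 q1 q2] := k_neq0.
have [g01 g02 g12] : [/\ t1 - t0 != 0, t2 - t0 != 0 & t2 - t1 != 0].
  by split; rewrite -opprB oppr_eq0.
have nz (a b c : K) : a != 0 -> b != 0 -> c != 0 -> (a * (b * c))^-1 != 0.
  by move=> ha hb hc; rewrite invr_eq0 !mulf_neq0.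
case: i => [[|[|[|[|[|]]]]]//= hi]; rewrite /ww /=; try exact: nz.
  by rewrite invr_eq0 oppr_eq0 -invr_eq0 -mulrA; apply: nz.
by rewrite -mulrA; apply: nz.
Qed.

Let ll (i : 'I_5) := nth l0 [:: l0; l1; l2; l3; l4] i.

(** At t_i only the term of l_i survives. At 0 the common factor -t_0 t_1 t_2 comes out and Cramer's
    rule gives l_3. The choice of t_i amounts to k_i = (b_i / D)(1 - t_i), so at 1 the factor (1 -
    t_0)(1 - t_1)(1 - t_2) comes out and leaves l_4. *)
Lemma conic_tangent i x : dot (ll i) x = ww i * (cpol x).[tt i].
Proof.
have [[h01 h02 h12 [n0 n1 n2]] [e0 e1 e2]] := tneq; have [q0 q1 q2] := k_neq0.
have [g01 g02 g12] : [/\ t1 - t0 != 0, t2 - t0 != 0 & t2 - t1 != 0].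
  by split; rewrite -opprB oppr_eq0.
have cE s : dot (cvec s) x = k0 * ((s - t1) * (s - t2)) * dot l0 x +
    k1 * ((s - t0) * (s - t2)) * dot l1 x + k2 * ((s - t0) * (s - t1)) * dot l2 x.
  by rewrite /cvec /dot /x0 /x1 /x2; ring.
rewrite cpol_horner cE.
have A3 (E A0 A1 A2 s0 s1 s2 u0 u1 u2 : K) : E != 0 -> s0 != 0 -> s1 != 0 -> s2 != 0 ->
    A0 * u0 + A1 * u1 + A2 * u2 = E * ((- (s0 * s1 * s2))^-1 *
      (- (A0 / E * s0) * ((0 - s1) * (0 - s2)) * u0 + - (A1 / E * s1) * ((0 - s0) * (0 - s2)) * u1
       + - (A2 / E * s2) * ((0 - s0) * (0 - s1)) * u2)).
  by move=> H1 H2 H3 H4; field; rewrite H1 oppr_eq0 !mulf_neq0.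
have A4 (E B0 B1 B2 s0 s1 s2 j0 j1 j2 u0 u1 u2 : K) : E != 0 -> 1 - s0 != 0 -> 1 - s1 != 0 -> 1 - s2 != 0 ->
    j0 = B0 / E * (1 - s0) -> j1 = B1 / E * (1 - s1) -> j2 = B2 / E * (1 - s2) ->
    B0 * u0 + B1 * u1 + B2 * u2 = E * (((1 - s0) * (1 - s1) * (1 - s2))^-1 *
      (j0 * ((1 - s1) * (1 - s2)) * u0 + j1 * ((1 - s0) * (1 - s2)) * u1
       + j2 * ((1 - s0) * (1 - s1)) * u2)).
  by move=> H1 H2 H3 H4 -> -> ->; field; rewrite ?H1 ?H2 ?H3 ?H4 ?mulf_neq0.
have kb (a b : K) : b - a != 0 -> - (a / D * (b / (b - a))) = b / D * (1 - b / (b - a)).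
  by move=> h; field; rewrite D0 h.
case: i => [[|[|[|[|[|]]]]]//= hi]; rewrite /ww /tt /ll /=.
- rewrite !subrr !(mul0r, mulr0) !addr0 mulKf ?mulf_neq0 ?mulf_neq0 //.
- rewrite !subrr !(mul0r, mulr0) !addr0 !add0r mulKf ?mulf_neq0 ?mulf_neq0 //.
- rewrite !subrr !(mul0r, mulr0) !add0r mulKf ?mulf_neq0 ?mulf_neq0 //.
- apply: (mulfI D0); rewrite cramer3; exact: A3.
- apply: (mulfI D0); rewrite cramer4; apply: A4 => //; exact: kb.
Qed.

(** The quartic has an infinite fibre: vectors with entries in a finite set represent only finitely
    many tangent lines, and [pencil_move] can avoid the corresponding parameters. *)
Lemma conic_move (S : seq K) : exists L : 'I_5 -> 'I_3 -> K,
  fam false L (@unitg 5) = fam false ll (@unitg 5) /\ exists i k, L i k \notin S.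
Proof.
have [[h01 h02 h12 [n0 n1 n2]] [e0 e1 e2]] := tneq; have [q0 q1 q2] := k_neq0.
pose la1 v := det3 v l1 l2; pose la2 v := det3 l0 v l2.
(* Up to common factors, the first two Cramer coordinates of the tangent line at s are k0 (s - t1)
   and k1 (s - t0). Hence [Zp v] vanishes at s if that line is proportional to [v]. *)
pose Zp v : {poly K} := if (la1 v == 0) && (la2 v == 0) then 1 else
  (la2 v * k0) *: ('X - t1%:P) - (la1 v * k1) *: ('X - t0%:P).
have Zp0 v : Zp v != 0.
  rewrite /Zp; case: ifP => [_|]; first exact: oner_neq0.
  move/negbT; rewrite negb_and => nz; apply/eqP => E.
  have E0 := congr1 (fun p : {poly K} => p.[t0]) E; have E1 := congr1 (fun p : {poly K} => p.[t1]) E.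
  move: E0 E1; rewrite !hornerD !hornerN !hornerZ !hornerXsubC !subrr !mulr0 subr0 sub0r !horner0.
  move=> /eqP E0 /eqP E1; move: E0 E1; rewrite oppr_eq0 !mulf_eq0 (negPf h01) (negPf q0) (negPf q1) !orbF.
  rewrite -opprB oppr_eq0 (negPf h01) orbF => z2 z1.
  by move: nz; rewrite z1 z2.
(* The factors at t1 and t2 keep the first Cramer coordinate of the new line nonzero, which excludes
   the default value 1 of [Zp] at this line. *)
pose Z := ('X - t1%:P) * ('X - t2%:P) *
  \prod_(a <- S) \prod_(b <- S) \prod_(c <- S) Zp (mk3 a b c).
have Z0 : Z != 0.
  rewrite !mulf_neq0 ?polyXsubC_eq0 // prodf_seq_neq0; apply/allP => a _ /=.
  rewrite prodf_seq_neq0; apply/allP => b _ /=.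
  by rewrite prodf_seq_neq0; apply/allP => c _ /=.
have [t' [w' [w'0 Zt' hQ]]] := pencil_move tt_inj ww_neq0 Z0.
pose L (i : 'I_5) k := w' i * cvec (t' i) k.
have dL i x : dot (L i) x = w' i * (cpol x).[t' i].
  by rewrite cpol_horner /L dotZ.
have pev C : polyfun (fun x : 'I_3 -> K => ev 4 C x).
  by apply: (@polyfun_ev K 'I_3 4 (fun=> C) id) => [a b|k]; [exact: polyfunC | exact: polyfun_coord].
have pdot v : polyfun (fun x : 'I_3 -> K => dot v x).
  by apply: (@polyfun_dot K 'I_3 (fun=> v) id) => k; [exact: polyfunC | exact: polyfun_coord].
exists L; split.
  apply: (@form_ext K 4); [exact: (@td_fam0 K 5) | exact: (@td_fam0 K 5) |].
  move=> x; apply/eqP; rewrite -subr_eq0; apply/eqP; move: x.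
  apply: (@polyfun_zero K 'I_3 _ ctop (cross l1 l2)).
  - by apply: polyfunB; apply: pev.
  - by rewrite /ctop; apply: polyfunD; [apply: polyfunD|]; apply: polyfunM; first [exact: polyfunC | exact: pdot].
  - by rewrite /ctop dot_cross_l dot_cross_r !mulr0 !addr0 mulf_neq0.
  move=> x hx; rewrite (ev_unit L) (ev_unit ll).
  rewrite (star_weights (Q := cpol x) w'0 (dL^~ x)).
  by rewrite (star_weights (Q := cpol x) ww_neq0 (conic_tangent^~ x)) hQ ?subrr // size_cpol.
apply: NNPP => hn; have {}hn i k : L i k \in S.
  by apply/negPn/negP => h; apply: hn; exists i, k.
pose s := t' ord0; pose v := L ord0.
have := Zt' ord0; rewrite -/s /Z !hornerM !mulf_eq0 !negb_or !hornerXsubC => /andP[/andP[s1 s2]].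
rewrite horner_prod prodf_seq_neq0 => /allP/(_ (x0 v) (hn _ _)) /=.
rewrite horner_prod prodf_seq_neq0 => /allP/(_ (x1 v) (hn _ _)) /=.
rewrite horner_prod prodf_seq_neq0 => /allP/(_ (x2 v) (hn _ _)) /=.
have -> : mk3 (x0 v) (x1 v) (x2 v) = v by apply: ext3; rewrite !mk3E.
have E1 : la1 v = w' ord0 * (k0 * ((s - t1) * (s - t2))) * D.
  by rewrite /la1 /D /v /L /cvec -/s !det3E /x0 /x1 /x2; ring.
have E2 : la2 v = w' ord0 * (k1 * ((s - t0) * (s - t2))) * D.
  by rewrite /la2 /D /v /L /cvec -/s !det3E /x0 /x1 /x2; ring.
have nz : la1 v != 0 by rewrite E1 !mulf_neq0.
rewrite /Zp (negPf nz) /= => /eqP; apply.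
by rewrite hornerD hornerN !hornerZ !hornerXsubC E1 E2; ring.
Qed.

End Conic.

End Quartic.

(** * Upper bound for quartics through five-line stars *)

Section QuarticBound.
Variable K : closedFieldType.

Lemma finite_roots (p : {poly K}) : p != 0 -> exists S : seq K, forall x, p.[x] = 0 -> x \in S.
Proof.
move=> p0; have [S E] := closed_field_poly_normal p; exists S => x /eqP.
rewrite E hornerZ mulf_eq0 lead_coef_eq0 (negPf p0) /= => hx.
by rewrite -root_prod_XsubC.
Qed.

(** If there are at least as many independent F_k as parameters, each parameter satisfies an
    algebraic equation over them. At a generic point these equations do not degenerate and leave
    finitely many values. *)
Lemma finite_fibre m r (F : 'I_r -> ('I_m -> K) -> K) (G : ('I_m -> K) -> K) : (m <= r)%N ->
  (forall k, polyfun (F k)) -> dense (fun w => exists y, w = fun k => F k y) ->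
  polyfun G -> (exists y, G y != 0) ->
  exists (y : 'I_m -> K) (S : seq K), G y != 0 /\
    forall y', (forall k, F k y' = F k y) -> forall c, y' c \in S.
Proof.
move=> mr FP dF GP Gn.
pose rel (c : 'I_m) (q : {mpoly K[r + 1]}) := q != 0 /\
  forall y, q.@[join_fun (fun k => F k y) (fun=> y c)] = 0.
have [q hq] : exists q : 'I_m -> {mpoly K[r + 1]}, forall c, rel c (q c).
  apply: (@fin_all_exists _ (fun=> {mpoly K[r + 1]}) rel) => c.
  have [k||p p0 hp] := @poly_dep K (r + 1) m (fun k y => join_fun (fun k => F k y) (fun=> y c) k).
  - by rewrite /join_fun; case: (split k) => k' //; apply: polyfun_coord.
  - by rewrite addn1.
  by exists p.
pose H (o : option 'I_m) (s : 'I_m + 'I_m -> K) := match o with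
  | Some c => (q c).@[fun k => join_fun (fun k => F k (fun j => s (inl j))) (fun=> s (inr c)) k]
  | None => G (fun j => s (inl j)) end.
have HP o : polyfun (H o).
  case: o => [c|] /=; last exact: (polyfun_reindex (f := G)).
  apply: polyfun_meval => k; rewrite /join_fun; case: (split k) => k'; last exact: polyfun_coord.
  exact: (polyfun_reindex (f := F k')).
have Hn o : exists s, H o s != 0.
  case: o => [c|] /=; last first.
    by have [y Gy] := Gn; exists (fun o => match o with inl j => y j | inr _ => 0 end).
  apply: NNPP => hn; have [/eqP q0 _] := hq c; apply: q0.
  apply: (dense_prod dF (@denseT K 1)) => z [[y Ez] _].
  pose s (o : 'I_m + 'I_m) := match o with inl j => y j | inr _ => z (rshift r ord0) end.
  apply/eqP/negPn/negP => nz; apply: hn; exists s => /=; apply: contraNneq nz => <-.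
  apply/eqP; apply: meval_eq => k; rewrite /join_fun; case: splitP => k' Ek.
    have -> : k = lshift 1 k' by apply: val_inj.
    exact: (congr1 (fun f => f k') Ez).
  by rewrite /s; congr z; apply: val_inj; rewrite /= Ek; case: k' {Ek} => [[]].
have [s hs] := polyfun_nz_prod HP Hn.
pose y j := s (inl j).
pose fin c (S : seq K) := forall x, (q c).@[fun k => join_fun (fun k => F k y) (fun=> x) k] = 0 -> x \in S.
have [S hS] : exists S : 'I_m -> seq K, forall c, fin c (S c).
  apply: (@fin_all_exists _ (fun=> seq K) fin) => c.
  have [e he] := HP (Some c).
  pose u (o : 'I_m + 'I_m) := match o with inl j => y j | inr _ => 0 end.
  pose v (o : 'I_m + 'I_m) : K := match o with inl j => 0 | inr _ => 1 end.
  have [p _ hp] := he u v.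
  have pE x : p.[x] = (q c).@[fun k => join_fun (fun k => F k y) (fun=> x) k].
    rewrite -hp /= mulr1 add0r; congr (meval _ (q c)).
    have -> : (fun j => y j + x * 0) = y by apply: functional_extensionality => j; rewrite mulr0 addr0.
    by [].
  have p0 : p != 0.
    apply: contraNneq (hs (Some c)) => p0 /=.
    by have := pE (s (inr c)); rewrite p0 horner0 => <-.
  by have [S hS] := finite_roots p0; exists S => x hx; apply: hS; rewrite pE.
exists y, (flatten [seq S c | c <- enum 'I_m]); split; first exact: (hs None).
move=> y' hy' c; apply/flattenP; exists (S c); first by apply: map_f; rewrite mem_enum.
apply: hS; rewrite -[RHS](proj2 (hq c) y').
by apply: meval_eq => k; rewrite /join_fun; case: (split k) => k'; rewrite ?hy'.
Qed.

Lemma fam_unit_scale l (s : 'I_l -> K) L : (forall i, s i != 0) ->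
  fam false (fun i k => s i * L i k) (@unitg K l) =
  fun a b => (\prod_i s i) * comb L (fun i => (s i)^-1) a b.
Proof.
move=> s0; apply: (@form_ext K (l - 1)); [exact: td_fam0 | exact/tdZ/td_comb |] => x.
rewrite evZ ev_comb mulr_sumr ev_fam0; apply: eq_bigr => i _; rewrite mk3E mul1r.
have -> : \prod_(k | k != i) dot (fun k0 => s k * L k k0) x =
    (\prod_(k | k != i) s k) * \prod_(k | k != i) dot (L k) x.
  by rewrite -big_split; apply: eq_bigr => k _; rewrite dotZ.
by rewrite [X in _ = X * _](bigD1 i) //= mulrACA divff // mul1r.
Qed.

(** Constants that are all nonzero disappear on dividing line i by g_i, up to a common factor. The
    3l coefficients of the lines therefore suffice as parameters. *)
Lemma fam_closure l (p : {mpoly K[nforms (l - 1)]}) : (2 <= l)%N -> hom_poly p ->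
  (forall L, p.@[vec (fam false L (@unitg K l))] = 0) ->
  forall v, pclosure (@Sdl K (l - 1) l) v -> p.@[v] = 0.
Proof.
move=> l2 hp hz v [_]; apply=> // {}v _ /Sdl_elim[L hL hI].
have [g Eg] := Idl_span l2 hL hI; rewrite -(unvecK v) Eg.
pose F (g : 'I_l -> K) := p.@[vec (comb L g)].
apply: (@polyfun_zero K 'I_l F (fun g => \prod_i g i) (fun=> 1)).
- apply: polyfun_meval => k; apply: polyfun_sum => i.
  by apply: polyfunM; [apply: polyfun_coord | apply: polyfunC].
- by apply: polyfun_prod => i; apply: polyfun_coord.
- by rewrite big1 ?oner_neq0.
move=> {Eg}g /prodf_neq0 g0; have {}g0 i : g i != 0 by apply: g0.
have s0 i : (g i)^-1 != 0 by rewrite invr_eq0.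
have := hz (fun i k => (g i)^-1 * L i k); rewrite fam_unit_scale //.
have [e he] := hom_poly_scale hp.
pose w := @vec K (l - 1) (comb L g).
have -> : vec (fun a b => (\prod_i (g i)^-1) * comb L (fun i => (g i)^-1^-1) a b) =
   fun j => (\prod_i (g i)^-1) * w j.
  apply: functional_extensionality => j; rewrite /w /vec; congr (_ * comb L _ _ _).
  by apply: functional_extensionality => i; rewrite invrK.
move/eqP; rewrite he mulf_eq0 expf_eq0 => /orP[/andP[_]|/eqP //].
by move=> /prodf_eq0[i _]; rewrite (negPf (s0 i)).
Qed.

(** The thirteen factors are the nondegeneracy hypotheses of [conic_move], in the same order. *)
Definition lurothG (L : 'I_5 -> 'I_3 -> K) : K :=
  let l0 := L ord0 in let l1 := L (inord 1) in let l2 := L (inord 2) in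
  let l3 := L (inord 3) in let l4 := L (inord 4) in
  \prod_(x <- [:: det3 l0 l1 l2; det3 l3 l1 l2; det3 l0 l3 l2; det3 l0 l1 l3;
    det3 l4 l1 l2; det3 l0 l4 l2; det3 l0 l1 l4;
    det3 l4 l1 l2 - det3 l3 l1 l2; det3 l0 l4 l2 - det3 l0 l3 l2; det3 l0 l1 l4 - det3 l0 l1 l3;
    det3 l3 l1 l2 * det3 l0 l4 l2 - det3 l0 l3 l2 * det3 l4 l1 l2;
    det3 l3 l1 l2 * det3 l0 l1 l4 - det3 l0 l1 l3 * det3 l4 l1 l2;
    det3 l0 l3 l2 * det3 l0 l1 l4 - det3 l0 l1 l3 * det3 l0 l4 l2]) x.

Lemma nth5 T (L : 'I_5 -> T) : (fun i : 'I_5 => nth (L ord0)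
  [:: L ord0; L (inord 1); L (inord 2); L (inord 3); L (inord 4)] i) = L.
Proof.
apply: functional_extensionality => -[[|[|[|[|[|]]]]]//= hi]; congr L; apply: val_inj;
  by rewrite /= ?inordK.
Qed.

Lemma luroth_fibre L : lurothG L != 0 -> forall S : seq K, exists L' : 'I_5 -> 'I_3 -> K,
  fam false L' (@unitg K 5) = fam false L (@unitg K 5) /\ exists i k, L' i k \notin S.
Proof.
rewrite /lurothG !big_cons big_nil mulr1 !mulf_eq0 !negb_or.
move=> /and5P[h1 h2 h3 h4 /and5P[h5 h6 h7 h8 /and5P[h9 h10 h11 h12 h13]]] S.
have := @conic_move K (L ord0) (L (inord 1)) (L (inord 2)) (L (inord 3)) (L (inord 4))
  h1 h2 h3 h4 h5 h6 h7 h8 h9 h10 h11 h12 h13 S.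
by rewrite nth5.
Qed.

Lemma luroth_nonempty : exists L, lurothG L != 0.
Proof.
have [s [us s0 ss]] := inj_points K 4.
case: s us s0 ss => [|a [|b [|c [|d []]]]] //= us s0 _.
(* For the coordinate lines, (a, a, a) and (b, c, d), the conditions reduce to a, b, c, d being
   nonzero and distinct. *)
pose l := [:: mk3 1 0 0; mk3 0 1 0; mk3 0 0 1; mk3 a a a; mk3 b c d] : seq ('I_3 -> K).
exists (fun i => nth (mk3 0 0 0) l i).
move: us s0; rewrite !inE !negb_or => /and4P[/and3P[ab ac ad] /andP[bc bd] cd _] /and4P[a0 b0 c0 d0].
have nz (x y : K) : x != y -> y - x != 0 by rewrite subr_eq0 eq_sym.
have nz0 (x : K) : 0 != x -> x != 0 by rewrite eq_sym.
rewrite prodf_seq_neq0 /lurothG /= !inordK //= !det3E !mk3E.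
rewrite !(mul0r, mulr0, mul1r, mulr1, subr0, sub0r, addr0, add0r, oppr0, opprK).
by rewrite -!mulrBr !mulf_eq0 !negb_or oner_neq0 !nz // !nz0.
Qed.

Definition lines15 (y : 'I_15 -> K) (i : 'I_5) (k : 'I_3) := y (inord (3 * i + k)).

Lemma lines15_surj L : exists y, lines15 y = L.
Proof.
exists (fun j => L (inord (j %/ 3)) (inord (j %% 3))).
apply: functional_extensionality => i; apply: functional_extensionality => k.
have hi := ltn_ord i; have hk := ltn_ord k.
rewrite /lines15 inordK; last by lia.
by congr L; apply: val_inj; rewrite /= inordK; lia.
Qed.

(** A chain of this length would give 15 independent functions of the 15 coefficients of the lines,
    hence generically finite fibres, against [luroth_fibre]. *)
Lemma quartic_upper : ~ pchain (pclosure (@Sdl K 4 5)) 14.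
Proof.
pose Phi (y : 'I_15 -> K) := @vec K 4 (fam false (lines15 y) (@unitg K 5)).
have PhiP j : polyfun (fun y => Phi y j).
  apply: (@pform_fam K 'I_15 false 5 (fun y => lines15 y) (fun=> @unitg K 5)) => i k.
    exact: polyfun_coord.
  exact: polyfunC.
move=> /(upper_chain (Phi := Phi)) H; have [||f hf] := H.
- move=> p hp hz; apply: (@fam_closure 5) => // L.
  by have [y <-] := lines15_surj L; apply: hz.
- move=> a y a0.
  (* The quartic has degree 4 in a common factor of the lines, so a scalar is realized by its fourth
     root. *)
  have [th hth] := @GRing.solve_monicpoly K 4 (fun i => if i == 0%N then a else 0) isT.
  have {}hth : th ^+ 4 = a.
    by rewrite hth big_ord_recl /= mulr1 big1 ?addr0 // => i _; rewrite mul0r.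
  have th0 : th != 0 by apply: contraNneq a0 => t0; rewrite -hth t0 expr0n.
  exists (fun j => th * y j); apply: functional_extensionality => j.
  rewrite /Phi /vec; set ab := nth _ _ _.
  rewrite (fam_unit_scale (lines15 y) (fun _ => th0)).
  have E1 : lines15 y = fun i k => 1 * lines15 y i k.
    by apply: functional_extensionality => i; apply: functional_extensionality => k; rewrite mul1r.
  rewrite [in RHS]E1 (fam_unit_scale (lines15 y) (fun _ => oner_neq0 _)) /comb.
  rewrite prodr_const card_ord [\prod_i 1]big1 // mul1r !mulr_sumr; apply: eq_bigr => i _.
  by rewrite invr1 mul1r exprSr hth mulrA mulfK.
pose F k y := (f k).@[Phi y].
have FP k : polyfun (F k) by apply: polyfun_meval.
have dF : dense (fun w => exists y, w = fun k => F k y).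
  by move=> q hq; apply: hf => y; apply: hq; exists y.
have Gn : exists y, lurothG (lines15 y) != 0.
  by have [L hL] := luroth_nonempty; have [y Ey] := lines15_surj L; exists y; rewrite Ey.
have GP : polyfun (fun y => lurothG (lines15 y)).
  have p i : pvec (fun y => lines15 y i) by move=> k; apply: polyfun_coord.
  have p3 i j k : polyfun (fun y => det3 (lines15 y i) (lines15 y j) (lines15 y k)) by apply: polyfun_det3.
  rewrite /lurothG; apply: (@polyfun_ext _ _ (fun y => _)).
    by move=> y; rewrite !big_cons big_nil.
  do !apply: polyfunM => //; try exact: polyfunC; apply: polyfunB => //; exact: polyfunM.
have [y [S [Gy hS]]] := finite_fibre (leqnn 15) FP dF GP Gn.
have [L' [E [i [k hk]]]] := luroth_fibre Gy S.
have [y' Ey'] := lines15_surj L'.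
case/negP: hk; rewrite -Ey'; apply: hS => c; congr (meval _ (f c)).
by rewrite /Phi Ey' E.
Qed.

End QuarticBound.

(** * Lower bound for quartics through five-line stars *)

Section QuarticLower.
Variable K : closedFieldType.

Lemma fam_vanish (e : bool) l n (J : 'I_n.+1 -> nat * nat) (p : {mpoly K[nforms (l - 1 + e)]}) :
  (2 <= l)%N -> @Dens K l (l - 1 + e) _ J -> hom_poly p ->
  (forall v, vnz v -> @Sdl K (l - 1 + e) l v -> p.@[v] = 0) ->
  forall L g : 'I_l -> 'I_3 -> K, p.@[vec (fam e L g)] = 0.
Proof.
move=> l2 hJ hp hS L g; have [G [Gp Gn GD]] := ex_Dstar K l.
pose F (Y : 'I_l * 'I_3 -> K) := p.@[vec (fam e (Lof Y) g)].
have FP : polyfun F.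
  apply: polyfun_meval => k; apply: (@pform_fam _ _ e l (@Lof K l) (fun=> g)) => i.
    exact: pvec_Lof.
  exact: pvec_const.
apply: (norm_lines FP Gp Gn (_ : _) (fun p => L p.1 p.2)) => s y s0 /GD/Dstar_good Dy.
apply: (Sdl_vanish l2 hJ hp hS Dy); rewrite vecK; last by have [] := fam_Idl e (Lof (fun p => s p.1 * Ln y p.1 p.2)) g.
by apply: (proj1 (@Idl_scale K l (l - 1 + e) s (Ln y) _ s0)); apply: fam_Idl.
Qed.

(** Deleting a parameter from every term sets it to 1; the index 15 in front of every term
    multiplies the whole form by y_15. *)
Definition sdiag5 : sform := [seq (t.1, 15%N :: [seq i <- t.2 | (i != 13)%N && (i != 8)%N]) | t <- sdiag 5].

(* Setting y_8 = y_13 = 1 keeps the coefficients independent; y_15 is the scalar of the cone. *)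
Definition free5 : seq nat := [:: 0; 1; 2; 3; 4; 5; 6; 7; 9; 10; 11; 12; 14]%N.
Definition norm5 (y : nat -> K) i := if (i != 13%N) && (i != 8%N) then y i else 1.
Definition fill5 (y : 'I_13 -> K) i := norm5 (fun i => y (inord (index i free5))) i.

Lemma fill5K y i : (i < 15)%N -> fill5 (fun j => y (nth 0%N free5 j)) i = norm5 y i.
Proof.
move=> hi; rewrite /fill5 /norm5; case: ifP => [hi'|_]; last by [].
have im : i \in free5.
  have /allP/(_ i) : all (fun i => (i != 13) && (i != 8) ==> (i \in free5))%N (iota 0 15) by [].
  by rewrite mem_iota hi => /(_ isT)/implyP/(_ hi').
rewrite inordK; last by rewrite -[13%N]/(size free5) index_mem.
by rewrite nth_index.
Qed.

Lemma scoef_sdiag5 y a b : scoef sdiag5 y a b = y 15%N * scoef (sdiag 5) (norm5 y) a b.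
Proof.
rewrite /scoef /sdiag5 big_map mulr_sumr; apply: eq_bigr => t _.
rewrite /tcoef /= big_cons big_filter mulrCA; congr (_ * (_ * _)).
rewrite big_mkcond; apply: eq_bigr => i _.
by rewrite /norm5; case: ifP.
Qed.

Lemma scoef_sdiag_ext y z : (forall i, (i < 15)%N -> y i = z i) ->
  scoef (sdiag 5) y = scoef (sdiag 5) z :> (nat -> nat -> K).
Proof.
move=> E; apply: functional_extensionality => a; apply: functional_extensionality => b.
have hb : all (fun t : term => all (fun i => i < 15)%N t.2) (sdiag 5) by vm_compute.
rewrite /scoef [LHS]big_seq_cond [RHS]big_seq_cond; apply: eq_bigr => t /andP[/(allP hb) ht _].
by rewrite /tcoef !big_seq; congr (_ * _); apply: eq_bigr => i /(allP ht)/E.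
Qed.

Lemma sdiag5_fam y : scoef (sdiag 5) y = fam false (@diagL K 5 y) (@unitg K 5).
Proof. by apply: diag_fam => //; vm_compute. Qed.

Lemma dense_sdiag5 : dense (fun w : 'I_14 -> K => exists y : nat -> K, w = fun k =>
    y 15%N * scoef (sdiag 5) (norm5 y) (nth (0, 0)%N idx_5 k).1 (nth (0, 0)%N idx_5 k).2).
Proof.
have hc : trop_check sdiag5 om_5 idx_5 wt_5 inv_5 2 by vm_compute.
apply: dense_sub (@trop_dense K _ _ _ _ _ _ hc) => _ [y ->]; exists y.
by apply: functional_extensionality => k; rewrite scoef_sdiag5.
Qed.

Lemma dense5 : DensFull K false 5 (fun k : 'I_14 => nth (0, 0)%N idx_5 k).
Proof.
apply: dense_sub dense_sdiag5 => _ [y ->].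
exists (@diagL K 5 (norm5 y)), (fun=> mk3 (y 15%N) 0 0).
apply: functional_extensionality => k; rewrite sdiag5_fam /fam mulr_sumr.
by apply: eq_bigr => i _; rewrite /gmul !mk3E mul1r.
Qed.

(** 13 parameters and the scalar of the cone give 14 independent coefficients out of 15. *)
Lemma quartic_lower : pchain (pclosure (@Sdl K 4 5)) 13.
Proof.
have hJ := DensFull_Dens dense5; have [J' hJ'] := Dens_coord hJ.
pose psi (y : 'I_13 -> K) := @vec K 4 (scoef (sdiag 5) (fill5 y)).
have hT : shomog 4 (sdiag 5) by vm_compute.
have psiP j : polyfun (fun y => psi y j).
  apply: polyfun_sum => t; apply: polyfunM; first exact: polyfunC.
  apply: polyfun_prod => i; rewrite /fill5 /norm5; case: ((i != 13%N) && (i != 8%N)).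
    exact: polyfun_coord.
  exact: polyfunC.
apply: (@lower_chain K _ 13 psi J' psiP).
  apply: dense_sub dense_sdiag5 => _ [y ->].
  exists (y 15%N), (fun j => y (nth 0%N free5 j)); apply: functional_extensionality => k.
  rewrite /psi hJ'; last exact: td_scoef.
  congr (_ * _); set a := _.1; set b := _.2.
  suff -> : scoef (sdiag 5) (norm5 y) = scoef (sdiag 5) (fill5 (fun j => y (nth 0%N free5 j))) by [].
  by apply: scoef_sdiag_ext => i /fill5K ->.
have pz p : hom_poly p -> (forall v, vnz v -> @Sdl K 4 5 v -> p.@[v] = 0) -> forall y, p.@[psi y] = 0.
  move=> hp hS y; rewrite /psi sdiag5_fam.
  exact: (@fam_vanish false 5 _ _ p isT hJ hp hS (@diagL K 5 (fill5 y)) (@unitg K 5)).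
move=> v [vn hv]; split; first exact: vn.
move=> p hp hS; apply: (hv p hp) => w w0 hw.
exact: (cone_vanish hp (pz p hp hS) w0 hw).
Qed.

End QuarticLower.

(** * Dimensions *)

Section Dominant.
Variable K : closedFieldType.

(** Projective space is the cone over the affine chart where the first coordinate is 1. *)
Lemma full_lower N r (Z : ('I_N -> K) -> Prop) : N = r.+1 -> (forall v, vnz v -> Z v) -> pchain Z r.
Proof.
move=> E hZ; subst N.
pose psi (y : 'I_r -> K) (j : 'I_r.+1) := oapp y 1 (unlift ord0 j).
apply: (@lower_chain K _ r psi id).
- by move=> j; rewrite /psi; case: (unlift _ _) => [i|]; [apply: polyfun_coord | apply: polyfunC].
- have X0 : 'X_ord0 != 0 :> {mpoly K[r.+1]}.
    by apply/eqP => /(congr1 (meval (fun=> 1))); rewrite mevalXU meval0 => /eqP; rewrite oner_eq0.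
  apply: dense_sub (dense_open X0 (@denseT K r.+1)) => z [_]; rewrite mevalXU => z0.
  exists (z ord0), (fun j => z (lift ord0 j) / z ord0); apply: functional_extensionality => k.
  by rewrite /psi; case: unliftP => [j ->|->] /=; rewrite ?mulr1 // mulrC divfK.
by move=> v [/hZ].
Qed.

Lemma full_upper N r (Z : ('I_N -> K) -> Prop) : (N <= r)%N -> ~ pchain Z r.
Proof.
move=> Nr /(upper_chain (Phi := id)) H; have [||f hf] := H.
- by move=> p _ hp v _; apply: hp.
- by move=> a y _; exists (fun j => a * y j).
have [||p p0 hp] := @poly_dep K r.+1 N (fun k y => (f k).@[y]).
- by move=> k; apply: polyfun_meval => i; apply: polyfun_coord.
- by [].
by move: p0; rewrite (hf p) ?eqxx.
Qed.

(** With as many independent coefficients as monomials, [J'] is injective and hence a permutation,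
    so a homogeneous equation of S(d,l) is the zero polynomial. *)
Lemma full_closure d l (J : 'I_(nforms d) -> nat * nat) : (2 <= l)%N -> @Dens K l d _ J ->
  forall v, vnz v -> pclosure (@Sdl K d l) v.
Proof.
move=> l2 hJ v vn; split=> // p hp hS.
have [J' hJ'] := Dens_coord hJ; have [G [Gp Gn GD]] := ex_Dstar K l.
have dJ := hJ G Gp Gn.
have iJ : injective J'.
  move=> k k' E; apply: (dense_inj dJ) => _ [y [C [_ [tC _] ->]]].
  by rewrite -!hJ' // E.
have [J1 JK KJ] : bijective J' by apply: injF_bij.
pose q : {mpoly K[nforms d]} := p \mPo [tuple 'X_(J1 m) | m < nforms d].
have qE w : q.@[w] = p.@[fun m => w (J1 m)].
  by rewrite comp_mpoly_meval; apply: meval_eq => i; rewrite tnth_mktuple mevalXU.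
have q0 : q = 0.
  apply: dJ => _ [y [C [/GD/Dstar_good Dy [tC hC] ->]]]; rewrite qE.
  have N0 : (0 < nforms d)%N by rewrite size_mons bin_gt0.
  have [n En] : exists n, nforms d = n.+1 by exists (nforms d).-1; rewrite prednK.
  have E : (fun m => C (J (J1 m)).1 (J (J1 m)).2) = @vec K d C.
    by apply: functional_extensionality => m; rewrite -hJ' // KJ.
  rewrite E; pose Jn (i : 'I_n.+1) := J (cast_ord (esym En) i).
  have hJn : @Dens K l d _ Jn.
    move=> G' Gp' Gn'; have := hJ G' Gp' Gn'; rewrite /Jn; move: En J {hJ Jn hJ' E}.
    move: (nforms d) => N En; subst N => J hJ; apply: dense_sub hJ => _ [y' [C' [h1 h2 ->]]].
    exists y', C'; split=> //; apply: functional_extensionality => k.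
    by rewrite cast_ord_id.
  by apply: (Sdl_vanish l2 hJn hp hS Dy); rewrite vecK.
have := qE (fun k => v (J' k)); rewrite q0 meval0.
have -> : (fun m => v (J' (J1 m))) = v by apply: functional_extensionality => m; rewrite KJ.
by move=> <-.
Qed.

Lemma nformsS d : nforms d.+1 = (nforms d + d.+2)%N.
Proof. by rewrite !size_mons binS bin1 addnC. Qed.

(** Each degree adds as many independent coefficients as there are new monomials, so the number of
    missing ones stays constant. *)
Lemma Dens_up l d k n (J : 'I_n -> nat * nat) : (2 <= l)%N -> (l - 1 <= d)%N -> @Dens K l d n J ->
  exists n' (J' : 'I_n' -> nat * nat), (n' + nforms d = n + nforms (d + k))%N /\ @Dens K l (d + k) n' J'.
Proof.
move=> l2 ld hJ; elim: k => [|k [n' [J' [En hJ']]]]; first by rewrite addn0; exists n, J.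
rewrite addnS nformsS; exists (n' + (d + k).+2)%N, (join_idx J' (fun b : 'I_(d + k).+2 => (b : nat, (d + k).+1 - b)%N)); split; last first.
  by apply: Dens_succ hJ' => //; lia.
by lia.
Qed.

Lemma full_dim l d0 d (J : 'I_(nforms d0) -> nat * nat) : (2 <= l)%N -> (l - 1 <= d0)%N ->
  (d0 <= d)%N -> @Dens K l d0 _ J -> pdim_eq (@Sdl K d l) ('C(d.+2, 2) - 1).
Proof.
move=> l2 ld0 dd hJ; have [n [J' [En hJ']]] := Dens_up (d - d0) l2 ld0 hJ.
move: En hJ'; rewrite subnKC // => En; have {}En : n = nforms d by lia.
subst n => hJ'.
have N0 : (0 < 'C(d.+2, 2))%N by rewrite bin_gt0.
split; first by apply: full_lower (full_closure l2 hJ'); rewrite size_mons; lia.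
by apply: full_upper; rewrite size_mons; lia.
Qed.

(** From 18 coefficients for l = 6, three more with each line: 3l in all, which is the number of
    coefficients of the lines. *)
Lemma DensFull_up k : exists (n : nat) (J : 'I_n -> nat * nat), n = (18 + 3 * k)%N /\ DensFull K false (6 + k) J.
Proof.
elim: k => [|k [n [J [En hJ]]]].
  by exists 18%N, (fun k : 'I_18 => nth (0, 0)%N idx_6 k); split=> //; apply: dense6.
rewrite addnS; exists (n + 3)%N, (join_idx J (@newidx (6 + k))); split; last first.
  by apply: DensFull_adjoin hJ.
by lia.
Qed.

Lemma large_dim l d : (6 <= l)%N -> (l - 1 <= d)%N ->
  pdim_eq (@Sdl K d l) ('C(d.+2, 2) - 'C(l, 2) + 2 * l - 1).
Proof.
move=> l6 ld; have l2 : (2 <= l)%N by lia.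
have [n [J [En hJ]]] := DensFull_up (l - 6).
move: hJ; rewrite subnKC // => /DensFull_Dens hJ.
have [n' [J' [En' hJ']]] := Dens_up (d - (l - 1 + false)) l2 (leq_addr _ _) hJ.
move: En' hJ'; rewrite addn0 subnKC // => En' hJ'.
have Eb : nforms (l - 1) = ('C(l, 2) + l)%N.
  have [m Em] : exists m, l = m.+1 by exists l.-1; lia.
  by rewrite size_mons Em subn1 /= binS bin1.
have le : ('C(l, 2) <= 'C(d.+2, 2))%N by apply: leq_bin2l; lia.
have ln : (0 < n')%N by move: En'; rewrite Eb size_mons; lia.
case: n' ln J' En' hJ' => // n' _ J' En' hJ'.
(* In degree l-1 the count 3l equals 2l + N - binom(l,2), because N - binom(l,2) = l there; both
   sides then grow equally with d. *)
have E : n'.+1 = (l + l + (nforms d - #|{: pairs l}|))%N.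
  by rewrite card_pairs; move: En'; rewrite Eb size_mons; lia.
have E2 : ('C(d.+2, 2) - 'C(l, 2) + 2 * l - 1 = n')%N.
  by move: E; rewrite card_pairs size_mons; lia.
have ld2 : (l <= d + 2)%N by lia.
split; rewrite E2; first exact: expected_lower hJ'.
by apply: expected_upper => //; rewrite -E.
Qed.

End Dominant.

Theorem theorem1p1 (K : closedFieldType) (d l : nat) :
  (2 <= l)%N ->
  ((d < l - 1)%N -> forall c : 'I_(nforms d) -> K, ~ @Sdl K d l c) /\
  ((l - 1 <= d)%N -> pdim_eq (@Sdl K d l) (expected_dim d l)).
Proof.
move=> l2; split=> [dl c Sc|ld].
  have [[i ci] _] := Sc; have [L hL hc] := Sdl_elim Sc.
  case/eqP: ci; rewrite -(unvecK c) /vec.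
  exact: (Idl_empty l2 dl hL hc).
rewrite /expected_dim; case: leqP => [l4|l5].
  have : (l == 2) || (l == 3) || (l == 4) by lia.
  have nf0 k : nforms k = 'C(k.+2, 2) by apply: size_mons.
  case/orP => [/orP[]|] /eqP E; subst l.
  - exact: (full_dim (J := _) l2 _ ld (DensFull_Dens (@dense2 K))).
  - exact: (full_dim (J := _) l2 _ ld (DensFull_Dens (@dense3 K))).
  - exact: (full_dim (J := _) l2 _ ld (DensFull_Dens (@dense4 K))).
case: eqP => [E|/eqP ne]; last by apply: large_dim; lia.
subst l; case: eqP => [->|/eqP nd].
  by split; [exact: quartic_lower | exact: quartic_upper].
(* The induction on d starts in degree 5 here, since in degree 4 one coefficient is missing. *)
have d5 : (5 <= d)%N by lia.
exact: (full_dim (J := _) l2 _ d5 (DensFull_Dens (@dense55 K))).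
Qed.
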